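(* Let $R$ be a commutative Noetherian ring such that $X:=\operatorname{Spec} R$ is connected. Let $\mathcal T\subset D^b(\operatorname{coh} X)$ be a thick triangulated subcategory which is regular. Then $\mathcal T=0$ or $\mathcal T=D^b(\operatorname{coh} X)$.
   Context: $D^b(\operatorname{coh} X)$ is the bounded derived category of coherent sheaves on $X$; for $X=\operatorname{Spec} R$ it is equivalent to $D^b(R\text{-mod})$, the bounded derived category of finitely generated $R$-modules. A full triangulated subcategory $\mathcal T'\subset\mathcal T$ of a triangulated category is thick if every object of $\mathcal T$ that is a direct summand of an object of $\mathcal T'$ belongs to $\mathcal T'$. For an object $G$ of a triangulated category $\mathcal T$: $[G]_0$ is the full subcategory of (objects isomorphic to) finite direct sums of shifts of $G$; for $k\ge 1$, $[G]_k$ is the full subcategory of objects $F$ for which there is a distinguished triangle $F_{k-1}\to F\to F_0\to F_{k-1}[1]$ with $F_0\in[G]_0$ and $F_{k-1}\in[G]_{k-1}$; and $\langle G\rangle_n$ is the full subcategory of direct summands in $\mathcal T$ of objects of $[G]_n$. An object $G$ is a strong generator of $\mathcal T$ if $\mathcal T=\langle G\rangle_n$ for some $n$. A triangulated category is regular if it has a strong generator. *)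

(* Defs.v *)
From HB Require Import structures.
From mathcomp Require Import all_boot all_order all_algebra zify.
From mathcomp Require Import boolp classical_sets topology.
Set Implicit Arguments.
Unset Strict Implicit.
Unset Printing Implicit Defensive.
Import GRing.Theory.
Local Open Scope ring_scope.
Local Open Scope classical_set_scope.

(** Rings are [comPzRingType], so the zero ring (whose spectrum is empty) is
    allowed; mathcomp's [idealr] and [prime_idealr] exclude it and are
    restricted to proper ideals, hence the set-based versions below. *)

Record is_ideal (R : comPzRingType) (I : set R) : Prop := IsIdeal {
  ideal0 : I 0;
  idealD : forall x y, I x -> I y -> I (x + y);
  idealM : forall a x, I x -> I (a * x) }.

Definition noetherian_ring (R : comPzRingType) : Prop :=
  forall I : set R, is_ideal I ->
    exists (n : nat) (g : 'I_n -> R), (forall k, I (g k)) /\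
      forall x, I x -> exists c : 'I_n -> R, x = \sum_k c k * g k.

Record Spec (R : comPzRingType) := MkSpec {
  spec_set :> set R;
  spec_ideal : is_ideal spec_set;
  spec_proper : ~ spec_set 1;
  spec_prime : forall x y, spec_set (x * y) -> spec_set x \/ spec_set y }.

HB.instance Definition _ (R : comPzRingType) := gen_eqMixin (Spec R).
HB.instance Definition _ (R : comPzRingType) := gen_choiceMixin (Spec R).

(** The closed sets are the [V(S) = {p | S `<=` p}], for [S] a subset of [R]. *)
Definition zariski_open (R : comPzRingType) (U : set (Spec R)) : Prop :=
  exists S : set R, U = ~` [set p : Spec R | S `<=` p].

Section Zariski.
Variable R : comPzRingType.

Lemma zariski_openT : zariski_open [set: Spec R].
Proof.
exists setT; rewrite -[LHS]setCK; congr (~` _); rewrite setCT.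
by apply/seteqP; split=> [p []|p /(_ 1 I)]; apply: spec_proper.
Qed.

Lemma zariski_openI : setI_closed (@zariski_open R).
Proof.
move=> _ _ [S ->] [T ->].
exists [set z | exists x y, [/\ S x, T y & z = x * y]].
rewrite -setCU; congr (~` _); apply/seteqP; split=> p.
  case=> sp z [x [y [Sx Ty ->]]]; last exact: idealM (spec_ideal p) _ _ (sp _ Ty).
  by rewrite mulrC; apply: idealM (spec_ideal p) _ _ (sp _ Sx).
move=> sp /=; apply: contrapT => /not_orP[nS nT]; apply: nS => x Sx.
apply: contrapT => npx; apply: nT => y Ty.
by have [|//|] := @spec_prime _ p x y; first by apply: sp; exists x, y.
Qed.

Lemma zariski_open_bigU (I : Type) (f : I -> set (Spec R)) :
  (forall i, zariski_open (f i)) -> zariski_open (\bigcup_i f i).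
Proof.
move=> /choice[S fE]; exists (\bigcup_i S i); apply/seteqP; split=> p.
  by case=> i _; rewrite fE => nS sp; apply: nS => x Sx; apply: sp; exists i.
move=> nS; apply: contrapT => nf; apply: nS => x [i _ Six].
apply: contrapT => npx; apply: nf; exists i => //; rewrite fE.
by move=> /(_ x Six).
Qed.

HB.instance Definition _ := isOpenTopological.Build (Spec R)
  zariski_openT zariski_openI zariski_open_bigU.

End Zariski.

Definition fin_gen (R : comPzRingType) (M : lmodType R) : Prop :=
  exists (n : nat) (g : 'I_n -> M),
    forall x, exists c : 'I_n -> R, x = \sum_k c k *: g k.

Record bcomplex (R : comPzRingType) := BComplex {
  cterm :> int -> lmodType R;
  diff : forall i : int, {linear cterm i -> cterm (i + 1)};
  diff_diff : forall i (x : cterm i), diff (i + 1) (diff i x) = 0;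
  cterm_bounded : exists N : nat,
    forall i : int, (N < absz i)%N -> forall x : cterm i, x = 0;
  cterm_fg : forall i, fin_gen (cterm i) }.
Arguments diff {R} X {i} : rename.

Record chain_map (R : comPzRingType) (X Y : bcomplex R) := ChainMap {
  cmap :> forall i : int, {linear X i -> Y i};
  cmap_diff : forall i (x : X i), cmap (i + 1) (diff X x) = diff Y (cmap i x) }.

(** Cohomology in degree [i + 1] (that is, in every degree) is cocycles modulo
    the image of [diff]; the two clauses are injectivity and surjectivity of
    the map induced by [f]. *)
Definition quasi_iso (R : comPzRingType) (X Y : bcomplex R)
    (f : chain_map X Y) : Prop :=
  forall i : int,
    (forall x : X (i + 1), diff X x = 0 ->
       (exists y : Y i, f (i + 1) x = diff Y y) ->
       exists x' : X i, x = diff X x') /\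
    (forall y : Y (i + 1), diff Y y = 0 ->
       exists2 x : X (i + 1), diff X x = 0 &
         exists y' : Y i, y - f (i + 1) x = diff Y y').

Section Complexes.
Variable R : comPzRingType.
Implicit Types (X Y Z : bcomplex R) (M N : lmodType R).

Definition idc X : chain_map X X :=
  @ChainMap R X X (fun i => idfun) (fun i x => erefl).

Lemma compc_diff X Y Z (g : chain_map Y Z) (f : chain_map X Y) i (x : X i) :
  (g (i + 1) \o f (i + 1)) (diff X x) = diff Z ((g i \o f i) x).
Proof. by rewrite /= !cmap_diff. Qed.

Definition compc X Y Z (g : chain_map Y Z) (f : chain_map X Y) :
    chain_map X Z :=
  @ChainMap R X Z (fun i => g i \o f i) (compc_diff g f).

Lemma fin_gen_prod M N : fin_gen M -> fin_gen N -> fin_gen (M * N)%type.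
Proof.
move=> [m [g gP]] [n [h hP]].
exists (m + n)%N, (fun k => match split k with
  inl a => (g a, 0) | inr b => (0, h b) end) => -[x y].
have [c ->] := gP x; have [e ->] := hP y.
exists (fun k => match split k with inl a => c a | inr b => e b end).
rewrite big_split_ord /=.
have sumE (p : nat) (u : 'I_p -> M) (v : 'I_p -> N) :
    \sum_k (u k, v k) = (\sum_k u k, \sum_k v k) :> (M * N)%type.
  elim: p u v => [|p IHp] u v; first by rewrite !big_ord0.
  by rewrite !big_ord_recr /= IHp.
rewrite (eq_bigr (fun k => (c k *: g k, 0) : (M * N)%type)); last first.
  move=> k _; have /= -> := unsplitK (inl k : 'I_m + 'I_n).
  by apply: (congr2 pair); rewrite /= ?scaler0.
rewrite [X in _ = _ + X](eq_bigr (fun k => (0, e k *: h k) : (M * N)%type)).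
  rewrite !sumE; apply: (congr2 pair) => /=.
    by rewrite [X in _ = _ + X]big1 ?addr0.
  by rewrite [X in _ = X + _]big1 ?add0r.
move=> k _; have /= -> := unsplitK (inr k : 'I_m + 'I_n).
by apply: (congr2 pair); rewrite /= ?scaler0.
Qed.

Definition zero_term (_ : int) : lmodType R := 'rV[R]_0.

Lemma zero_diff_diff i (x : zero_term i) :
  (\0 : {linear zero_term (i + 1) -> zero_term (i + 1 + 1)})
    ((\0 : {linear zero_term i -> zero_term (i + 1)}) x) = 0.
Proof. by []. Qed.

Lemma zero_bounded : exists N : nat,
  forall i : int, (N < absz i)%N -> forall x : zero_term i, x = 0.
Proof. by exists 0%N => i _ x; rewrite thinmx0. Qed.

Lemma zero_fg i : fin_gen (zero_term i).
Proof.
exists 0%N, (fun=> 0) => x; exists (fun=> 0).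
by rewrite big_ord0; apply: thinmx0.
Qed.

Definition zeroc : bcomplex R :=
  @BComplex R zero_term _ zero_diff_diff zero_bounded zero_fg.

Section DirectSum.
Variables X Y : bcomplex R.

Definition dsum_term (i : int) : lmodType R := (X i * Y i)%type.

Definition dsum_diff_fun i (p : dsum_term i) : dsum_term (i + 1) :=
  (diff X p.1, diff Y p.2).

Lemma dsum_diff_linear i : linear (@dsum_diff_fun i).
Proof. by move=> a p q; apply: (congr2 pair); rewrite linearP. Qed.

HB.instance Definition _ i := GRing.isLinear.Build R
  (dsum_term i) (dsum_term (i + 1)) _ (@dsum_diff_fun i) (@dsum_diff_linear i).

Lemma dsum_diff_diff i (p : dsum_term i) :
  dsum_diff_fun (dsum_diff_fun p) = 0.
Proof. by apply: (congr2 pair); rewrite diff_diff. Qed.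

Lemma dsum_bounded : exists N : nat,
  forall i : int, (N < absz i)%N -> forall p : dsum_term i, p = 0.
Proof.
have [m mP] := cterm_bounded X; have [n nP] := cterm_bounded Y.
exists (maxn m n) => i; rewrite gtn_max => /andP[mi ni] [x y].
by rewrite (mP _ mi x) (nP _ ni y).
Qed.

Lemma dsum_fg i : fin_gen (dsum_term i).
Proof. by apply: fin_gen_prod; apply: cterm_fg. Qed.

Definition dsum : bcomplex R :=
  @BComplex R dsum_term (fun i => @dsum_diff_fun i)
    dsum_diff_diff dsum_bounded dsum_fg.

End DirectSum.

Section Cast.
Variable X : int -> lmodType R.

Definition cast i j (e : i = j) : X i -> X j :=
  match e in _ = k return X i -> X k with erefl => id end.

Lemma cast_linear i j (e : i = j) : linear (cast e).
Proof. by destruct e. Qed.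

HB.instance Definition _ i j (e : i = j) :=
  GRing.isLinear.Build R (X i) (X j) _ (cast e) (cast_linear e).

Lemma cast_id i (e : i = i) x : cast e x = x.
Proof. by rewrite (eq_axiomK e). Qed.

Lemma cast_comp i j k (e : i = j) (e' : j = k) x :
  cast e' (cast e x) = cast (etrans e e') x.
Proof. by destruct e', e. Qed.

End Cast.

Lemma cast_diff X i j (e : i = j) (e' : i + 1 = j + 1) (x : X i) :
  diff X (cast e x) = cast e' (diff X x).
Proof. by destruct e; rewrite !cast_id. Qed.

Lemma cast_cmap X Y (f : chain_map X Y) i j (e : i = j) (x : X i) :
  f j (cast e x) = cast e (f i x).
Proof. by destruct e. Qed.

(** [X[n]], with terms [X (i + n)] and differential [(-1)^n d]; the cast is
    along the identity [i + n + 1 = i + 1 + n]. *)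
Section Shift.
Variable n : int.

Definition shift_term X (i : int) : lmodType R := X (i + n).

Definition shift_diff_fun X i (x : shift_term X i) : shift_term X (i + 1) :=
  (-1) ^+ absz n *: cast (addrAC i n 1) (diff X x).

Lemma shift_diff_linear X i : linear (@shift_diff_fun X i).
Proof.
move=> a x y; rewrite /shift_diff_fun.
rewrite (linearP (@diff R X (i + n))) (linearP (cast _)) scalerDr !scalerA.
by rewrite [a * _]mulrC.
Qed.

HB.instance Definition _ X i := GRing.isLinear.Build R
  (shift_term X i) (shift_term X (i + 1)) _
  (@shift_diff_fun X i) (@shift_diff_linear X i).

Lemma shift_diff_diff X i (x : shift_term X i) :
  shift_diff_fun (shift_diff_fun x) = 0.
Proof.
rewrite /shift_diff_fun linearZ /= (cast_diff _ (congr1 (+%R^~ 1) (addrAC i n 1))).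
by rewrite diff_diff !(linear0, scaler0).
Qed.

Lemma shift_bounded X : exists N : nat,
  forall i : int, (N < absz i)%N -> forall x : shift_term X i, x = 0.
Proof.
have [m mP] := cterm_bounded X; exists (m + absz n)%N => i mi x.
by apply: mP; lia.
Qed.

Lemma shift_fg X i : fin_gen (shift_term X i).
Proof. exact: cterm_fg. Qed.

Definition shift X : bcomplex R :=
  @BComplex R (shift_term X) (fun i => @shift_diff_fun X i)
    (@shift_diff_diff X) (shift_bounded X) (@shift_fg X).

Lemma shiftc_diff X Y (f : chain_map X Y) i (x : shift X i) :
  f (i + 1 + n) (diff (shift X) x) = diff (shift Y) (f (i + n) x).
Proof.
by rewrite /= /shift_diff_fun linearZ cast_cmap cmap_diff.
Qed.

Definition shiftc X Y (f : chain_map X Y) : chain_map (shift X) (shift Y) :=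
  @ChainMap R (shift X) (shift Y) (fun i => f (i + n)) (shiftc_diff f).

Lemma shift_diffE X i (x : X (i + n)) :
  diff (shift X) (x : shift X i)
  = (-1) ^+ absz n *: cast (addrAC i n 1) (diff X x).
Proof. by []. Qed.

Lemma signZK (M : lmodType R) (m : nat) (x : M) :
  (-1) ^+ m *: ((-1) ^+ m *: x) = x.
Proof. by rewrite scalerA -exprD addnn -mul2n exprM sqrrN !expr1n scale1r. Qed.

Lemma quasi_iso_shift X Y (f : chain_map X Y) :
  quasi_iso f -> quasi_iso (shiftc f).
Proof.
move=> qf i; have [injf surf] := qf (i + n).
pose e : i + n + 1 = i + 1 + n := addrAC i n 1.
have cK (Z : bcomplex R) (x : Z (i + n + 1)) : cast (esym e) (cast e x) = x.
  by rewrite cast_comp cast_id.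
have cKV (Z : bcomplex R) (x : Z (i + 1 + n)) : cast e (cast (esym e) x) = x.
  by rewrite cast_comp cast_id.
have cyc (Z : bcomplex R) (x : Z (i + n + 1)) :
    diff (shift Z) (cast e x : shift Z (i + 1)) = 0 <-> diff Z x = 0.
  rewrite shift_diffE (cast_diff _ (congr1 (+%R^~ 1) e)) cast_comp.
  split=> [|->]; last by rewrite linear0 scaler0.
  move=> /(congr1 (fun z => (-1) ^+ absz n *: z)); rewrite signZK scaler0.
  set e1 := etrans _ _ => /(congr1 (cast (esym e1))).
  by rewrite cast_comp cast_id linear0.
have bnd (Z : bcomplex R) (x : Z (i + n + 1)) :
    (exists y : shift Z i, cast e x = diff (shift Z) y) <->
    (exists y : Z (i + n), x = diff Z y).
  split=> -[y]; rewrite ?shift_diffE => xE; exists ((-1) ^+ absz n *: y).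
    by rewrite linearZ -(cK _ x) xE linearZ /= cK.
  by rewrite shift_diffE !linearZ /= signZK xE.
split.
  move=> x; rewrite -(cKV _ x) => /cyc dx; rewrite [shiftc f _ _]cast_cmap.
  by move=> /bnd fx; apply/bnd/injf.
move=> y; rewrite -(cKV _ y) => /cyc /surf[x dx yx].
exists (cast e x); first exact/cyc.
by rewrite [shiftc f _ _]cast_cmap -(linearB (cast e)); apply/bnd.
Qed.

End Shift.

Section Cone.
Variables (X Y : bcomplex R) (f : chain_map X Y).

Definition cone_term (i : int) : lmodType R := (X (i + 1)%R * Y i)%type.

Definition cone_diff_fun i (p : cone_term i) : cone_term (i + 1) :=
  (- diff X p.1, f (i + 1) p.1 + diff Y p.2).

Lemma cone_diff_linear i : linear (@cone_diff_fun i).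
Proof.
move=> a p q; apply: (congr2 pair) => /=.
  by rewrite linearP opprD scalerN.
by rewrite !linearP scalerDr addrACA.
Qed.

HB.instance Definition _ i := GRing.isLinear.Build R
  (cone_term i) (cone_term (i + 1)) _ (@cone_diff_fun i) (@cone_diff_linear i).

Lemma cone_diff_diff i (p : cone_term i) : cone_diff_fun (cone_diff_fun p) = 0.
Proof.
apply: (congr2 pair) => /=; first by rewrite linearN diff_diff !oppr0.
by rewrite linearN linearD diff_diff addr0 cmap_diff addNr.
Qed.

Lemma cone_bounded : exists N : nat,
  forall i : int, (N < absz i)%N -> forall p : cone_term i, p = 0.
Proof.
have [m mP] := cterm_bounded X; have [n nP] := cterm_bounded Y.
exists (maxn m n).+1 => i mni [x y].
have mi : (m < absz (i + 1)%R)%N by lia.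
have ni : (n < absz i)%N by lia.
by rewrite (mP _ mi x) (nP _ ni y).
Qed.

Lemma cone_fg i : fin_gen (cone_term i).
Proof. by apply: fin_gen_prod; apply: cterm_fg. Qed.

Definition cone : bcomplex R :=
  @BComplex R cone_term (fun i => @cone_diff_fun i)
    cone_diff_diff cone_bounded cone_fg.

Definition cone_in_fun i (y : Y i) : cone i := (0, y).

Lemma cone_in_linear i : linear (@cone_in_fun i).
Proof. by move=> a x y; apply: (congr2 pair); rewrite //= scaler0 addr0. Qed.

HB.instance Definition _ i :=
  GRing.isLinear.Build R (Y i) (cone i) _ (@cone_in_fun i) (@cone_in_linear i).

Lemma cone_in_diff i (y : Y i) :
  cone_in_fun (diff Y y) = diff cone (cone_in_fun y).
Proof. by apply: (congr2 pair); rewrite /= linear0 ?oppr0 ?add0r. Qed.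

Definition cone_in : chain_map Y cone :=
  @ChainMap R Y cone (fun i => @cone_in_fun i) cone_in_diff.

Definition cone_out_fun i (p : cone i) : shift 1 X i := p.1.

Lemma cone_out_linear i : linear (@cone_out_fun i).
Proof. by []. Qed.

HB.instance Definition _ i := GRing.isLinear.Build R
  (cone i) (shift 1 X i) _ (@cone_out_fun i) (@cone_out_linear i).

Lemma cone_out_diff i (p : cone i) :
  cone_out_fun (diff cone p) = diff (shift 1 X) (cone_out_fun p).
Proof.
by rewrite shift_diffE cast_id expr1 scaleN1r.
Qed.

Definition cone_out : chain_map cone (shift 1 X) :=
  @ChainMap R cone (shift 1 X) (fun i => @cone_out_fun i) cone_out_diff.

End Cone.

End Complexes.
Arguments zeroc {R}.

(** [D^b(R-mod)] is the localization of the category of bounded complexes of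
    finitely generated modules at the quasi-isomorphisms.  Its objects are the
    bounded complexes; a morphism is an element of [dhom X Y] up to [deq]. *)

Inductive dhom (R : comPzRingType) : bcomplex R -> bcomplex R -> Type :=
| dmap X Y (f : chain_map X Y) : dhom X Y
| dinv X Y (s : chain_map X Y) (qs : quasi_iso s) : dhom Y X
| dcomp X Y Z (g : dhom Y Z) (f : dhom X Y) : dhom X Z.

Definition did (R : comPzRingType) (X : bcomplex R) : dhom X X := dmap (idc X).

Inductive deq (R : comPzRingType) :
    forall X Y : bcomplex R, dhom X Y -> dhom X Y -> Prop :=
| deq_refl X Y (f : dhom X Y) : deq f f
| deq_sym X Y (f g : dhom X Y) : deq f g -> deq g f
| deq_trans X Y (f g h : dhom X Y) : deq f g -> deq g h -> deq f h
| deq_comp X Y Z (g g' : dhom Y Z) (f f' : dhom X Y) :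
    deq g g' -> deq f f' -> deq (dcomp g f) (dcomp g' f')
| deq_compA X Y Z W (h : dhom Z W) (g : dhom Y Z) (f : dhom X Y) :
    deq (dcomp h (dcomp g f)) (dcomp (dcomp h g) f)
| deq_id_l X Y (f : dhom X Y) : deq (dcomp (did Y) f) f
| deq_id_r X Y (f : dhom X Y) : deq (dcomp f (did X)) f
| deq_ext X Y (f g : chain_map X Y) :
    (forall i x, f i x = g i x) -> deq (dmap f) (dmap g)
| deq_dmap_comp X Y Z (g : chain_map Y Z) (f : chain_map X Y) :
    deq (dmap (compc g f)) (dcomp (dmap g) (dmap f))
| deq_inv_l X Y (s : chain_map X Y) (qs : quasi_iso s) :
    deq (dcomp (dinv qs) (dmap s)) (did X)
| deq_inv_r X Y (s : chain_map X Y) (qs : quasi_iso s) :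
    deq (dcomp (dmap s) (dinv qs)) (did Y).

Fixpoint dshift (R : comPzRingType) (n : int) (X Y : bcomplex R)
    (f : dhom X Y) : dhom (shift n X) (shift n Y) :=
  match f with
  | dmap _ _ f => dmap (shiftc n f)
  | dinv _ _ _ qs => dinv (quasi_iso_shift n qs)
  | dcomp _ _ _ g f => dcomp (dshift n g) (dshift n f)
  end.

Section Triangulated.
Variable R : comPzRingType.
Implicit Types (X Y Z F E G : bcomplex R).

(** A full subcategory of [D^b(R-mod)], given by its objects. *)
Definition subcat := bcomplex R -> Prop.
Implicit Types T : subcat.

Definition is_diso X Y (f : dhom X Y) : Prop :=
  exists g : dhom Y X, deq (dcomp g f) (did X) /\ deq (dcomp f g) (did Y).

Definition diso X Y : Prop := exists f : dhom X Y, is_diso f.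

(** Triangles isomorphic to the triangle of a mapping cone. *)
Definition distinguished X Y Z
    (u : dhom X Y) (v : dhom Y Z) (w : dhom Z (shift 1 X)) : Prop :=
  exists (X' Y' : bcomplex R) (f : chain_map X' Y')
         (a : dhom X X') (b : dhom Y Y') (c : dhom Z (cone f)),
    [/\ is_diso a, is_diso b & is_diso c] /\
    [/\ deq (dcomp b u) (dcomp (dmap f) a),
        deq (dcomp c v) (dcomp (dmap (cone_in f)) b)
      & deq (dcomp (dshift 1 a) w) (dcomp (dmap (cone_out f)) c)].

(** [direct_summand_in T F E]: [F] is a direct summand, in the additive
    category [T], of [E]. *)
Definition direct_summand_in T F E : Prop :=
  T F /\ exists2 F', T F' & diso E (dsum F F').

Definition full_Db : subcat := fun=> True.

(** Full triangulated subcategories are closed under isomorphism. *)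
Record triangulated_subcat T : Prop := TriangulatedSubcat {
  tri_iso : forall X Y, diso X Y -> T X -> T Y;
  tri_zero : T zeroc;
  tri_shift : forall (n : int) X, T X -> T (shift n X);
  tri_cone : forall X Y Z (u : dhom X Y) (v : dhom Y Z)
    (w : dhom Z (shift 1 X)), distinguished u v w -> T X -> T Y -> T Z }.

Definition thick T : Prop :=
  forall F E, T E -> direct_summand_in full_Db F E -> T F.

Definition sum_of_shifts G (ns : seq int) : bcomplex R :=
  foldr (fun n F => dsum (shift n G) F) zeroc ns.

Definition gen_ext0 T G : subcat := fun F =>
  T F /\ exists ns : seq int, diso F (sum_of_shifts G ns).

(** [gen_ext T G n] is [[G]_n], computed in the triangulated category [T]. *)
Fixpoint gen_ext T G (n : nat) (F : bcomplex R) : Prop :=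
  if n is k.+1 then
    T F /\ exists (E F0 : bcomplex R)
                 (u : dhom E F) (v : dhom F F0) (w : dhom F0 (shift 1 E)),
      [/\ gen_ext T G k E, gen_ext0 T G F0 & distinguished u v w]
  else gen_ext0 T G F.

(** [gen_add T G n] is [<G>_n], computed in the triangulated category [T]. *)
Definition gen_add T G (n : nat) : subcat := fun F =>
  exists2 E, gen_ext T G n E & direct_summand_in T F E.

Definition strong_generator T G : Prop :=
  T G /\ exists n : nat, forall F, T F <-> gen_add T G n F.

Definition regular T : Prop := exists G, strong_generator T G.

End Triangulated.
Arguments full_Db {R}.

(* Main.v *)
From HB Require Import structures.
Require Import Defs.
From mathcomp Require Import all_boot all_order all_algebra zify ring.
From mathcomp Require Import boolp classical_sets topology.
Set Implicit Arguments.
Unset Strict Implicit.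
Unset Printing Implicit Defensive.
Import Order.TTheory GRing.Theory Num.Theory.
Local Open Scope ring_scope.

(** Let [G] be a strong generator, so that every object of [T] is a summand of
    an object of [[G]_n] for a fixed [n], and let [I] be the ideal of the [r]
    that kill the cohomology of [G].  The proof has two halves.

    First half: every cyclic module [R / J] with [J] containing a power of [I]
    lies in [T].  By Noetherian induction and devissage ([cyclic_power]) only
    [J = p] prime matters, and then [I] is contained in [p].  Put [A = R / p]
    and let [F] be a resolution of [G] by free modules of finite rank.  As [p]
    is in the support of [G], the complex [F (x) A] is not exact over the
    fraction field of [A] ([fibre_splitting]; the input is Nakayama's lemma),
    so some degree [s] and some [f] outside [p] admit chain maps
    [A[-s] -> F (x) A -> A[-s]] with composite [f].  The unbounded complex
    [F (x) A] is approximated to any depth by objects [Q] of [T]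
    ([tens_approx]): resolve [A] by free modules and take iterated cones of
    copies of [F].  Strong generation enters through [factors_gen_ext]: a map
    from an object of [[G]_n] to a complex in degrees at least [a] factors
    through an object of [T] in degrees at least [c], where [c] depends on [a]
    and [n] only, because shifts of [G] far to the left have no such maps.
    Applied to [Q -> F (x) A -> A[-s]] this gives an object [Y] of [T], bounded
    below by a [c] that does not depend on [Q]; when [Q] is deep enough, the
    resolution of [A[-s]] lifts to [Q] in all degrees that [Y] can see, so that
    multiplication by [f] on [A[-s]] factors through [Y]
    ([factor_through_T]).  The cone of this multiplication is [A / f A], in [T]
    by induction, and then [A[-s]] is a retract of an extension of that cone by
    [Y] ([factor_and_cone]).

    Second half: long exact sequences show that a product of [n + 1] elements of
    [I] kills the cohomology of every object of [[G]_n] ([kills_gen_add]).  For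
    the object [R / I^m] of [T] this says that [I^(n+1)] is contained in [I^m],
    for every [m].  So [I^(n+1)] is its own square, hence is generated by an
    idempotent, which is [0] or [1] because the spectrum is connected.  If it is
    [1], then [G] is acyclic and so is all of [T].  If it is [0], then all
    cyclic modules lie in [T], hence all finitely generated ones, hence all
    bounded complexes of such modules ([T_of_terms]).

    Morphisms of the derived category are formal words in chain maps and inverses
    of quasi-isomorphisms.  They are compared with chain maps between projective
    resolutions, up to homotopy ([Rep_deq]); the only consequence that is used
    is that isomorphic objects have homotopy equivalent resolutions
    ([diso_res]). *)


(** * Identities in abelian groups *)

(** Expressions over a list of atoms.  Two of them have the same value in every
    abelian group as soon as each atom has the same integer coefficient in
    both. *)
Inductive abexpr := AbVar of nat | AbZero | AbOpp of abexpr | AbAdd of abexpr & abexpr.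

Fixpoint abeval (V : zmodType) (s : seq V) (e : abexpr) : V :=
  match e with
  | AbVar k => s`_k
  | AbZero => 0
  | AbOpp e => - abeval s e
  | AbAdd e f => abeval s e + abeval s f
  end.

Fixpoint abcoef (e : abexpr) (i : nat) : int :=
  match e with
  | AbVar k => if i == k then Posz 1 else Posz 0
  | AbZero => Posz 0
  | AbOpp e => intZmod.oppz (abcoef e i)
  | AbAdd e f => intZmod.addz (abcoef e i) (abcoef f i)
  end.

Lemma abevalE (V : zmodType) (s : seq V) e :
  abeval s e = \sum_(i < size s) s`_i *~ abcoef e i.
Proof.
elim: e => [k||e IH|e IHe f IHf] /=.
- case: (ltnP k (size s)) => ks.
    rewrite (bigD1 (Ordinal ks)) //= eqxx mulr1z big1 ?addr0 // => i ik.
    by case: eqP => [e|]; [case/eqP: ik; apply/val_inj | rewrite mulr0z].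
  rewrite nth_default // big1 // => i _.
  by case: eqP => [e|]; [have := ltn_ord i; rewrite e ltnNge ks | rewrite mulr0z].
- by rewrite big1 // => i _; rewrite mulr0z.
- by rewrite IH -sumrN; apply: eq_bigr => i _; rewrite -mulrNz.
- by rewrite IHe IHf -big_split; apply: eq_bigr => i _; rewrite /= -mulrzDr.
Qed.

Lemma abeval_eq (V : zmodType) (s : seq V) e f :
  all (fun i => abcoef e i == abcoef f i) (iota 0 (size s)) ->
  abeval s e = abeval s f.
Proof.
move=> /allP ef; rewrite !abevalE; apply: eq_bigr => i _.
by rewrite (eqP (ef i _)) // mem_iota /= add0n.
Qed.

(** Atoms are compared syntactically first; conversion is needed because the
    same element occurs with different presentations of its module. *)
Ltac ab_find x s :=
  lazymatch s with
  | ?y :: ?t =>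
    match goal with
    | _ => let _ := match goal with _ => first [constr_eq x y | unify x y] end in constr:(0%N)
    | _ => let n := ab_find x t in constr:(n.+1)
    end
  end.

Ltac ab_vars x s :=
  lazymatch x with
  | (?a + ?b)%R => let s1 := ab_vars a s in ab_vars b s1
  | (- ?a)%R => ab_vars a s
  | (0)%R => s
  | _ => match goal with
         | _ => let _ := ab_find x s in s
         | _ => constr:(x :: s)
         end
  end.

Ltac ab_quote x s :=
  lazymatch x with
  | (?a + ?b)%R => let e := ab_quote a s in let f := ab_quote b s in
                   constr:(AbAdd e f)
  | (- ?a)%R => let e := ab_quote a s in constr:(AbOpp e)
  | (0)%R => constr:(AbZero)
  | _ => let n := ab_find x s in constr:(AbVar n)
  end.

Ltac abel :=
  lazymatch goal with
  | |- @eq ?V ?x ?y =>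
    let s0 := ab_vars x (@nil V) in
    let s := ab_vars y s0 in
    let e := ab_quote x s in
    let f := ab_quote y s in
    change (abeval s e = abeval s f);
    apply: abeval_eq; vm_compute; reflexivity
  end.

Section Modules.
Variable R : comPzRingType.
Implicit Types (U V W M N : lmodType R).

(** * Modules *)

Definition mkLin U V (f : U -> V) (h : linear f) : {linear U -> V} :=
  HB.pack_for {linear U -> V} f (GRing.isLinear.Build R U V _ f h).

Record submod V (S : set V) : Prop := IsSubmod {
  sub0 : S 0;
  subD : forall x y, S x -> S y -> S (x + y);
  subZ : forall a x, S x -> S (a *: x) }.

Lemma subN V (S : set V) x : submod S -> S x -> S (- x).
Proof. by move=> hS Sx; rewrite -scaleN1r; apply: subZ. Qed.

Lemma subB V (S : set V) x y : submod S -> S x -> S y -> S (x - y).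
Proof. by move=> hS Sx Sy; apply: (subD hS) => //; apply: subN. Qed.

Lemma sub_sum V (S : set V) (I : Type) (r : seq I) (P : pred I) (F : I -> V) :
  submod S -> (forall i, P i -> S (F i)) -> S (\sum_(i <- r | P i) F i).
Proof. by move=> hS; apply: big_ind; [exact: sub0 hS | exact: subD hS]. Qed.

Section Quot.
Variables (V : lmodType R) (S : set V) (hS : submod S).

Let p : {pred V} := fun v => `[< S v >].

Let p_zmod : zmod_closed p.
Proof.
split; first by apply/asboolP; apply: sub0 hS.
by move=> x y /asboolP Sx /asboolP Sy; apply/asboolP; apply: subB.
Qed.

Let pZ : zmodClosed V := HB.pack_for (zmodClosed V) p
  (GRing.isZmodClosed.Build V p p_zmod).

Let Q := Quotient.quot pZ.

Let piQ : V -> Q := fun v => (\pi_Q v)%qT.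

Let piQ_eq x y : piQ x = piQ y <-> S (x - y).
Proof.
have -> : S (x - y) <-> p (x - y) by split => /asboolP.
have := @Quotient.idealrBE _ pZ x y; rewrite /piQ => E.
by split; [move/eqP | move=> h; apply/eqP]; rewrite -E.
Qed.

Let piQD x y : piQ (x + y) = piQ x + piQ y.
Proof. by rewrite /piQ raddfD. Qed.

Let scQ (a : R) (q : Q) : Q := piQ (a *: repr q).

Let scQ_pi a x : scQ a (piQ x) = piQ (a *: x).
Proof.
apply/piQ_eq; rewrite -scalerBr; apply: subZ => //; apply/piQ_eq.
by rewrite /piQ reprK.
Qed.

Let piQ_surj (q : Q) : exists x, q = piQ x.
Proof. by exists (repr q); rewrite /piQ reprK. Qed.

Let scQA a b q : scQ a (scQ b q) = scQ (a * b) q.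
Proof. by have [x ->] := piQ_surj q; rewrite !scQ_pi scalerA. Qed.

Let scQ1 : left_id 1 scQ.
Proof. by move=> q; have [x ->] := piQ_surj q; rewrite !scQ_pi scale1r. Qed.

Let scQDr : right_distributive scQ +%R.
Proof.
move=> a q r; have [x ->] := piQ_surj q; have [y ->] := piQ_surj r.
by rewrite -piQD !scQ_pi scalerDr piQD.
Qed.

Let scQDl q : {morph scQ^~ q : a b / a + b}.
Proof.
by move=> a b; have [x ->] := piQ_surj q; rewrite !scQ_pi scalerDl piQD.
Qed.

Let Qmod : lmodType R := HB.pack_for (lmodType R) (Quotient.quot pZ)
  (GRing.Zmodule_isLmodule.Build R (Quotient.quot pZ) scQA scQ1 scQDr scQDl).

(** The additive quotient by the boolean predicate of membership carries the
    scalar action of representatives. *)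
Lemma quotient_exists : exists (M : lmodType R) (q : {linear V -> M}),
  (forall m, exists v, m = q v) /\ (forall v, q v = 0 <-> S v).
Proof.
have lq : linear (piQ : V -> Qmod).
  by move=> a x y; rewrite piQD -scQ_pi.
exists Qmod, (mkLin lq); split=> [m|v]; first exact: piQ_surj.
rewrite -{2}[v]subr0 -piQ_eq; have -> : piQ 0 = 0 by rewrite /piQ raddf0.
by [].
Qed.

Definition quo : lmodType R := projT1 (cid quotient_exists).
Definition proj_quo : {linear V -> quo} :=
  projT1 (cid (projT2 (cid quotient_exists))).

Lemma proj_quo_surj m : exists v, m = proj_quo v.
Proof. by have [+ _] := projT2 (cid (projT2 (cid quotient_exists))); apply. Qed.

Lemma proj_quo0 v : proj_quo v = 0 <-> S v.
Proof. by have [_ +] := projT2 (cid (projT2 (cid quotient_exists))); apply. Qed.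

End Quot.

Lemma factor_surj U V W (q : {linear U -> V}) (f : {linear U -> W}) :
  (forall v, exists u, v = q u) -> (forall u, q u = 0 -> f u = 0) ->
  exists g : {linear V -> W}, forall u, g (q u) = f u.
Proof.
move=> /choice[s sP] qf.
have fs u : f (s (q u)) = f u.
  by apply/subr0_eq; rewrite -linearB; apply: qf; rewrite linearB -sP subrr.
have lg : linear (f \o s).
  move=> a x y /=; rewrite -linearP -[RHS]fs linearP -!sP //.
by exists (mkLin lg) => u; rewrite /= fs.
Qed.

Lemma fin_gen_surj U V (q : {linear U -> V}) :
  (forall v, exists u, v = q u) -> fin_gen U -> fin_gen V.
Proof.
move=> qs [n [g gP]]; exists n, (q \o g) => v.
have [u ->] := qs v; have [c ->] := gP u; exists c.
by rewrite linear_sum; apply: eq_bigr => k _; rewrite linearZ.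
Qed.

Lemma fin_gen_quo V (S : set V) (hS : submod S) : fin_gen V -> fin_gen (quo hS).
Proof. exact/fin_gen_surj/proj_quo_surj. Qed.

Lemma fin_gen_rV n : fin_gen 'rV[R]_n.
Proof.
exists n, (fun k => delta_mx 0 k) => x; exists (fun k => x 0 k).
exact: row_sum_delta.
Qed.

Lemma fin_gen_fin V (I : finType) (g : I -> V) :
  (forall x, exists c : I -> R, x = \sum_i c i *: g i) -> fin_gen V.
Proof.
move=> gP; exists #|I|, (g \o enum_val) => x; have [c ->] := gP x.
exists (c \o enum_val); rewrite (reindex (@enum_val I predT)) //.
by exists enum_rank => i _; rewrite ?enum_valK ?enum_rankK.
Qed.

Definition ffun_at V r (j : 'I_r) (x : V) : {ffun 'I_r -> V} :=
  [ffun k => if k == j then x else 0].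

Lemma ffun_at_linear V r (j : 'I_r) : linear (@ffun_at V r j).
Proof.
move=> a x y; apply/ffunP => k; rewrite !ffunE.
by case: eqP; rewrite // scaler0 addr0.
Qed.

Lemma ffun_sum_at V r (f : {ffun 'I_r -> V}) : f = \sum_j ffun_at j (f j).
Proof.
apply/ffunP => k; rewrite sum_ffunE (bigD1 k) //= ffunE eqxx big1 ?addr0 //.
by move=> j jk; rewrite ffunE eq_sym (negPf jk).
Qed.

Lemma fin_gen_ffun V r : fin_gen V -> fin_gen {ffun 'I_r -> V}.
Proof.
move=> [n [g gP]].
apply: (@fin_gen_fin _ ('I_r * 'I_n)%type (fun k => ffun_at k.1 (g k.2))) => f.
have /choice[c cP] : forall j, exists c : 'I_n -> R, f j = \sum_k c k *: g k.
  by move=> j; apply: gP.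
exists (fun k => c k.1 k.2).
rewrite -(pair_big predT predT (fun j k => c j k *: ffun_at j (g k))) /=.
rewrite {1}[f]ffun_sum_at; apply: eq_bigr => j _.
rewrite cP -[ffun_at j _]/(mkLin (@ffun_at_linear V r j) _) linear_sum.
by apply: eq_bigr => k _; rewrite linearZ.
Qed.

(** * Projective modules *)

(** The lifting property is asked of maps that land in the image of [q], so that
    [q] may be a differential of a complex. *)
Definition projective V : Prop :=
  forall M N (q : {linear M -> N}) (f : {linear V -> N}),
    (forall v, exists x, f v = q x) ->
    exists g : {linear V -> M}, forall v, q (g v) = f v.

Lemma projective_prod V W :
  projective V -> projective W -> projective (V * W)%type.
Proof.
move=> pV pW M N q f fq.
have l1 : linear (fun v : V => f (v, 0)).
  move=> a x y; rewrite -linearP; congr (f _).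
  by apply: (congr2 pair); rewrite //= scaler0 addr0.
have l2 : linear (fun w : W => f (0, w)).
  move=> a x y; rewrite -linearP; congr (f _).
  by apply: (congr2 pair); rewrite //= scaler0 addr0.
have [g gE] := pV _ _ q (mkLin l1) (fun v => fq (v, 0)).
have [h hE] := pW _ _ q (mkLin l2) (fun w => fq (0, w)).
have l3 : linear (fun p : V * W => g p.1 + h p.2).
  by move=> a p p'; rewrite /= !linearP scalerDr addrACA.
exists (mkLin l3) => -[v w]; rewrite /= linearD gE hE /= -linearD.
by congr (f _); apply: (congr2 pair); rewrite /= ?addr0 ?add0r.
Qed.

Lemma rV_ext V n (g : 'I_n -> V) :
  exists f : {linear 'rV[R]_n -> V}, forall k, f (delta_mx 0 k) = g k.
Proof.
have l : linear (fun x : 'rV[R]_n => \sum_k x 0 k *: g k).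
  move=> a x y; rewrite scaler_sumr -big_split; apply: eq_bigr => k _ /=.
  by rewrite !mxE scalerDl scalerA.
exists (mkLin l) => k; rewrite /= (bigD1 k) //= mxE !eqxx scale1r big1 ?addr0 //.
by move=> j jk; rewrite mxE (negPf jk) andbF scale0r.
Qed.

Lemma rV_eq V n (f g : {linear 'rV[R]_n -> V}) :
  (forall k, f (delta_mx 0 k) = g (delta_mx 0 k)) -> f =1 g.
Proof.
move=> fg x; rewrite (row_sum_delta x) !linear_sum; apply: eq_bigr => k _.
by rewrite !linearZ fg.
Qed.

Lemma projective_rV n : projective 'rV[R]_n.
Proof.
move=> M N q f fq.
have /choice[s sP] := fun k => fq (delta_mx 0 k).
have [g gE] := rV_ext s; exists g.
by apply: (@rV_eq _ _ (q \o g)) => k /=; rewrite gE sP.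
Qed.

Lemma projective_ffun V r : projective V -> projective {ffun 'I_r -> V}.
Proof.
move=> pV M N q f fq.
have /choice[g gE] : forall j, exists g : {linear V -> M},
    forall v, q (g v) = f (ffun_at j v).
  by move=> j; apply: (pV _ _ q (f \o mkLin (@ffun_at_linear V r j))) => v /=.
have l : linear (fun x : {ffun 'I_r -> V} => \sum_j g j (x j)).
  move=> a x y; rewrite scaler_sumr -big_split; apply: eq_bigr => k _ /=.
  by rewrite !ffunE linearP.
exists (mkLin l) => x /=; rewrite {2}[x]ffun_sum_at !linear_sum.
by apply: eq_bigr => j _; rewrite gE.
Qed.

(** * Noetherian rings *)

Definition fin_gen_in V (S : set V) : Prop :=
  exists (n : nat) (g : 'I_n -> V), (forall k, S (g k)) /\
    forall x, S x -> exists c : 'I_n -> R, x = \sum_k c k *: g k.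

(** Induction on the number of generators of [V]: the coefficients of the first
    generator in elements of [S] form a finitely generated ideal, and the
    elements of [S] without that generator are covered by induction. *)
Lemma noetherian_submod V (S : set V) : noetherian_ring R ->
  fin_gen V -> submod S -> fin_gen_in S.
Proof.
move=> noethR [n [g gP]] hS.
have {gP} : forall x, S x -> exists c : 'I_n -> R, x = \sum_k c k *: g k by [].
elim: n g S hS => [|n IHn] g S hS gP.
  exists 0%N, g; split=> [[]//|x /gP[c]]; rewrite big_ord0 => ->.
  by exists (fun=> 0); rewrite big_ord0.
pose sp x := exists c : 'I_n -> R, x = \sum_k c k *: g (lift ord0 k).
have sp_sub : submod (sp : set V).
  split; first by exists (fun=> 0); rewrite big1 // => k _; rewrite scale0r.
    move=> x y [c ->] [e ->]; exists (fun k => c k + e k).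
    by rewrite -big_split; apply: eq_bigr => k _; rewrite scalerDl.
  move=> a x [c ->]; exists (fun k => a * c k); rewrite scaler_sumr.
  by apply: eq_bigr => k _; rewrite scalerA.
have hI : is_ideal ((fun r => exists2 x, S x & sp (x - r *: g ord0)) : set R).
  split.
  - by exists 0; [exact: sub0 hS | rewrite scale0r subr0; apply: sub0 sp_sub].
  - move=> r s [x Sx xr] [y Sy ys]; exists (x + y); first exact: (subD hS).
    by rewrite scalerDl opprD addrACA; apply: (subD sp_sub).
  - move=> a r [x Sx xr]; exists (a *: x); first exact: (subZ hS).
    by rewrite -scalerA -scalerBr; apply: (subZ sp_sub).
have [m [r [rI rP]]] := noethR _ hI.
have /choice[y yP] : forall k, exists y, S y /\ sp (y - r k *: g ord0).
  by move=> k; have [y] := rI k; exists y.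
have hS' : submod ((fun x => S x /\ sp x) : set V).
  split; first by split; [exact: sub0 hS | exact: sub0 sp_sub].
    by move=> x z [Sx px] [Sz pz]; split; [exact: (subD hS) | exact: (subD sp_sub)].
  by move=> a x [Sx px]; split; [exact: (subZ hS) | exact: (subZ sp_sub)].
have [l [h [hS'h hP]]] := IHn (g \o lift ord0) _ hS' (fun x => @proj2 _ _).
exists (m + l)%N, (fun k => match split k with inl a => y a | inr b => h b end).
split=> [k|x Sx]; first by case: split => a; [have [] := yP a | have [] := hS'h a].
have [c xE] := gP x Sx; rewrite big_ord_recl in xE.
have [e eE] : exists e : 'I_m -> R, c ord0 = \sum_k e k * r k.
  by apply: rP; exists x => //; rewrite xE addrC addKr; exists (fun k => c (lift ord0 k)).
have [d dE] : exists d : 'I_l -> R, x - \sum_k e k *: y k = \sum_k d k *: h k.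
  apply: hP; split.
    by apply: (subB hS) => //; apply: sub_sum => // k _; apply: (subZ hS); case: (yP k).
  rewrite xE eE scaler_suml addrAC -sumrB.
  apply: (subD sp_sub); last by exists (fun k => c (lift ord0 k)).
  apply: sub_sum => // k _; rewrite -opprB; apply: subN => //.
  by rewrite -scalerA -scalerBr; apply: (subZ sp_sub); case: (yP k).
exists (fun k => match split k with inl a => e a | inr b => d b end).
rewrite -[x](subrK (\sum_k e k *: y k)) dE addrC big_split_ord /=; congr (_ + _).
  by apply: eq_bigr => k _; have /= -> := unsplitK (inl k : 'I_m + 'I_l).
by apply: eq_bigr => k _; have /= -> := unsplitK (inr k : 'I_m + 'I_l).
Qed.

End Modules.

(** * Families indexed by the integers *)

(** A differential goes from degree [i] to [i + 1] and a homotopy from degree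
    [i + 1] to [i], so that identities are naturally stated in degree [i + 1].
    The next two facts return from there to all degrees; transports along
    [i - 1 + 1 = i] occur nowhere else. *)
Lemma int_succ_ind (Q : int -> Prop) : (forall i, Q (i + 1)) -> forall i, Q i.
Proof. by move=> h i; rewrite -[i](subrK 1). Qed.

Lemma unshift_family (T : int -> Type) (F : forall i, T (i + 1)) :
  exists G : forall i, T i, forall i, G (i + 1) = F i.
Proof.
pose G i : T i := eq_rect _ T (F (i - 1)) i (subrK 1 i).
exists G => i; rewrite /G; move: (subrK 1 (i + 1)).
have -> : i + 1 - 1 = i by rewrite addrK.
by move=> e; rewrite (eq_axiomK e).
Qed.

Section DownRec.
Variables (T : int -> Type) (t0 : forall i, T i) (b : int).
Variables (good : forall i, T i -> Prop) (Rl : forall i, T (i + 1) -> T i -> Prop).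
Hypothesis good0 : forall i : int, b <= i -> good (t0 i).
Hypothesis Rl0 : forall i : int, b <= i -> Rl (t0 (i + 1)) (t0 i).
Hypothesis stepP : forall (i : int) (y : T (i + 1)), good y -> exists x, Rl y x /\ good x.

(** Dependent choice from degree [b] downwards; [good] is the invariant that
    makes the next choice possible. *)
Lemma downward_recursion :
  exists t : forall i, T i,
    (forall i : int, b <= i -> t i = t0 i) /\ forall i : int, Rl (t (i + 1)) (t i).
Proof.
have stex : forall i, exists s : T (i + 1) -> T i,
    forall y, good y -> Rl y (s y) /\ good (s y).
  move=> i; have [|s sP] := choice (P := fun y x => good y -> @Rl i y x /\ good x).
    move=> y; case: (pselect (good y)) => [/stepP[x xP]|ny]; first by exists x.
    by exists (t0 i).
  by exists s.
pose st i := projT1 (cid (stex i)).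
have stE i : forall y, good y -> Rl y (st i y) /\ good (st i y) := projT2 (cid (stex i)).
have eS (n : nat) : b - n%:Z = b - n.+1%:Z + 1 by lia.
pose F := fix F (n : nat) : T (b - n%:Z) :=
  if n is m.+1 return T (b - n%:Z) then st _ (eq_rect _ T (F m) _ (eS m))
  else t0 (b - 0%:Z).
have FP n : good (F n).
  elim: n => [|n IHn]; first by apply: good0; lia.
  apply: (stE _ _ _).2; move: (eS n); rewrite -(eS n) => e.
  by rewrite (eq_axiomK e).
have eE i : i < b -> b - (`|b - i|%N)%:Z = i by lia.
pose t i : T i := match pselect (i < b) with
  | left h => eq_rect _ T (F `|b - i|%N) i (eE i h) | right _ => t0 i end.
have tF n : t (b - n%:Z) = F n.
  rewrite /t; case: pselect => [h|h].
    move: (eE _ h); have -> : `|(b - (b - n%:Z))%R|%N = n by lia.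
    by move=> e; rewrite (eq_axiomK e).
  have n0 : n = 0%N by lia.
  by rewrite n0.
exists t; split=> [i bi|i]; first by rewrite /t; case: pselect => // h; lia.
case: (leP b i) => bi.
  have tE j : b <= j -> t j = t0 j by rewrite /t; case: pselect => // h h'; lia.
  by rewrite !tE; [exact: Rl0 | exact: bi | lia].
have -> : i = b - (`|b - i|%N.-1.+1)%:Z by lia.
move: (`|b - i|%N.-1) => n {i bi}.
have key k (e : b - n%:Z = k) : t k = eq_rect _ T (F n) k e.
  by destruct e; apply: tF.
have gF k (e : b - n%:Z = k) : good (eq_rect _ T (F n) k e).
  by destruct e; apply: FP.
by rewrite (tF n.+1) (key _ (eS n)); case: (stE _ _ (gF _ (eS n))).
Qed.
End DownRec.

Section Complexes.
Variable R : comPzRingType.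

(** * Complexes without boundedness *)

(** Resolutions are unbounded below, so bounded complexes have to be embedded in
    a larger class. *)
Record cx := Cx {
  ct :> int -> lmodType R;
  cd : forall i, {linear ct i -> ct (i + 1)};
  cdd : forall i (x : ct i), cd (i + 1) (cd i x) = 0 }.
Arguments cd X {i} : rename.

Record cm (X Y : cx) := Cm {
  cf :> forall i, {linear X i -> Y i};
  cfd : forall i (x : X i), cf (i + 1) (cd X x) = cd Y (cf i x) }.

Coercion cxb (X : bcomplex R) : cx := @Cx X (@diff R X) (@diff_diff R X).
Coercion cmb (X Y : bcomplex R) (f : chain_map X Y) : cm X Y :=
  @Cm X Y (cmap f) (cmap_diff f).
Definition bcm (X Y : bcomplex R) (f : cm X Y) : chain_map X Y :=
  @ChainMap R X Y (cf f) (cfd f).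

Implicit Types X Y Z P Q C M : cx.

Definition qis X Y (f : cm X Y) : Prop :=
  forall i : int,
    (forall x : X (i + 1), cd X x = 0 ->
       (exists y : Y i, f (i + 1) x = cd Y y) ->
       exists x' : X i, x = cd X x') /\
    (forall y : Y (i + 1), cd Y y = 0 ->
       exists2 x : X (i + 1), cd X x = 0 &
         exists y' : Y i, y - f (i + 1) x = cd Y y').

(** Vanishing of the cohomology in degree [i + 1]. *)
Definition exact_at X (i : int) : Prop :=
  forall x : X (i + 1), cd X x = 0 -> exists y : X i, x = cd X y.

Definition above (b : int) X : Prop := forall i : int, b <= i -> forall x : X i, x = 0.
Definition below (a : int) X : Prop := forall i : int, i < a -> forall x : X i, x = 0.

Definition idm X : cm X X := @Cm X X (fun i => idfun) (fun i x => erefl).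

Lemma compm_d X Y Z (g : cm Y Z) (f : cm X Y) i (x : X i) :
  (g (i + 1) \o f (i + 1)) (cd X x) = cd Z ((g i \o f i) x).
Proof. by rewrite /= !cfd. Qed.

Definition compm X Y Z (g : cm Y Z) (f : cm X Y) : cm X Z :=
  @Cm X Z (fun i => g i \o f i) (compm_d g f).

Definition htpy X Y (f g : cm X Y) : Prop :=
  exists h : forall i, {linear X (i + 1) -> Y i},
    forall i (x : X (i + 1)), f _ x - g _ x = cd Y (h i x) + h (i + 1) (cd X x).

Lemma htpy_ext X Y (f g : cm X Y) : (forall i x, f i x = g i x) -> htpy f g.
Proof.
move=> fg; exists (fun i => \0 : {linear X (i + 1) -> Y i}) => i x /=.
by rewrite fg subrr linear0 addr0.
Qed.

Lemma htpy_refl X Y (f : cm X Y) : htpy f f.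
Proof. exact: htpy_ext. Qed.

Lemma htpy_sym X Y (f g : cm X Y) : htpy f g -> htpy g f.
Proof.
move=> [h hE]; exists (fun i => \- h i : {linear X (i + 1) -> Y i}) => i x /=.
by rewrite linearN -opprD -hE opprB.
Qed.

Lemma htpy_trans X Y (f g e : cm X Y) : htpy f g -> htpy g e -> htpy f e.
Proof.
move=> [h hE] [k kE].
exists (fun i => h i \+ k i : {linear X (i + 1) -> Y i}) => i x /=.
rewrite linearD; have := congr2 +%R (hE i x) (kE i x) => E.
transitivity (f _ x - g _ x + (g _ x - e _ x)); first by abel.
by rewrite E; abel.
Qed.

Lemma htpy_comp X Y Z (g g' : cm Y Z) (f f' : cm X Y) :
  htpy g g' -> htpy f f' -> htpy (compm g f) (compm g' f').
Proof.
move=> gg' [h hE]; apply: (@htpy_trans _ _ _ (compm g f')).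
  exists (fun i => g i \o h i : {linear X (i + 1) -> Z i}) => i x /=.
  by rewrite -linearB hE linearD cfd.
case: gg' => k kE.
exists (fun i => k i \o f' (i + 1) : {linear X (i + 1) -> Z i}) => i x /=.
by rewrite kE cfd.
Qed.

Lemma comp_htpy_l X Y Z (g g' : cm Y Z) (f : cm X Y) :
  htpy g g' -> htpy (compm g f) (compm g' f).
Proof. by move=> h; apply: htpy_comp h (htpy_refl f). Qed.

Lemma comp_htpy_r X Y Z (g : cm Y Z) (f f' : cm X Y) :
  htpy f f' -> htpy (compm g f) (compm g f').
Proof. exact: htpy_comp (htpy_refl g). Qed.

(** ** Mapping cones *)

Section Cone.
Variables (X Y : cx) (f : cm X Y).

Definition conex_fun i (p : (X (i + 1)%R * Y i)%type) :
    (X (i + 1 + 1)%R * Y (i + 1)%R)%type :=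
  (- cd X p.1, f (i + 1) p.1 + cd Y p.2).

Lemma conex_linear i : linear (@conex_fun i).
Proof.
move=> a p q; apply: (congr2 pair) => /=.
  by rewrite linearP opprD scalerN.
by rewrite !linearP scalerDr addrACA.
Qed.

Lemma conex_dd i (p : (X (i + 1)%R * Y i)%type) :
  mkLin (@conex_linear (i + 1)) (mkLin (@conex_linear i) p) = 0.
Proof.
apply: (congr2 pair) => /=; first by rewrite linearN cdd !oppr0.
by rewrite linearN linearD cdd addr0 cfd addNr.
Qed.

Definition conex : cx :=
  @Cx (fun i => (X (i + 1)%R * Y i)%type) _ conex_dd.

End Cone.

Lemma qis_cone X Y (f : cm X Y) : qis f -> forall i, exact_at (conex f) i.
Proof.
move=> qf i [x y] [/eqP]; rewrite /= oppr_eq0 => /eqP dx fdy.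
have [x' xE] : exists x', x = cd X x'.
  apply: (qf (i + 1)).1 => //; exists (- y); rewrite linearN.
  by apply/subr0_eq; rewrite opprK.
have [z dz [y' yE]] : exists2 z : X (i + 1), cd X z = 0 &
    exists y' : Y i, (y + f _ x') - f (i + 1) z = cd Y y'.
  by apply: (qf i).2; rewrite linearD -cfd -xE -[RHS]fdy; abel.
exists (z - x', y'); apply: (congr2 pair) => /=.
  by rewrite linearB dz xE; abel.
by rewrite linearB -yE; abel.
Qed.

(** ** Homotopies from bounded above complexes of projectives *)

Definition projc P : Prop :=
  (exists b, above b P) /\ forall i, projective (P i).

(** The homotopy is built downwards from the degree above which [P] vanishes:
    [f - h d] takes values in cycles, which are boundaries, and [P] is
    projective. *)
Lemma null_homotopy (K : int -> Prop) P C (f : cm P C) :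
  (forall i, K i -> K (i + 1)) -> projc P -> (forall i, K i -> exact_at C i) ->
  exists h : forall i, {linear P (i + 1) -> C i},
    forall i, K i -> forall x, f (i + 1) x = cd C (h i x) + h (i + 1) (cd P x).
Proof.
move=> Kup [[b Pb] Pp] Cex.
pose T i := {linear P (i + 1) -> C i}.
pose good i (h : T i) := K i -> forall x : P i, cd C (f i x - h (cd P x)) = 0.
pose Rl i (h' : T (i + 1)) (h : T i) :=
  K i -> forall x, f (i + 1) x = cd C (h x) + h' (cd P x).
have [|||h [_ hP]] := @downward_recursion T (fun=> \0) b good Rl.
- by move=> i bi _ x; rewrite (Pb _ bi x) !linear0 addr0 linear0.
- move=> i bi _ x; have bi1 : b <= i + 1 by lia.
  rewrite (Pb _ bi1 x).
  by rewrite !linear0 addr0.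
- move=> i h' gh'; case: (pselect (K i)) => [Ki|nK]; last by exists \0; split=> Ki; case: (nK Ki).
  have [h hE] : exists h : {linear P (i + 1) -> C i},
      forall x, cd C (h x) = (f (i + 1) \- (h' \o cd P)) x.
    apply: Pp => x; have [|z zE] := Cex _ Ki (f _ x - h' (cd P x)).
      by apply: gh'; apply: Kup.
    by exists z; rewrite /= zE.
  exists h; split=> [_ x|_ x]; first by rewrite hE /= subrK.
  by rewrite linearB hE /= cdd linear0 subr0 cfd subrr.
by exists h.
Qed.

(** A lift of [f] together with a homotopy is a null homotopy of the map [(0, f)]
    to the cone of [q].  With [K] a half-line this lifts [f] in high degrees
    only, through a map that is highly connected but not a
    quasi-isomorphism. *)
Lemma lift_range (K : int -> Prop) P X Y (q : cm X Y) (f : cm P Y) :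
  (forall i, K i -> K (i + 1)) -> projc P -> (forall i, K i -> exact_at (conex q) i) ->
  exists (l : forall i, {linear P i -> X i}) (h : forall i, {linear P (i + 1) -> Y i}),
    forall i, K i -> forall x : P (i + 1),
      l _ (cd P x) = cd X (l _ x) /\
      f _ x = q _ (l _ x) + (cd Y (h i x) + h (i + 1) (cd P x)).
Proof.
move=> Kup Pp qex.
pose g0 i (x : P i) : conex q i := (0, f i x).
have g0l i : linear (@g0 i).
  by move=> a x y; apply: (congr2 pair); rewrite /= ?scaler0 ?addr0 ?linearP.
have g0d i (x : P i) : mkLin (@g0l _) (cd P x) = cd (conex q) (mkLin (@g0l _) x).
  by apply: (congr2 pair); rewrite /= linear0 ?oppr0 // add0r cfd.
have [h hE] := null_homotopy (Cm g0d) Kup Pp qex.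
have h1l i : linear (fun x => (h i x).1) by move=> a x y; rewrite linearP.
have h2l i : linear (fun x => (h i x).2) by move=> a x y; rewrite linearP.
have [l lE] := @unshift_family (fun i => {linear P i -> X i}) (fun i => mkLin (@h1l i)).
exists l, (fun i => mkLin (@h2l i)) => i Ki x.
have [e1 e2] := hE i Ki x; rewrite !lE /=; split.
  by apply/subr0_eq; rewrite [RHS]e1 /=; abel.
by rewrite e2; abel.
Qed.

Lemma lift_htpy P X Y (q : cm X Y) (f : cm P Y) :
  projc P -> qis q -> exists l : cm P X, htpy (compm q l) f.
Proof.
move=> Pp /qis_cone qex.
have [//|l [h lh]] := @lift_range (fun=> True) P X Y q f _ Pp (fun i _ => qex i).
have ld i (x : P i) : l _ (cd P x) = cd X (l _ x).
  by move: i x; apply: int_succ_ind => i x; case: (lh i I x).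
exists (Cm ld); apply: htpy_sym; exists h => i x /=.
by have [_ ->] := lh i I x; abel.
Qed.

(** The difference [f - g] and a homotopy from [q f] to [q g] are the components
    of a chain map from [P[1]] to the cone of [q], which is acyclic. *)
Lemma lift_unique P X Y (q : cm X Y) (f g : cm P X) :
  projc P -> qis q -> htpy (compm q f) (compm q g) -> htpy f g.
Proof.
move=> [[b Pb] Pp] /qis_cone qex [k kE].
have sdd i (x : P (i + 1)) : (\- @cd P (i + 1 + 1)) ((\- @cd P (i + 1)) x) = 0.
  by rewrite /= linearN cdd !oppr0.
pose sP := @Cx (fun i => P (i + 1)) (fun i => \- @cd P (i + 1)) sdd.
have sPp : projc sP.
  by split=> [|i]; [exists b => i bi; apply: Pb; lia | exact: Pp].
pose g0 i (x : sP i) : conex q i := (f _ x - g _ x, - k i x).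
have g0l i : linear (@g0 i).
  move=> a x y; apply: (congr2 pair).
    exact: (linearP (f (i + 1) \- g (i + 1))).
  exact: (linearP (\- k i)).
have g0d i (x : sP i) : mkLin (@g0l _) (cd sP x) = cd (conex q) (mkLin (@g0l _) x).
  apply: (congr2 pair) => /=.
    by rewrite (linearN (f _)) (linearN (g _)) (linearB (cd X)) !cfd; abel.
  have /= kEi := kE i x.
  by rewrite (linearN (k _)) (linearN (cd Y)) (linearB (q _)) kEi; abel.
have [//|h hE] := @null_homotopy (fun=> True) _ _ (Cm g0d) _ sPp (fun i _ => qex i).
have h1l i : linear (fun x => - (h i x).1).
  by move=> a x y; rewrite linearP /= opprD scalerN.
have [s sE] := @unshift_family (fun i => {linear P (i + 1) -> X i})
  (fun i => mkLin (@h1l i)).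
exists s; apply: int_succ_ind => i x.
have hN : h (i + 1) (cd sP x) = - h (i + 1) (cd P x) := linearN (h (i + 1)) _.
have := hE i I x; rewrite hN => -[e1 _].
by rewrite !sE /= e1 (linearN (cd X)).
Qed.

End Complexes.
Arguments cd {R} X {i} : rename.

Section Resolutions.
Variable R : comPzRingType.
Implicit Types X Y P Q : cx R.

(** * Free resolutions *)

(** The ranks are data, so that [F (x) A] can be formed termwise from the matrices
    of the differentials, as powers of [A], without tensor products of modules. *)
Record fcx := Fcx {
  rk : int -> nat;
  fd : forall i, {linear 'rV[R]_(rk i) -> 'rV[R]_(rk (i + 1))};
  fdd : forall i x, fd (i + 1) (fd i x) = 0 }.

Coercion cx_of_fcx (F : fcx) : cx R := @Cx R (fun i => 'rV[R]_(rk F i)) _ (@fdd F).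

Definition ord_ext (V : zmodType) n (g : 'I_n -> V) (k : nat) : V :=
  if insub k is Some j then g j else 0.

Lemma ord_extE (V : zmodType) n (g : 'I_n -> V) (k : 'I_n) : ord_ext g k = g k.
Proof. by rewrite /ord_ext valK. Qed.

Lemma ord_ext0 (V : zmodType) n (g : 'I_n -> V) k : (n <= k)%N -> ord_ext g k = 0.
Proof. by move=> nk; rewrite /ord_ext insubF // ltnNge nk. Qed.

(** One degree of a resolution [P -> X]: the rank of [P i], the coefficients of
    the images of its basis in [P (i + 1)] and those images in [X i].  The
    coefficients form an infinite matrix so that the type does not depend on
    the rank in degree [i + 1]. *)
Record stage (X : cx R) i := Stage {
  srk : nat; sD : nat -> nat -> R; sp : nat -> X i }.
Arguments Stage {X i}.
Arguments srk {X i}.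
Arguments sD {X i}.
Arguments sp {X i}.

(** The basis of [P i] is sent to generators of the module of pairs [(p, x)] in
    [P (i + 1) * X i] with [d p = 0] and [p] mapping to [d x].  This one
    condition makes [P] a complex, [P -> X] a chain map and, since all such
    pairs are hit, a quasi-isomorphism. *)
Definition stage_rel X i (s' : stage X (i + 1)) (s : stage X i) : Prop :=
  (forall k m, (srk s' <= m)%N -> sD s k m = 0) /\
  (forall k : 'I_(srk s),
     (forall l, \sum_(m < srk s') sD s k m * sD s' m l = 0) /\
     \sum_(m < srk s') sD s k m *: sp s' m = cd X (sp s k)) /\
  (forall (p : 'rV[R]_(srk s')) (x : X i),
     (forall l, \sum_(m < srk s') p 0 m * sD s' m l = 0) ->
     \sum_(m < srk s') p 0 m *: sp s' m = cd X x ->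
     exists c : 'rV[R]_(srk s),
       (forall m : 'I_(srk s'), p 0 m = \sum_k c 0 k * sD s k m) /\
       x = \sum_k c 0 k *: sp s k).

Lemma stage_step X i (s' : stage X (i + 1)) : noetherian_ring R ->
  fin_gen (X i) -> exists s, stage_rel s' s.
Proof.
move=> noethR fgX.
pose r := srk s'.
pose S : set ('rV[R]_r * X i)%type := fun p =>
  (forall l, \sum_(m < r) p.1 0 m * sD s' m l = 0) /\
  \sum_(m < r) p.1 0 m *: sp s' m = cd X p.2.
have hS : submod S.
  split.
  - split=> [l|]; rewrite big1 ?linear0 // => m _; rewrite mxE.
      by rewrite mul0r.
    by rewrite scale0r.
  - move=> [p x] [q y] [p0 px] [q0 qy]; split=> [l|] /=.
      have := congr2 +%R (p0 l) (q0 l); rewrite addr0 -big_split => E; rewrite -[RHS]E.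
      by apply: eq_bigr => m _; rewrite mxE mulrDl.
    have := congr2 +%R px qy; rewrite -linearD -big_split => <-.
    by apply: eq_bigr => m _; rewrite mxE scalerDl.
  - move=> a [p x] [p0 px]; split=> [l|] /=.
      have := congr1 ( *%R a) (p0 l); rewrite mulr0 mulr_sumr => E; rewrite -[RHS]E.
      by apply: eq_bigr => m _; rewrite mxE mulrA.
    have := congr1 ( *:%R a) px; rewrite -linearZ scaler_sumr => <-.
    by apply: eq_bigr => m _; rewrite mxE scalerA.
have [n [g [gS gP]]] := noetherian_submod noethR (fin_gen_prod (fin_gen_rV _ r) fgX) hS.
exists (Stage n (fun k m => ord_ext (fun j => ord_ext (fun l => (g j).1 0 l) m) k)
              (ord_ext (fun j => (g j).2))).
split=> /= [k m rm|].
  rewrite /ord_ext; case: insubP => // j _ _; exact: ord_ext0.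
split=> /= [k|p x p0 px].
  have [g0 gd] := gS k; rewrite ord_extE -gd; split=> [l|].
    by rewrite -[RHS](g0 l); apply: eq_bigr => m _; rewrite !ord_extE.
  by apply: eq_bigr => m _; rewrite !ord_extE.
have [c cE] : exists c : 'I_n -> R, (p, x) = \sum_k c k *: g k by apply: gP.
exists (\row_k c k).
have fstE : p = \sum_k c k *: (g k).1.
  have -> : p = (p, x).1 by [].
  by rewrite cE (big_morph fst (fun _ _ => erefl) erefl).
have sndE : x = \sum_k c k *: (g k).2.
  have -> : x = (p, x).2 by [].
  by rewrite {1}cE (big_morph snd (fun _ _ => erefl) erefl).
split=> [m|].
  rewrite fstE summxE; apply: eq_bigr => k _.
  by rewrite !mxE !ord_extE.
by rewrite sndE; apply: eq_bigr => k _; rewrite !mxE !ord_extE.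
Qed.

Lemma resolution X b : noetherian_ring R -> above b X ->
  (forall i, fin_gen (X i)) ->
  exists F : fcx, (forall i : int, b <= i -> rk F i = 0%N) /\
    exists p : cm F X, qis p.
Proof.
move=> noethR Xb fgX.
have [|||t [t0 tR]] := @downward_recursion (stage X)
  (fun i => Stage 0 (fun _ _ => 0) (fun _ => 0)) b (fun _ _ => True) (@stage_rel X).
- by [].
- move=> i bi; split=> //; split=> [[]//|p x _ _]; exists 0; split=> [[]//|].
  by rewrite big_ord0 /= (Xb _ bi x).
- move=> i s' _; have [s sP] := stage_step s' noethR (fgX i).
  by exists s.
pose d i (x : 'rV[R]_(srk (t i))) : 'rV[R]_(srk (t (i + 1))) :=
  \row_l \sum_k x 0 k * sD (t i) k l.
have dl i : linear (@d i).
  move=> a x y; apply/rowP => l; rewrite !mxE mulr_sumr -big_split.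
  by apply: eq_bigr => k _; rewrite !mxE mulrDl mulrA.
have pl i : linear (fun x : 'rV[R]_(srk (t i)) => \sum_k x 0 k *: sp (t i) k).
  move=> a x y; rewrite scaler_sumr -big_split.
  by apply: eq_bigr => k _; rewrite !mxE scalerDl scalerA.
have dd i (x : 'rV[R]_(srk (t i))) : mkLin (@dl (i + 1)) (mkLin (@dl i) x) = 0.
  apply/rowP => l; rewrite !mxE.
  rewrite (eq_bigr (fun m : 'I_(srk (t (i + 1))) => \sum_k x 0 k * (sD (t i) k m * sD (t (i + 1)) m l))).
    rewrite exchange_big big1 // => k _ /=; rewrite -mulr_sumr.
    by have [H _] := (tR i).2.1 k; rewrite H mulr0.
  by move=> m _; rewrite !mxE mulr_suml; apply: eq_bigr => k _; rewrite mulrA.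
pose F := Fcx dd.
have pd i (x : F i) : mkLin (@pl (i + 1)) (cd F x) = cd X (mkLin (@pl i) x).
  rewrite /= linear_sum.
  rewrite (eq_bigr (fun m : 'I_(srk (t (i + 1))) => \sum_k x 0 k *: (sD (t i) k m *: sp (t (i + 1)) m))).
    rewrite exchange_big; apply: eq_bigr => k _ /=; rewrite -scaler_sumr linearZ.
    by have [_ ->] := (tR i).2.1 k.
  by move=> m _; rewrite !mxE scaler_suml; apply: eq_bigr => k _; rewrite scalerA.
exists F; split=> [i bi|]; first by rewrite /= t0.
exists (Cm pd) => i.
have key (p : F (i + 1)) (x : X i) : cd F p = 0 -> Cm pd (i + 1) p = cd X x ->
    exists c : F i, p = cd F c.
  move=> dp px; have [||c [cE _]] := (tR i).2.2 p x.
  - move=> l; case: (ltnP l (srk (t (i + 1 + 1)))) => lr.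
      by have /rowP/(_ (Ordinal lr)) := dp; rewrite !mxE.
    by rewrite big1 // => m _; rewrite (tR _).1 ?mulr0.
  - exact: px.
  - by exists c; apply/rowP => l; rewrite cE !mxE.
split=> [x dx [y xy]|y dy]; first exact: key dx xy.
have [||c [c0 yE]] := (tR (i + 1)).2.2 0 y.
- by move=> l; rewrite big1 // => m _; rewrite mxE mul0r.
- by rewrite dy big1 // => m _; rewrite mxE scale0r.
exists c; last by exists 0; rewrite linear0 yE subrr.
by apply/rowP => l; rewrite !mxE -c0 mxE.
Qed.

Lemma projc_fcx (F : fcx) (b : int) :
  (forall i : int, b <= i -> rk F i = 0%N) -> projc F.
Proof.
move=> F0; split=> [|i]; last exact: projective_rV.
exists b => i bi x; apply/rowP => -[m mi]; exfalso.
by move: mi; rewrite F0.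
Qed.

Lemma above_fcx (F : fcx) (b : int) :
  (forall i : int, b <= i -> rk F i = 0%N) -> above b F.
Proof.
by move=> F0 i bi x; apply/rowP => -[m mi]; exfalso; move: mi; rewrite F0.
Qed.

End Resolutions.

Section Resolutions.
Variable R : comPzRingType.
Implicit Types X Y Z P Q : cx R.

(** * Morphisms of the derived category on resolutions *)

Lemma qis_comp X Y Z (g : cm Y Z) (f : cm X Y) :
  qis g -> qis f -> qis (compm g f).
Proof.
move=> qg qf i; split=> [x dx gfx|z dz] /=.
  by apply: (qf i).1 => //; apply: (qg i).1 => //; rewrite -cfd dx linear0.
have [y dy [z' zE]] := (qg i).2 z dz; have [x dx [y' yE]] := (qf i).2 y dy.
exists x => //; exists (z' + g _ y'); rewrite linearD -zE -cfd -yE linearB.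
by abel.
Qed.

Lemma qis_htpy X Y (f g : cm X Y) : htpy f g -> qis f -> qis g.
Proof.
move=> [h hE] qf i; split=> [x dx [y gx]|y dy].
  apply: (qf i).1 => //; exists (y + h i x); rewrite linearD -gx.
  by rewrite -[f _ x](subrK (g _ x)) hE dx linear0; abel.
have [x dx [y' yE]] := (qf i).2 y dy; exists x => //; exists (y' + h i x).
by rewrite linearD -yE -[cd Y (h i x)]addr0 -(linear0 (h (i + 1))) -dx -hE; abel.
Qed.

Lemma qis_cancel_r X Y Z (g : cm Y Z) (f : cm X Y) :
  qis (compm g f) -> qis f -> qis g.
Proof.
move=> qgf qf i; split=> [y dy [z gy]|z dz].
  have [x dx [y' yE]] := (qf i).2 y dy.
  have [x' xE] : exists x' : X i, x = cd X x'.
    apply: (qgf i).1 => //; exists (z - g _ y'); rewrite linearB -gy -cfd -yE.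
    by rewrite linearB /=; abel.
  exists (y' + f _ x'); rewrite linearD -yE -cfd -xE; abel.
have [x dx [z' zE]] := (qgf i).2 z dz.
by exists (f _ x); [rewrite -cfd dx linear0 | exists z'].
Qed.

Lemma htpyA X Y Z W (h : cm Z W) (g : cm Y Z) (f : cm X Y) :
  htpy (compm h (compm g f)) (compm (compm h g) f).
Proof. exact: htpy_ext. Qed.

Lemma htpy_idl X Y (f : cm X Y) : htpy (compm (idm Y) f) f.
Proof. exact: htpy_ext. Qed.

Lemma htpy_idr X Y (f : cm X Y) : htpy (compm f (idm X)) f.
Proof. exact: htpy_ext. Qed.

Record res X := Res {
  rP :> cx R; rp : cm rP X; rproj : projc rP; rqis : qis rp }.

Lemma res_unique X (P Q : res X) : exists a : cm P Q, exists b : cm Q P,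
  [/\ htpy (compm (rp Q) a) (rp P), htpy (compm b a) (idm P)
    & htpy (compm a b) (idm Q)].
Proof.
have [a aE] := lift_htpy (rp P) (rproj P) (@rqis _ Q).
have [b bE] := lift_htpy (rp Q) (rproj Q) (@rqis _ P).
exists a, b; split=> //.
  apply: (lift_unique (rproj P) (@rqis _ P)).
  apply: htpy_trans (htpyA _ _ _) _; apply: htpy_trans (comp_htpy_l _ bE) _.
  exact: htpy_trans aE (htpy_sym (htpy_idr _)).
apply: (lift_unique (rproj Q) (@rqis _ Q)).
apply: htpy_trans (htpyA _ _ _) _; apply: htpy_trans (comp_htpy_l _ aE) _.
exact: htpy_trans bE (htpy_sym (htpy_idr _)).
Qed.

Lemma res_exists (X : bcomplex R) : noetherian_ring R -> inhabited (res X).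
Proof.
move=> noethR; have [N NP] := cterm_bounded X.
have Xb : above (N.+1%:Z) X by move=> i iN x; apply: NP; lia.
have [F [F0 [p qp]]] := resolution noethR Xb (@cterm_fg _ X).
by split; apply: (Res (projc_fcx F0) qp).
Qed.

End Resolutions.
Arguments rqis {R X} r.
Arguments rproj {R X} r.

Section Representatives.
Variable R : comPzRingType.
Variable rs : forall X : bcomplex R, res X.
Implicit Types X Y Z W : bcomplex R.

(** [Rep f a]: the chain map [a] of resolutions induces the morphism [f] of the
    derived category.  For a formal inverse of [s] the condition is on the
    composite with [s]. *)
Fixpoint Rep (X Y : bcomplex R) (f : dhom X Y) : cm (rs X) (rs Y) -> Prop :=
  match f with
  | dmap X Y f => fun a => htpy (compm (rp (rs Y)) a) (compm f (rp (rs X)))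
  | dinv X Y s _ => fun a => htpy (compm (compm s (rp (rs X))) a) (rp (rs Y))
  | dcomp X Y Z g f => fun a =>
      exists a1 a2, [/\ Rep f a1, Rep g a2 & htpy a (compm a2 a1)]
  end.

Lemma Rep_exists X Y (f : dhom X Y) : exists a, Rep f a.
Proof.
elim: f => [{}X {}Y f|{}X {}Y s qs|{}X {}Y Z g [b gb] f [a fa]] /=.
- exact: lift_htpy (rproj _) (rqis _).
- exact: lift_htpy (rproj _) (qis_comp (qs : qis s) (rqis _)).
- by exists (compm b a), a, b; split=> //; apply: htpy_refl.
Qed.

Lemma Rep_unique X Y (f : dhom X Y) a a' : Rep f a -> Rep f a' -> htpy a a'.
Proof.
elim: f a a' => [{}X {}Y f|{}X {}Y s qs|{}X {}Y Z g IHg f IHf] a a' /=.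
- move=> fa fa'; apply: (lift_unique (rproj _) (rqis (rs Y))).
  exact: htpy_trans fa (htpy_sym fa').
- move=> sa sa'; apply: (lift_unique (rproj _) (qis_comp (qs : qis s) (rqis (rs X)))).
  exact: htpy_trans sa (htpy_sym sa').
- move=> [b [c [fb gc E]]] [b' [c' [fb' gc' E']]].
  apply: htpy_trans E (htpy_trans _ (htpy_sym E')).
  by apply: htpy_comp; [apply: IHg | apply: IHf].
Qed.

Lemma Rep_id X a : Rep (did X) a -> htpy a (idm _).
Proof.
move=> /= ida; apply: (lift_unique (rproj _) (rqis (rs X))).
exact: htpy_trans ida (htpy_ext (fun i x => erefl)).
Qed.

(** Soundness of the defining relations of the localization; each is an instance
    of uniqueness of lifts up to homotopy. *)
Lemma Rep_deq X Y (f g : dhom X Y) : deq f g ->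
  forall a b, Rep f a -> Rep g b -> htpy a b.
Proof.
elim=> {X Y f g}.
- by move=> X Y f a b; apply: Rep_unique.
- by move=> X Y f g _ IH a b fa gb; apply/htpy_sym/IH.
- move=> X Y f g h _ IH1 _ IH2 a b fa hb; have [c gc] := Rep_exists g.
  exact: htpy_trans (IH1 _ _ fa gc) (IH2 _ _ gc hb).
- move=> X Y Z g g' f f' _ IHg _ IHf a b /= [a1 [a2 [fa ga E]]] [b1 [b2 [fb gb E']]].
  apply: htpy_trans E (htpy_trans _ (htpy_sym E')).
  by apply: htpy_comp; [apply: IHg | apply: IHf].
- move=> X Y Z W h g f a b /= [a1 [a2 [[a3 [a4 [fa3 ga4 E1]]] ha2 E2]]].
  move=> [b1 [b2 [fb1 [b3 [b4 [gb3 hb4 E3]]] E4]]].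
  apply: htpy_trans E2 _; apply: htpy_trans (comp_htpy_r _ E1) _.
  apply: htpy_trans (htpyA _ _ _) _; apply/htpy_sym.
  apply: htpy_trans E4 _; apply: htpy_trans (comp_htpy_l _ E3) _.
  apply: htpy_comp; [apply: htpy_comp|]; first exact: Rep_unique hb4 ha2.
    exact: Rep_unique gb3 ga4.
  exact: Rep_unique fb1 fa3.
- move=> X Y f a b [a1 [a2 [fa1 /Rep_id ia2 E]]] fb.
  apply: htpy_trans E _; apply: htpy_trans (comp_htpy_l _ ia2) _.
  exact: htpy_trans (htpy_idl _) (Rep_unique fa1 fb).
- move=> X Y f a b [a1 [a2 [/Rep_id ia1 fa2 E]]] fb.
  apply: htpy_trans E _; apply: htpy_trans (comp_htpy_r _ ia1) _.
  exact: htpy_trans (htpy_idr _) (Rep_unique fa2 fb).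
- move=> X Y f g fg a b /= fa gb.
  apply: (lift_unique (rproj _) (rqis (rs Y))).
  apply: htpy_trans fa (htpy_trans _ (htpy_sym gb)).
  by apply: comp_htpy_l; apply: htpy_ext.
- move=> X Y Z g f a b /= gfa [b1 [b2 [fb1 gb2 E]]].
  apply: (lift_unique (rproj _) (rqis (rs Z))).
  apply: htpy_trans gfa _; apply: htpy_sym.
  apply: htpy_trans (comp_htpy_r _ E) _.
  apply: htpy_trans (htpyA _ _ _) _; apply: htpy_trans (comp_htpy_l _ gb2) _.
  apply: htpy_trans (htpy_sym (htpyA _ _ _)) _.
  apply: htpy_trans (comp_htpy_r _ fb1) _.
  exact: htpy_ext.
- move=> X Y s qs a b /= [a1 [a2 [sa1 sa2 E]]] /Rep_id ib.
  apply: htpy_trans (htpy_sym ib).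
  apply: (lift_unique (rproj _) (qis_comp (qs : qis s) (rqis (rs X)))).
  apply: htpy_trans (comp_htpy_r _ E) _.
  apply: htpy_trans (htpyA _ _ _) _; apply: htpy_trans (comp_htpy_l _ sa2) _.
  exact: htpy_trans sa1 (htpy_sym (htpy_idr _)).
- move=> X Y s qs a b /= [a1 [a2 [sa1 sa2 E]]] /Rep_id ib.
  apply: htpy_trans (htpy_sym ib).
  apply: (lift_unique (rproj _) (rqis (rs Y))).
  apply: htpy_trans (comp_htpy_r _ E) _.
  apply: htpy_trans (htpyA _ _ _) _; apply: htpy_trans (comp_htpy_l _ sa2) _.
  exact: htpy_trans sa1 (htpy_sym (htpy_idr _)).
Qed.
End Representatives.

Lemma diso_res (R : comPzRingType) (X Y : bcomplex R) (P : res X) (Q : res Y) :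
  noetherian_ring R -> diso X Y ->
  exists (a : cm P Q) (b : cm Q P), htpy (compm b a) (idm P) /\
    htpy (compm a b) (idm Q).
Proof.
move=> noethR [f [g [gf fg]]].
have rsE (Z : bcomplex R) : exists _ : res Z, True.
  by have [r] := res_exists Z noethR; exists r.
pose rs (Z : bcomplex R) := projT1 (cid (rsE Z)).
have [a fa] := Rep_exists rs f; have [b gb] := Rep_exists rs g.
have ba : htpy (compm b a) (idm (rs X)).
  apply: (Rep_deq (rs := rs) gf); first by exists a, b; split=> //; apply: htpy_refl.
  exact: htpy_ext.
have ab : htpy (compm a b) (idm (rs Y)).
  apply: (Rep_deq (rs := rs) fg); first by exists b, a; split=> //; apply: htpy_refl.
  exact: htpy_ext.
have [a1 [b1 [_ ba1 ab1]]] := res_unique P (rs X).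
have [a2 [b2 [_ ba2 ab2]]] := res_unique (rs Y) Q.
have comp3 (A B C : cx R) (u : cm A B) (v : cm B A) (u' : cm B C) (v' : cm C B) :
    htpy (compm v u) (idm A) -> htpy (compm v' u') (idm B) ->
    htpy (compm (compm v v') (compm u' u)) (idm A).
  move=> vu vu'; apply: htpy_trans (htpyA _ _ _) _.
  apply: (@htpy_trans _ _ _ _ (compm (compm v (compm v' u')) u)).
    exact: htpy_ext.
  apply: htpy_trans (comp_htpy_l _ (comp_htpy_r _ vu')) _.
  exact: htpy_trans (htpy_ext (fun i x => erefl)) vu.
exists (compm a2 (compm a a1)), (compm (compm b1 b) b2); split.
  exact: comp3 (comp3 _ _ _ _ _ _ _ ba1 ba) ba2.
have := comp3 _ _ _ _ _ _ _ (comp3 _ _ _ _ _ _ _ ab2 ab) ab1.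
by apply: htpy_trans; apply: htpy_ext.
Qed.

Section QisLemmas.
Variable R : comPzRingType.
Implicit Types X Y Z P Q C M : cx R.

(** * Recognising quasi-isomorphisms *)

Lemma bij_qis X Y (f : cm X Y) :
  (forall i (x : X i), f i x = 0 -> x = 0) ->
  (forall i (y : Y i), exists x, y = f i x) -> qis f.
Proof.
move=> fi fs i; split=> [x dx [y fx]|y dy].
  have [x' yE] := fs i y; exists x'; apply/subr0_eq/fi.
  by rewrite linearB fx cfd yE subrr.
have [x yE] := fs _ y; exists x; last by exists 0; rewrite linear0 yE subrr.
by apply: fi; rewrite cfd -yE.
Qed.

Section ConeMap.
Variables (X Y X' Y' : cx R) (f : cm X Y) (f' : cm X' Y').
Variables (a : cm X X') (b : cm Y Y').
Hypothesis ab : forall i x, b i (f i x) = f' i (a i x).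

Definition cone_map_fun i (p : conex f i) : conex f' i := (a _ p.1, b _ p.2).

Lemma cone_map_linear i : linear (@cone_map_fun i).
Proof. by move=> c p q; apply: (congr2 pair); rewrite linearP. Qed.

Lemma cone_map_d i (p : conex f i) :
  mkLin (@cone_map_linear _) (cd _ p) = cd _ (mkLin (@cone_map_linear _) p).
Proof.
apply: (congr2 pair); rewrite /= ?(linearN (a _)) ?(linearD (b _)) ?cfd //.
by rewrite ab.
Qed.

Definition cone_map : cm (conex f) (conex f') := Cm cone_map_d.

Lemma qis_cone_map : qis a -> qis b -> qis cone_map.
Proof.
move=> qa qb i; split.
  move=> [x y] [/eqP]; rewrite /= oppr_eq0 => /eqP dx fxy [[x' y'] [ax bY]].
  have [x1 xE] : exists x1, x = cd X x1.
    by apply: (qa _).1 => //; exists (- x'); rewrite linearN.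
  have [x2 dx2 [w wE]] : exists2 x2 : X (i + 1), cd X x2 = 0 &
      exists w : X' i, (a _ x1 + x') - a _ x2 = cd X' w.
    by apply: (qa _).2; rewrite linearD -cfd -xE ax; abel.
  have dx12 : cd X (x1 - x2) = x by rewrite linearB dx2 subr0 -xE.
  have [y1 yE] : exists y1, y + f _ (x1 - x2) = cd Y y1.
    apply: (qb _).1.
      by rewrite (linearD (cd Y)) -(cfd f) dx12 -[RHS]fxy; abel.
    exists (y' + f' _ w); rewrite (linearD (b _)) bY ab (linearD (cd Y')) -(cfd f').
    by rewrite -wE !(linearB (a _)) !(linearB (f' _)) !(linearD (f' _)); abel.
  exists (- (x1 - x2), y1); apply: (congr2 pair) => /=.
    by rewrite (linearN (cd X)) dx12 opprK.
  by rewrite -yE (linearN (f _)); abel.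
move=> [x' y'] [/eqP]; rewrite /= oppr_eq0 => /eqP dx' fxy'.
have [x dx [w wE]] := (qa _).2 x' dx'.
have axE : a _ x = x' - cd X' w by rewrite -wE; abel.
have [y1 y1E] : exists y1, f _ x = cd Y y1.
  apply: (qb _).1; first by rewrite -cfd dx linear0.
  exists (- (y' + f' _ w)); rewrite ab axE (linearB (f' _)) (linearN (cd Y')).
  by rewrite (linearD (cd Y')) -(cfd f') -[f' _ x'](addrK (cd Y' y')) fxy'; abel.
have [y2 dy2 [v vE]] : exists2 y2 : Y (i + 1), cd Y y2 = 0 &
    exists v : Y' i, (y' + f' _ w + b _ y1) - b _ y2 = cd Y' v.
  apply: (qb _).2; rewrite !(linearD (cd Y')) -(cfd f') -(cfd b) -y1E ab axE.
  by rewrite (linearB (f' _)) -[RHS]fxy'; abel.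
exists (x, y2 - y1).
  by apply: (congr2 pair); rewrite /= ?dx ?oppr0 // linearB dy2 -y1E; abel.
exists (- w, v); apply: (congr2 pair) => /=.
  by rewrite linearN axE; abel.
by rewrite linearN linearB -vE; abel.
Qed.
End ConeMap.

(** ** Quotient complexes *)

Section QuotCx.
Variables (X : cx R) (N : forall i, set (X i)).
Hypothesis hN : forall i, submod (@N i).
Hypothesis dN : forall i x, N x -> @N (i + 1) (cd X x).

Lemma quot_cx : exists (Q : cx R) (q : cm X Q),
  (forall i, Q i = quo (hN i)) /\
  (forall i y, exists x, y = q i x) /\ (forall i x, q i x = 0 <-> N x).
Proof.
have dex i : exists d : {linear quo (hN i) -> quo (hN (i + 1))},
    forall x, d (proj_quo (hN i) x) = proj_quo _ (cd X x).
  apply: (factor_surj (f := proj_quo (hN (i + 1)) \o cd X)) => [v|x].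
    exact: proj_quo_surj.
  by move=> /proj_quo0 Nx; apply/proj_quo0/dN.
pose d i := projT1 (cid (dex i)).
have dE i x : d i (proj_quo (hN i) x) = proj_quo _ (cd X x) := projT2 (cid (dex i)) x.
have dd i (y : quo (hN i)) : d (i + 1) (d i y) = 0.
  by have [x ->] := proj_quo_surj y; rewrite !dE cdd linear0.
exists (Cx dd), (@Cm _ X (Cx dd) (fun i => proj_quo (hN i)) (fun i x => esym (dE i x))).
split=> //; split=> i x; [exact: proj_quo_surj | exact: proj_quo0].
Qed.

Lemma quot_qis (Q : cx R) (q : cm X Q) :
  (forall i y, exists x, y = q i x) -> (forall i x, q i x = 0 <-> N x) ->
  (forall i (x : X (i + 1)), N x -> cd X x = 0 -> exists2 y, @N i y & x = cd X y) ->
  qis q.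
Proof.
move=> qs q0 Nex i; split=> [x dx [y qx]|y dy].
  have [z yE] := qs _ y.
  have [|| n _ nE] := Nex i (x - cd X z).
  - by apply/q0; rewrite linearB cfd qx yE subrr.
  - by rewrite linearB dx cdd subr0.
  by exists (z + n); rewrite linearD -nE; abel.
have [x yE] := qs _ y.
have [||n Nn nE] := Nex (i + 1) (cd X x).
- by apply/q0; rewrite cfd -yE.
- exact: cdd.
exists (x - n); first by rewrite linearB nE subrr.
by exists 0; rewrite linear0 linearB yE (q0 _ n).2 // subr0 subrr.
Qed.
End QuotCx.

End QisLemmas.

Section Bounded.
Variable R : comPzRingType.
Implicit Types X Y Z : bcomplex R.

Lemma bc_above X : exists b : int, above b X.
Proof.
by have [N NP] := cterm_bounded X; exists (N.+1%:Z) => i iN x; apply: NP; lia.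
Qed.

Lemma bc_below X : exists a : int, below a X.
Proof.
by have [N NP] := cterm_bounded X; exists (- N%:Z) => i iN x; apply: NP; lia.
Qed.

Lemma bcomplexP (X : cx R) a b : above b X -> below a X ->
  (forall i, fin_gen (X i)) -> exists Y : bcomplex R, cxb Y = X.
Proof.
case: X => X d dd Xb Xa Xfg.
have Xbd : exists N : nat, forall i : int, (N < `|i|)%N -> forall x : X i, x = 0.
  exists (`|a| + `|b|)%N => i iN x.
  case: (ltP i a) => ia; first exact: Xa.
  by apply: Xb; lia.
by exists (BComplex dd Xbd Xfg).
Qed.

(** ** Truncation *)

(** The quotient of [P] by its truncation in degrees at most [l]. *)
Lemma truncation (P : cx R) (l : int) : (exists b, above b P) ->
  (forall i, fin_gen (P i)) -> (forall i : int, i < l -> exact_at P i) ->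
  exists (Q : bcomplex R) (q : cm P Q),
    [/\ qis q, below l Q, forall i y, exists x, y = q i x
      & forall i : int, l < i -> forall x, q i x = 0 -> x = 0].
Proof.
move=> [b Pb] Pfg Pex.
pose N i : set (P i) := fun x => (l < i -> x = 0) /\ (i = l -> cd P x = 0).
have hN i : submod (@N i).
  split; first by split=> //; rewrite linear0.
    move=> x y [x1 x2] [y1 y2]; split=> h; first by rewrite x1 // y1 // addr0.
    by rewrite linearD x2 // y2 // addr0.
  move=> a x [x1 x2]; split=> h; first by rewrite x1 // scaler0.
  by rewrite linearZ x2 //= scaler0.
have dN i x : @N i x -> @N (i + 1) (cd P x).
  move=> [x1 x2]; split=> h; last exact: cdd.
  by case: (ltP l i) => li; [rewrite x1 // linear0 | apply: x2; lia].
have [Q [q [QE [qs q0]]]] := quot_cx hN dN.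
have Qb : above b Q.
  by move=> i bi y; have [x ->] := qs i y; rewrite (Pb _ bi x) linear0.
have Ql : below l Q.
  move=> i il y; have [x ->] := qs i y; apply/q0; split=> h.
    by exfalso; move: h; lia.
  by exfalso; move: h; lia.
have [Q' QQ'] := bcomplexP Qb Ql (fun i => fin_gen_surj (qs i) (Pfg i)).
destruct QQ'; exists Q', q; split=> //.
  apply: (quot_qis qs q0) => i x [x1 x2] dx.
  case: (ltP l (i + 1)) => li.
    exists 0; first exact: sub0 (hN i).
    by rewrite linear0 x1.
  case: (Pex i _ x dx) => [|y yE]; first by lia.
  by exists y => //; split=> h; exfalso; move: h; lia.
by move=> i li x /q0[x1 _]; apply: x1.
Qed.

(** Maps to complexes in degrees above [l] do not see what truncation removes. *)
Lemma factor_cm (P Q M : cx R) (q : cm P Q) (l : int) (f : cm P M) :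
  (forall i y, exists x, y = q i x) ->
  (forall i : int, l < i -> forall x, q i x = 0 -> x = 0) ->
  below (l + 1) M -> exists g : cm Q M, forall i x, g i (q i x) = f i x.
Proof.
move=> qs qi Ml.
have gex i : exists g : {linear Q i -> M i}, forall x, g (q i x) = f i x.
  apply: factor_surj => [v|x qx]; first exact: qs.
  case: (ltP l i) => li; first by rewrite (qi i li x qx) linear0.
  by apply: Ml; lia.
pose g i := projT1 (cid (gex i)).
have gE i x : g i (q i x) = f i x := projT2 (cid (gex i)) x.
have gd i (y : Q i) : g _ (cd Q y) = cd M (g _ y).
  by have [x ->] := qs i y; rewrite -cfd !gE cfd.
by exists (Cm gd).
Qed.

Lemma exact_qis (P X : cx R) (p : cm P X) (a : int) : qis p -> below a X ->
  forall i, i + 1 < a -> exact_at P i.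
Proof.
move=> qp Xa i ia x dx; apply: (qp i).1 => //.
by exists 0; rewrite linear0; apply: Xa.
Qed.

End Bounded.

Section Closure.
Variable R : comPzRingType.
Variable T : subcat R.
Hypothesis triT : triangulated_subcat T.
Hypothesis thickT : thick T.
Implicit Types X Y Z : bcomplex R.

(** * Closure properties of thick subcategories *)

Lemma qis_diso X Y (f : cm X Y) : qis f -> diso X Y /\ diso Y X.
Proof.
move=> qf; have qf' : quasi_iso (bcm f) := qf.
split; [exists (dmap (bcm f)), (dinv qf') | exists (dinv qf'), (dmap (bcm f))].
  by split; [apply: deq_inv_l | apply: deq_inv_r].
by split; [apply: deq_inv_r | apply: deq_inv_l].
Qed.

Lemma T_qis X Y (f : cm X Y) : qis f -> T X <-> T Y.
Proof. by move=> /qis_diso[h h']; split; apply: (tri_iso triT). Qed.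

Lemma did_is_diso X : is_diso (did X).
Proof. by exists (did X); split; apply: deq_id_l. Qed.

Lemma cone_distinguished X Y (f : chain_map X Y) :
  distinguished (dmap f) (dmap (cone_in f)) (dmap (cone_out f)).
Proof.
exists X, Y, f, (did X), (did Y), (did (cone f)); split.
  by split; apply: did_is_diso.
split; try by apply: deq_trans (deq_id_l _) (deq_sym (deq_id_r _)).
apply: deq_trans (deq_sym (deq_id_r _)); apply: deq_trans (deq_id_l _).
by apply: deq_comp (deq_refl _); apply: deq_ext.
Qed.

Lemma T_cone X Y (f : chain_map X Y) : T X -> T Y -> T (cone f).
Proof. exact: (tri_cone triT (cone_distinguished f)). Qed.

Lemma cast_succ (X0 : int -> lmodType R) i j (e : i = j) (x : X0 (i + 1)) :
  @cast R (fun k => X0 (k + 1)) i j e x =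
  @cast R X0 _ _ (congr1 (+%R^~ 1) e) x.
Proof. by destruct e. Qed.

(** Only casts separate [X[1][-1]] from [X]. *)
Lemma T_unshift X : T (shift 1 X) -> T X.
Proof.
move=> /(tri_shift triT (- 1)) h.
pose f i := @mkLin R (shift (- 1) (shift 1 X) i) (X i)
  (@cast R X _ _ (subrK 1 i)) (@cast_linear R X _ _ (subrK 1 i)).
have fd i (x : shift (- 1) (shift 1 X) i) :
    f _ (diff (shift (- 1) (shift 1 X)) x) = diff X (f _ x).
  have -> : diff (shift (- 1) (shift 1 X)) x =
      @cast R X _ _ (congr1 (+%R^~ 1) (addrAC i (- 1) 1)) (@diff R X (i - 1 + 1) x).
    rewrite /= /shift_diff_fun /= /shift_diff_fun /= cast_id !expr1 !scaleN1r.
    rewrite (linearN (cast (X := shift_term 1 X) (addrAC i (- 1) 1))) opprK.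
    exact: cast_succ.
  rewrite /f /= cast_comp (cast_diff _ (etrans (congr1 (+%R^~ 1) (addrAC i (- 1) 1)) (subrK 1 (i + 1)))).
  by [].
have fq : qis (@Cm R (shift (- 1) (shift 1 X)) X f fd).
  have fK i : cancel (f i) (@cast R X _ _ (esym (subrK 1 i))).
    by move=> x; rewrite /f cast_comp cast_id.
  apply: bij_qis => i x; first by move=> fx; rewrite -[x](fK i) [f i x]fx linear0.
  exists (@cast R X _ _ (esym (subrK 1 i)) x); by rewrite /= /f cast_comp cast_id.
exact: (T_qis fq).1 h.
Qed.

(** The cone of [Y -> cone f] is a shift of [X]. *)
Definition rotate_fun X Y (f : chain_map X Y) i (p : cone (cone_in f) i) :
  shift 1 X i := p.2.1.

Lemma rotate_linear X Y (f : chain_map X Y) i : linear (@rotate_fun X Y f i).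
Proof. by []. Qed.

Lemma rotate_d X Y (f : chain_map X Y) i (p : cone (cone_in f) i) :
  mkLin (@rotate_linear _ _ f (i + 1)) (diff _ p) =
  diff (shift 1 X) (mkLin (@rotate_linear _ _ f i) p).
Proof. by rewrite shift_diffE cast_id expr1 scaleN1r /= /rotate_fun /= add0r. Qed.

Lemma shift1E X i (x : X (i + 1)) :
  @cd R (shift 1 X) i x = - @diff R X (i + 1) x.
Proof. by rewrite /= /shift_diff_fun cast_id expr1 scaleN1r. Qed.

Lemma rotate_qis X Y (f : chain_map X Y) :
  qis (@Cm R (cone (cone_in f)) (shift 1 X) _ (@rotate_d _ _ f)).
Proof.
move=> i; split.
  move=> [y [x y']] [/eqP + /eqP + yE] [z /= xE].
  rewrite !oppr_eq0 => /eqP dy /eqP dx.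
  move: xE; rewrite -[RHS]/(@cd R (shift 1 X) i z) shift1E /rotate_fun /= => xE.
  exists (y' - f _ z, (z, 0)); apply: (congr2 pair); last apply: (congr2 pair).
  - rewrite linearB -(cmap_diff f) /= opprB -[diff X z]opprK -xE linearN.
    by move: yE => /= yE; apply/subr0_eq; rewrite -[RHS]yE; abel.
  - by rewrite /= add0r.
  - by rewrite /= linear0; abel.
move=> x; rewrite -[x]/(_ : X (i + 1 + 1)) shift1E => /eqP; rewrite oppr_eq0 => /eqP dx.
exists (- f _ x, (x, 0)).
  apply: (congr2 pair); last apply: (congr2 pair) => /=.
  - by rewrite /= linearN opprK -cmap_diff dx linear0.
  - by rewrite dx oppr0 addr0.
  - by rewrite linear0; abel.
by exists 0; rewrite linear0 /= /rotate_fun /= subrr.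
Qed.

Lemma T_fiber X Y (f : chain_map X Y) : T Y -> T (cone f) -> T X.
Proof.
move=> TY Tf; apply: T_unshift.
exact: (T_qis (@rotate_qis _ _ f)).1 (T_cone (cone_in f) TY Tf).
Qed.

Lemma T_middle X Y (f : chain_map X Y) : T X -> T (cone f) -> T Y.
Proof.
move=> TX Tf; apply: (T_fiber (f := cone_in f)) => //.
exact/(T_qis (@rotate_qis _ _ f)).2/(tri_shift triT).
Qed.

(** ** Short exact sequences *)

Section ShortExact.
Variables (X Y Z : bcomplex R) (f : cm X Y) (g : cm Y Z).
Hypothesis fi : forall i x, f i x = 0 -> x = 0.
Hypothesis gs : forall i z, exists y, z = g i y.
Hypothesis gf : forall i x, g i (f i x) = 0.
Hypothesis fg : forall i y, g i y = 0 -> exists x, y = f i x.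

Let c_fun i (p : cone (bcm f) i) : Z i := g i p.2.

Let c_lin i : linear (@c_fun i).
Proof. by move=> a p q; rewrite /c_fun linearP. Qed.

Let c_d i (p : cone (bcm f) i) :
  mkLin (@c_lin _) (diff _ p) = diff Z (mkLin (@c_lin _) p).
Proof.
by rewrite /= /c_fun /= (linearD (g _)) gf add0r; apply: (cfd g).
Qed.

Let c_qis : qis (@Cm R (cone (bcm f)) Z _ (@c_d)).
Proof.
move=> i; split.
  move=> [x y] [/eqP + fxy] [z gz]; rewrite oppr_eq0 => /eqP dx.
  have [y1 zE] := gs z; have [x1 x1E] : exists x1, y - cd Y y1 = f _ x1.
    by apply: fg; rewrite linearB (cfd g) -zE; apply/eqP; rewrite subr_eq0; apply/eqP.
  exists (x1, y1); apply: (congr2 pair) => /=.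
    apply/subr0_eq/fi; rewrite opprK linearD (cfd f) -x1E linearB cdd subr0.
    exact: fxy.
  by rewrite -x1E; abel.
move=> z dz; have [y zE] := gs z.
have [x xE] : exists x, cd Y y = f _ x by apply: fg; rewrite (cfd g) -zE.
exists (- x, y).
  apply: (congr2 pair) => /=; last by rewrite linearN -xE; abel.
  rewrite linearN opprK; apply: fi; rewrite -[diff X x]/(cd X x) (cfd f) -xE.
  exact: cdd.
by exists 0; rewrite linear0 /= /c_fun /= -zE subrr.
Qed.

(** The cone of the injection is quasi-isomorphic to the cokernel. *)
Lemma T_ses_cone : T (cone (bcm f)) <-> T Z.
Proof. exact: (T_qis c_qis). Qed.

Lemma T_ses_middle : T X -> T Z -> T Y.
Proof. by move=> TX TZ; apply: (T_middle (f := bcm f)) => //; apply/(T_qis c_qis). Qed.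

End ShortExact.

Lemma T_dsum X Y : T X -> T Y -> T (dsum X Y).
Proof.
have il i : linear (fun x : X i => (x, 0) : dsum X Y i).
  by move=> a x y; apply: (congr2 pair); rewrite //= scaler0 addr0.
have pl i : linear (fun p : dsum X Y i => p.2) by [].
have id_ i (x : X i) : mkLin (@il _) (diff X x) = diff (dsum X Y) (mkLin (@il _) x).
  by apply: (congr2 pair); rewrite //= linear0.
have pd i (p : dsum X Y i) : mkLin (@pl _) (diff _ p) = diff Y (mkLin (@pl _) p).
  by [].
apply: (T_ses_middle (f := @Cm R X (dsum X Y) _ id_) (g := @Cm R (dsum X Y) Y _ pd)).
- by move=> i x [].
- by move=> i y; exists (0, y).
- by [].
- by move=> i [x y] /= ->; exists x.
Qed.

(** The maps split [Y], up to quasi-isomorphism, as the sum of [X] and the cone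
    of [f]. *)
Lemma T_retract X' X Y (f : cm X' Y) (g : cm Y X) : qis (compm g f) -> T Y -> T X.
Proof.
move=> qgf TY.
suff : diso Y (dsum X (cone (bcm f))).
  by move=> h; apply: (thickT TY); split=> //; exists (cone (bcm f)).
pose s_fun i (y : Y i) : dsum X (cone (bcm f)) i := (g i y, (0, y)).
have sl i : linear (@s_fun i).
  move=> a x y; apply: (congr2 pair); first exact: linearP.
  by apply: (congr2 pair); rewrite //= scaler0 addr0.
have sd i (y : Y i) : mkLin (@sl _) (diff Y y) = diff _ (mkLin (@sl _) y).
  apply: (congr2 pair); first exact: (cfd g).
  by apply: (congr2 pair); rewrite /= linear0 ?oppr0 ?add0r.
apply: (@qis_diso _ _ (@Cm R Y (dsum X (cone (bcm f))) _ sd) _).1 => i; split.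
  move=> y dy [[x [a z]]] [gy /esym/eqP]; rewrite oppr_eq0 => /eqP da yE.
  have [a' aE] : exists a', a = cd X' a'.
    apply: (qgf _).1 => //; exists (x - g _ z); rewrite /= linearB -(cfd g).
    rewrite -[cd X x]gy; apply/eqP; rewrite eq_sym subr_eq -linearD.
    by apply/eqP; congr (g _ _).
  by exists (f _ a' + z); rewrite linearD -(cfd f) -aE.
move=> [x [a z]] [dx /eqP + faz]; rewrite oppr_eq0 => /eqP da.
have [a' aE] : exists a', a = cd X' a'.
  apply: (qgf _).1 => //; exists (- g _ z); rewrite linearN -(cfd g) /=.
  by rewrite -[f _ a](addrK (cd Y z)) [f _ a + _]faz sub0r linearN.
have dz' : cd Y (z + f _ a') = 0 by rewrite linearD -(cfd f) -aE -[RHS]faz; abel.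
have [b db [c cE]] : exists2 b : X' (i + 1), cd X' b = 0 &
    exists c : X i, (x - g _ (z + f _ a')) - g _ (f _ b) = cd X c.
  apply: (qgf _).2; rewrite linearB -(cfd g) dz' linear0 subr0; exact: dx.
exists (z + f _ a' + f _ b).
  by rewrite linearD dz' -(cfd f) db linear0 addr0.
exists (c, (- (a' + b), 0)); apply: (congr2 pair); last apply: (congr2 pair) => /=.
- by rewrite -[RHS]cE /= (linearD (g _)); abel.
- by rewrite linearN opprK linearD -[diff X' b]/(cd X' b) db aE subr0 addr0.
- by rewrite linear0 linearN linearD; abel.
Qed.

End Closure.

Section Extensions.
Variable R : comPzRingType.
Implicit Types X Y Z P Q C M : cx R.

(** * Twisted extensions *)

(** [X[1]], with the sign of the differential but without reindexing: the term
    in degree [i] is [X (i + 1)]. *)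
Lemma shx_dd X i (x : X (i + 1)) : (\- @cd R X (i + 1 + 1)) ((\- @cd R X (i + 1)) x) = 0.
Proof. by rewrite /= linearN cdd !oppr0. Qed.

Definition shx X : cx R := @Cx R (fun i => X (i + 1)) (fun i => \- @cd R X (i + 1)) (@shx_dd X).

Lemma shxm_d X Y (f : cm X Y) i (x : shx X i) : f _ (cd (shx X) x) = cd (shx Y) (f _ x).
Proof. by rewrite /= linearN cfd. Qed.

Definition shxm X Y (f : cm X Y) : cm (shx X) (shx Y) :=
  @Cm R (shx X) (shx Y) (fun i => f (i + 1)) (@shxm_d X Y f).

Lemma qis_shx X Y (f : cm X Y) : qis f -> qis (shxm f).
Proof.
move=> qf i; split=> [x /eqP|y /eqP]; rewrite /= oppr_eq0 => /eqP dx.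
  move=> [y fx]; have [|z xE] := (qf (i + 1)).1 x dx; last by exists (- z); rewrite /= linearN opprK.
  by exists (- y); rewrite linearN.
have [z dz [y' yE]] := (qf (i + 1)).2 y dx; exists z; first by rewrite /= dz oppr0.
by exists (- y'); rewrite /= linearN opprK.
Qed.

Lemma conex_out_d X Y (f : cm X Y) i (p : conex f i) :
  mkLin (fun a (p q : conex f _) => erefl : (a *: p + q).1 = _) (cd _ p) =
  cd (shx X) (mkLin (fun a (p q : conex f _) => erefl : (a *: p + q).1 = _) p).
Proof. by []. Qed.

Definition conex_out X Y (f : cm X Y) : cm (conex f) (shx X) :=
  @Cm R (conex f) (shx X) _ (@conex_out_d X Y f).

(** The extension of [P0] by [P1] with class [w], in the form of the cocone of
    [w] : [P0 -> P1[1]]; its terms need no reindexing. *)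
Section Ext.
Variables (P1 P0 : cx R) (w : cm P0 (shx P1)).

Definition ext_fun i (p : (P1 i * P0 i)%type) : (P1 (i + 1)%R * P0 (i + 1)%R)%type :=
  (cd P1 p.1 + w i p.2, cd P0 p.2).

Lemma ext_linear i : linear (@ext_fun i).
Proof.
by move=> a p q; apply: (congr2 pair); rewrite /= !linearP // scalerDr addrACA.
Qed.

Lemma wd i (b : P0 i) : w _ (cd P0 b) = - cd P1 (w i b).
Proof. exact: (cfd w b). Qed.

Lemma ext_dd i (p : (P1 i * P0 i)%type) :
  mkLin (@ext_linear (i + 1)) (mkLin (@ext_linear i) p) = 0.
Proof.
apply: (congr2 pair) => /=; last exact: cdd.
by rewrite linearD cdd add0r wd subrr.
Qed.

Definition extx : cx R := @Cx R (fun i => (P1 i * P0 i)%type) _ ext_dd.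

Lemma projc_ext : projc P1 -> projc P0 -> projc extx.
Proof.
move=> [[b1 Pb1] p1] [[b0 Pb0] p0]; split=> [|i]; last exact: projective_prod.
exists (Num.max b1 b0) => i; rewrite ge_max => /andP[i1 i0] [x y].
by rewrite (Pb1 _ i1 x) (Pb0 _ i0 y).
Qed.

Lemma ext_bcomplex b1 b0 a1 a0 : above b1 P1 -> above b0 P0 ->
  below a1 P1 -> below a0 P0 -> (forall i, fin_gen (P1 i)) ->
  (forall i, fin_gen (P0 i)) -> exists Y : bcomplex R, cxb Y = extx.
Proof.
move=> Pb1 Pb0 Pa1 Pa0 f1 f0.
apply: (@bcomplexP _ _ (Num.min a1 a0) (Num.max b1 b0)) => i.
- by rewrite ge_max => /andP[i1 i0] [x y]; rewrite (Pb1 _ i1 x) (Pb0 _ i0 y).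
- by rewrite lt_min => /andP[i1 i0] [x y]; rewrite (Pa1 _ i1 x) (Pa0 _ i0 y).
- exact: fin_gen_prod.
Qed.
End Ext.

(** Given [f : X -> Y], the object [Y] is the extension of the cone of [f] by
    [X], and this lifts to resolutions: [w] lifts the projection from the cone
    to [X[1]], and a homotopy [k] for that lift corrects the map to [Y]. *)
Section ExtRes.
Variables (X Y : cx R) (f : cm X Y) (P1 P0 : cx R).
Variables (p1 : cm P1 X) (p0 : cm P0 (conex f)).
Hypotheses (q1 : qis p1) (q0 : qis p0) (pP0 : projc P0).

Lemma ext_resolution : exists (w : cm P0 (shx P1)) (e : cm (extx w) Y), qis e.
Proof.
have [w [k0 k0E]] := lift_htpy (compm (conex_out f) p0) pP0 (qis_shx q1).
have [k kE0] := @unshift_family (fun i => {linear P0 i -> X i}) k0.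
have kE : forall i (x : P0 i),
    p1 _ (w i x) = (p0 i x).1 - cd X (k i x) + k _ (cd P0 x).
  apply: int_succ_ind => i x; have := k0E i x; rewrite !kE0 /= => E.
  by rewrite -[LHS](subrK (p0 _ x).1) E; abel.
pose e_fun i (p : extx w i) : Y i := - f i (p1 i p.1) + (p0 i p.2).2 + f i (k i p.2).
have el i : linear (@e_fun i).
  move=> a p q; rewrite /e_fun /= (linearP (p1 i)) (linearP (p0 i)) (linearP (k i)).
    by rewrite !(linearP (f i)) /= !scalerDr scalerN; abel.
have p0d i (x : P0 i) : cd P0 x = cd P0 x -> p0 _ (cd P0 x) =
    (- cd X (p0 i x).1, f (i + 1) (p0 i x).1 + cd Y (p0 i x).2).
  by move=> _; rewrite cfd.
have ed i (p : extx w i) : mkLin (@el _) (cd _ p) = cd Y (mkLin (@el _) p).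
  case: p => a b; rewrite /= /e_fun /= (p0d _ b erefl) /=.
  rewrite !(linearD (cd Y)) (linearN (cd Y)) -!(cfd f) -(cfd p1) (linearD (p1 _)) kE.
  by rewrite !(linearD (f _)) (linearN (f _)); abel.
exists w, (Cm ed).
have surj i (y : Y (i + 1)) : cd Y y = 0 ->
    exists2 x : extx w (i + 1), cd _ x = 0 & exists y', y - e_fun _ x = cd Y y'.
  move=> dy.
  have [|b db [[x3 y3] [E1 E2]]] := (q0 i).2 (0, y).
    by apply: (congr2 pair); rewrite /= linear0 ?oppr0 // dy addr0.
  have {}E1 : (p0 _ b).1 = cd X x3 by apply/oppr_inj; rewrite -[RHS]E1 /=; abel.
  have [a0 a0E] : exists a0, w _ b = cd P1 a0.
    apply: (q1 _).1; first by have := cfd w b; rewrite db linear0 /= => /esym/eqP;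
      rewrite oppr_eq0 => /eqP.
    by exists (x3 - k _ b); rewrite kE db !linear0 linearB E1 addr0.
  have [a1 da1 [v vE]] : exists2 a1 : P1 (i + 1), cd P1 a1 = 0 &
      exists v, (x3 - k _ b - p1 _ a0) - p1 _ a1 = cd X v.
    apply: (q1 _).2; rewrite !linearB -(cfd p1) -a0E kE db !linear0 E1; abel.
  exists (- (a0 + a1), b).
    by apply: (congr2 pair); rewrite //= linearN linearD da1 -a0E; abel.
  exists (y3 + f _ v); rewrite (linearD (cd Y)) -(cfd f) -vE /e_fun /=.
  have -> : cd Y y3 = y - (p0 _ b).2 - f _ x3.
    by move: E2 => /= E2; apply: (addrI (f (i + 1) x3)); rewrite -[LHS]E2; abel.
  by rewrite (linearN (p1 _)) (linearD (p1 _)) (linearN (f _)) !(linearB (f _))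
    (linearD (f _)); abel.
have inj : forall i (x : extx w (i + 1)), cd _ x = 0 -> (exists y, e_fun _ x = cd Y y) ->
    exists x', x = cd (extx w) x'.
  apply: int_succ_ind => i [a b] [dab db] [y ey].
  have wbE : p1 _ (w _ b) = - cd X (p1 _ a).
    by rewrite -(cfd p1) -linearN; congr (p1 _ _); apply: (addrI (cd P1 a));
       rewrite [LHS]dab subrr.
  have x0E : (p0 _ b).1 = cd X (k _ b - p1 _ a).
    have := kE _ b; rewrite db linear0 addr0 wbE => E.
    by rewrite linearB -[(p0 _ b).1](subrK (cd X (k _ b))) -[_ - _]E; abel.
  have [b1 bE] : exists b1, b = cd P0 b1.
    apply: (q0 _).1 => //; exists (p1 _ a - k _ b, y).
    rewrite [LHS]surjective_pairing; apply: (congr2 pair) => /=.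
      by rewrite x0E -(linearN (cd X)) opprB.
    by rewrite -ey /e_fun /= (linearB (f _)); abel.
  pose a1 := a - w _ b1.
  have da1 : cd P1 a1 = 0.
    rewrite /a1 linearB; have := wd w b1; rewrite -bE => E.
    by rewrite -[RHS]dab /= E; abel.
  pose y2 := y - e_fun _ (0, b1).
  have y2E : cd Y y2 = - f _ (p1 _ a1).
    have E : e_fun _ (a, b) = - f _ (p1 _ a1) + e_fun _ (cd (extx w) (0, b1)).
      rewrite /e_fun /= -bE linear0 add0r /a1 (linearB (p1 _)) (linearB (f _)).
      by abel.
    rewrite /y2 linearB -ey E; have /= -> := ed _ (0, b1); by abel.
  have [|b2 db2 [[x3 y3] [E1 _]]] := (q0 i).2 (p1 _ a1, y2).
    by apply: (congr2 pair); rewrite /= -?(cfd p1) ?da1 ?linear0 ?oppr0 // y2E subrr.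
  have [a2 a2E] : exists a2, a1 - w _ b2 = cd P1 a2.
    apply: (q1 _).1.
      by rewrite linearB da1 sub0r; have := wd w b2; rewrite db2 linear0 => <-.
    exists (k _ b2 - x3); rewrite (linearB (p1 _)) (linearB (cd X)) kE db2 linear0.
    have -> : (p0 _ b2).1 = p1 _ a1 + cd X x3.
      by rewrite -[LHS](subKr (p1 _ a1)); move: E1 => /= ->; rewrite opprK.
    by abel.
  exists (a2, b1 + b2); apply: (congr2 pair) => /=.
    by rewrite -a2E (linearD (w _)) /a1; abel.
  by rewrite linearD db2 addr0.
by move=> i; split; [exact: inj | exact: surj].
Qed.
End ExtRes.

Lemma dsum_resolution (X1 X0 : bcomplex R) (P1 P0 : cx R) (p1 : cm P1 X1) (p0 : cm P0 X0) :
  qis p1 -> qis p0 -> exists (w : cm P0 (shx P1)) (p : cm (extx w) (dsum X1 X0)),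
    qis p /\ forall i b, w i b = 0.
Proof.
move=> q1 q0.
have w0 i (x : P0 i) : (\0 : {linear P0 (i + 1) -> shx P1 (i + 1)}) (cd P0 x) =
  cd (shx P1) ((\0 : {linear P0 i -> shx P1 i}) x).
  by rewrite linear0.
pose w : cm P0 (shx P1) := Cm w0.
pose p_fun i (x : extx w i) : dsum X1 X0 i := (p1 i x.1, p0 i x.2).
have pl i : linear (@p_fun i) by move=> a x y; apply: (congr2 pair); rewrite linearP.
have pd i (x : extx w i) : mkLin (@pl _) (cd _ x) = cd (dsum X1 X0) (mkLin (@pl _) x).
  by apply: (congr2 pair); rewrite /= ?addr0 cfd.
exists w, (@Cm R (extx w) (dsum X1 X0) _ pd); split=> // i; split.
  move=> [a b] [/= da db] [[x y] [/= ax bY]]; rewrite addr0 in da.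
  have [a' aE] : exists a', a = cd P1 a' by apply: (q1 _).1 => //; exists x.
  have [b' bE] : exists b', b = cd P0 b' by apply: (q0 _).1 => //; exists y.
  by exists (a', b'); apply: (congr2 pair); rewrite /= ?addr0.
move=> [x y] [dx dy].
have [a da [x' xE]] := (q1 _).2 x dx; have [b db [y' yE]] := (q0 _).2 y dy.
exists (a, b); first by apply: (congr2 pair); rewrite /= ?da ?addr0.
by exists (x', y'); apply: (congr2 pair).
Qed.

Lemma htpy_equiv_qis X Y (a : cm X Y) (b : cm Y X) :
  htpy (compm b a) (idm X) -> htpy (compm a b) (idm Y) -> qis a.
Proof.
move=> [h hE] [k kE] i; split=> [x dx [y ax]|y dy].
  have := hE i x; rewrite dx linear0 addr0 /= ax (cfd b) => E.
  by exists (b _ y - h _ x); rewrite linearB -E; abel.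
have := kE i y; rewrite dy linear0 addr0 /= => E.
exists (b _ y); first by rewrite -cfd dy linear0.
by exists (- k _ y); rewrite linearN -E opprB.
Qed.

End Extensions.

Section Factor.
Variable R : comPzRingType.
Variable T : subcat R.
Hypothesis noethR : noetherian_ring R.
Hypothesis triT : triangulated_subcat T.
Implicit Types (P Q M : cx R) (X Y : bcomplex R).

(** * Resolutions of objects of the subcategory *)

Definition inT P : Prop :=
  [/\ projc P, forall i, fin_gen (P i) & exists2 X, T X & exists p : cm P X, qis p].

Lemma inT_exact P : inT P -> exists l : int, forall i, i < l -> exact_at P i.
Proof.
move=> [_ _ [X _ [p qp]]]; have [a Xa] := bc_below X.
by exists (a - 1) => i ia; apply: (exact_qis qp Xa); lia.
Qed.

(** Both objects are compared with a common deep truncation of [P], so that all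
    quasi-isomorphisms are between bounded complexes. *)
Lemma inT_qis P Y (q : cm P Y) : inT P -> qis q -> T Y.
Proof.
move=> [[Pb _] Pfg [X TX [p qp]]] qq.
have [a Xa] := bc_below X; have [c Yc] := bc_below Y.
pose l := Num.min a c - 1.
have [i il|Q [t [qt Ql ts ti]]] := truncation Pb Pfg (l := l).
  by apply: (exact_qis qp Xa); lia.
have Xl : below (l + 1) X by move=> i il; apply: Xa; lia.
have Yl : below (l + 1) Y by move=> i il; apply: Yc; lia.
have [f fE] := factor_cm p ts ti Xl; have [g gE] := factor_cm q ts ti Yl.
have qf : qis f.
  apply: (qis_cancel_r (f := t)) => //; apply: qis_htpy qp.
  by apply: htpy_ext => i x /=; rewrite fE.
have qg : qis g.
  apply: (qis_cancel_r (f := t)) => //; apply: qis_htpy qq.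
  by apply: htpy_ext => i x /=; rewrite gE.
exact/(T_qis triT qg)/(T_qis triT qf).
Qed.

(** The cone is computed on truncations: the one of [Q] starts higher, so that
    the map descends. *)
Lemma inT_cone P Q (f : cm P Q) : inT P -> inT Q -> inT (conex f).
Proof.
move=> TP TQ; have [l1 ex1] := inT_exact TP; have [l2 ex2] := inT_exact TQ.
have [pP Pfg _] := TP; have [pQ Qfg _] := TQ.
split.
- split; last by move=> i; apply: projective_prod; [apply: pP.2 | apply: pQ.2].
  have [b Pb] := pP.1; have [c Qc] := pQ.1; exists (Num.max b c) => i.
  by rewrite ge_max => /andP[bi ci] [x y]; rewrite (Qc i ci y) (Pb (i + 1) _ x) //; lia.
- by move=> i; apply: fin_gen_prod.
pose l := Num.min l1 l2 - 1.
have exP i : i < l -> exact_at P i by move=> il; apply: ex1; lia.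
have exQ i : i < l + 1 -> exact_at Q i by move=> il; apply: ex2; lia.
have [X [p [qp Xl ps pi]]] := truncation pP.1 Pfg exP.
have [Y [q [qq Yl qs qi]]] := truncation pQ.1 Qfg exQ.
have [g gE] := factor_cm (compm q f) ps pi Yl.
exists (cone (bcm g)).
  by apply: T_cone => //; [apply: (inT_qis (q := p)) | apply: (inT_qis (q := q))].
have E i x : q i (f i x) = g i (p i x) by rewrite gE.
pose idc := @Cm R (conex g) (cone (bcm g)) (fun i => idfun) (fun i x => erefl).
exists (compm idc (cone_map E)); apply: qis_comp; last exact: qis_cone_map.
by apply: bij_qis => i x //; exists x.
Qed.

(** * Factoring maps to bounded below complexes *)

(** As [P] is a bounded above complex of projectives wherever this is used, chain
    maps up to homotopy are the derived category maps from [P].  The object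
    [Y] may depend on [g] and [M]; the bound [c] may not. *)
Definition factors P (a c : int) : Prop :=
  forall M, below a M -> forall g : cm P M, exists2 Y, T Y /\ below c Y &
    exists (y : cm P Y) (y' : cm Y M), htpy g (compm y' y).

Lemma factors_retract P Q a c (i : cm Q P) (r : cm P Q) :
  htpy (compm r i) (idm Q) -> factors P a c -> factors Q a c.
Proof.
move=> ri fP M Ma g; have [Y TY [y [y' E]]] := fP M Ma (compm g r).
exists Y => //; exists (compm y i), y'.
apply: htpy_trans (htpy_sym (htpy_idr g)) _.
apply: htpy_trans (comp_htpy_r g (htpy_sym ri)) _.
apply: htpy_trans (htpyA _ _ _) _; apply: htpy_trans (comp_htpy_l i E) _.
exact: htpy_ext.
Qed.

Lemma factors_diso X Y (P : res X) (Q : res Y) a c :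
  diso X Y -> factors P a c -> factors Q a c.
Proof.
by move=> /(diso_res P Q noethR)[u [v [_ uv]]]; apply: factors_retract uv.
Qed.

(** Agreement in degrees at least [k] makes chain maps from [P] and from [Y] to
    complexes in degrees above [k] the same, so that [Y], an object of [T], can
    replace the unbounded [P]. *)
Definition approx P (k l : int) : Prop :=
  exists2 Y, T Y /\ below l Y & exists t : cm P Y, forall i : int, k <= i ->
    (forall x, t i x = 0 -> x = 0) /\ (forall y, exists x, y = t i x).

Lemma factor_approx P Y (t : cm P Y) k (M : int -> lmodType R) :
  (forall i : int, k <= i ->
    (forall x, t i x = 0 -> x = 0) /\ (forall y, exists x, y = t i x)) ->
  (forall i : int, i < k -> forall m : M i, m = 0) ->
  forall f : forall i, {linear P i -> M i}, exists g : forall i, {linear Y i -> M i},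
    forall i x, g i (t i x) = f i x.
Proof.
move=> tk Mk f.
have gex i : exists g : {linear Y i -> M i}, forall x, g (t i x) = f i x.
  case: (ltP i k) => ik.
    exists \0 => x; rewrite (Mk i ik (f i x)); exact: (Mk i ik).
  have [ti ts] := tk i ik; apply: factor_surj => // x /ti ->.
  by rewrite linear0.
pose g i := projT1 (cid (gex i)).
by exists g => i x; rewrite /g; case: (cid (gex i)) => /= h ->.
Qed.

Lemma factors_approx P a k l : approx P k l -> k < a -> factors P a l.
Proof.
move=> [Y TY [t tk]] ka M Ma g; exists Y => //; exists t.
have [h hE] := factor_approx (M := M) tk (fun i ik => Ma i (lt_trans ik ka)) (cf g).
have hd i (y : Y i) : h _ (cd Y y) = cd M (h i y).
  case: (ltP (i + 1) a) => ia; first by rewrite [RHS](Ma _ ia) [LHS](Ma _ ia).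
  have [_ ts] := tk i ltac:(lia); have [x ->] := ts y.
  by rewrite -(cfd t) !hE cfd.
by exists (@Cm R Y M h hd); apply: htpy_ext => i x /=; rewrite hE.
Qed.

Lemma T_ext Y Y0 (w : cm Y0 (shx Y)) : T Y -> T Y0 ->
  exists2 Z : bcomplex R, cxb Z = extx w & T Z.
Proof.
move=> TY TY0.
have [b1 Yb] := bc_above Y; have [b0 Y0b] := bc_above Y0.
have [a1 Ya] := bc_below Y; have [a0 Y0a] := bc_below Y0.
have [Z ZE] := ext_bcomplex w Yb Y0b Ya Y0a (@cterm_fg _ Y) (@cterm_fg _ Y0).
exists Z => //.
have il i : linear (fun x : Y i => (x, 0) : extx w i).
  by move=> s u v; apply: (congr2 pair); rewrite //= scaler0 addr0.
have pl i : linear (fun x : extx w i => x.2) by [].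
have id_ i (x : Y i) : mkLin (@il _) (cd Y x) = cd (extx w) (mkLin (@il _) x).
  by apply: (congr2 pair); rewrite /= linear0 ?addr0.
have pd i (x : extx w i) : mkLin (@pl _) (cd _ x) = cd Y0 (mkLin (@pl _) x) by [].
pose im := @Cm R Y (extx w) _ id_; pose pm := @Cm R (extx w) Y0 _ pd.
have ii i x : im i x = 0 -> x = 0 by case.
have ps i z : exists u, z = pm i u by exists (0, z).
have pi0 i x : pm i (im i x) = 0 by [].
have ex i u : pm i u = 0 -> exists x, u = im i x.
  by case: u => u v /= ->; exists u.
move: im pm ii ps pi0 ex; rewrite -ZE => im pm ii ps pi0 ex.
exact: (T_ses_middle triT ii ps pi0 ex TY TY0).
Qed.

(** After a homotopy the restriction of [g] to [P1] is strictly a composite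
    [P1 -> Y -> M].  The bounds on [k] ensure that the remaining component
    [P0 -> M] and the class [P0 -> P1[1] -> Y[1]] only involve degrees in which
    [P0] agrees with its approximation [Y0]; so [g] factors strictly through
    the extension of [Y0] by [Y]. *)
Lemma factors_ext P1 P0 (w : cm P0 (shx P1)) a c k l :
  factors P1 a c -> approx P0 k l -> k < a -> k + 2 <= c ->
  factors (extx w) a (Num.min c l).
Proof.
move=> fP1 [Y0 [TY0 Y0l] [t tk]] ka kc M Ma g.
have g1l i : linear (fun x : P1 i => g i (x, 0)).
  move=> s x y; rewrite -linearP; congr (g i _).
  by apply: (congr2 pair); rewrite //= scaler0 addr0.
have g0l i : linear (fun x : P0 i => g i (0, x)).
  move=> s x y; rewrite -linearP; congr (g i _).
  by apply: (congr2 pair); rewrite //= scaler0 addr0.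
have g1d i (x : P1 i) : mkLin (@g1l _) (cd P1 x) = cd M (mkLin (@g1l _) x).
  rewrite /= -(cfd g); congr (g _ _).
  by apply: (congr2 pair); rewrite /= linear0 ?addr0.
have gE i (x : extx w i) : g i x = g i (x.1, 0) + g i (0, x.2).
  rewrite -linearD; congr (g i _); rewrite [LHS]surjective_pairing.
  by apply: (congr2 pair); rewrite /= ?addr0 ?add0r.
have [Y [TY Yc] [y [y' [h hE]]]] := fP1 M Ma (Cm g1d).
have [w' w'E] := factor_approx (M := fun i => Y (i + 1)) tk
  (fun i ik => Yc (i + 1) ltac:(lia)) (fun i => y (i + 1) \o w i).
have w'd i (b : Y0 i) : w' _ (cd Y0 b) = cd (shx Y) (w' i b).
  case: (ltP i k) => ik.
    have Y0_ := Yc (i + 1 + 1) ltac:(lia).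
    by rewrite [LHS]Y0_ [RHS]Y0_.
  have [_ ts] := tk i ik; have [x ->] := ts b.
  by rewrite -(cfd t) !w'E /= wd linearN cfd.
pose w2 : cm Y0 (shx Y) := @Cm R Y0 (shx Y) w' w'd.
have [G0 G0E] := factor_approx (M := M) tk (fun i ik => Ma i (lt_trans ik ka))
  (fun i => mkLin (@g0l i) \- (h i \o w i)).
have [Z ZE TZ] := T_ext w2 TY TY0.
have Zb : below (Num.min c l) Z.
  rewrite ZE => i; rewrite lt_min => /andP[ic il] [u v].
  by rewrite (Yc _ ic u) (Y0l _ il v).
exists Z; first by [].
have e1l i : linear (fun x : extx w i => (y i x.1, t i x.2) : extx w2 i).
  by move=> s u v; apply: (congr2 pair); rewrite linearP.
have e1d i (x : extx w i) : mkLin (@e1l _) (cd _ x) = cd (extx w2) (mkLin (@e1l _) x).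
  by apply: (congr2 pair); rewrite /= ?(linearD (y _)) ?w'E !cfd.
have e2l i : linear (fun x : extx w2 i => y' i x.1 + G0 i x.2).
  by move=> s u v; rewrite /= !linearP scalerDr addrACA.
have e2d i (x : extx w2 i) : mkLin (@e2l _) (cd _ x) = cd M (mkLin (@e2l _) x).
  case: (ltP (i + 1) a) => ia; first by rewrite [RHS](Ma _ ia) [LHS](Ma _ ia).
  case: x => u v; have [_ ts] := tk i ltac:(lia); have [b ->] := ts v.
  rewrite /= w'E -(cfd t) !G0E /= (linearD (y' _)) (linearD (cd M)) -(cfd y').
  have E1 := hE i (w i b); rewrite /= in E1.
  have E2 : g _ (w i b, 0) + g _ (0, cd P0 b) = cd M (g i (0, b)).
    have := cfd g (0, b : P0 i) => /= <-; rewrite [RHS]gE /= linear0 add0r.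
    by [].
  rewrite wd (linearN (h _)) (linearB (cd M)) -E2 -[g _ (w i b, 0)](subrK (y' _ (y _ (w i b)))) E1.
  by abel.
pose e1 := @Cm R (extx w) (extx w2) _ e1d; pose e2 := @Cm R (extx w2) M _ e2d.
have gh : htpy g (compm e2 e1).
  have Hl i : linear (fun x : extx w (i + 1) => h i x.1).
    by move=> s u v; rewrite /= linearP.
  exists (fun i => mkLin (@Hl i)) => i [u v]; rewrite gE /= G0E /= (linearD (h _)).
  have /= E1 := hE i u.
  transitivity (g _ (u, 0) - y' _ (y _ u) + h _ (w _ v)); first by abel.
  by rewrite E1; abel.
move: e1 e2 gh; rewrite -ZE => e1 e2 gh.
by exists e1, e2.
Qed.

End Factor.

Section Generator.
Variable R : comPzRingType.
Variable T : subcat R.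
Hypothesis noethR : noetherian_ring R.
Hypothesis triT : triangulated_subcat T.
Hypothesis thickT : thick T.
Variable G : bcomplex R.
Hypothesis TG : T G.
Implicit Types (P Q M : cx R) (X Y : bcomplex R).

Lemma diso_sym X Y : diso X Y -> diso Y X.
Proof. by move=> [f [g [gf fg]]]; exists g, f. Qed.

Lemma res_bounded X b : above b X -> exists P : res X,
  above b P /\ forall i, fin_gen (P i).
Proof.
move=> Xb; have [F [F0 [p qp]]] := resolution noethR Xb (@cterm_fg _ X).
exists (Res (projc_fcx F0) qp); split; first exact: above_fcx.
by move=> i; apply: fin_gen_rV.
Qed.

(** The bound [l] does not depend on the list: the shifts of [G] that reach
    degrees at least [k] are bounded on one side, and the others contribute
    nothing in these degrees. *)
Lemma approx_sum (k : int) : exists l : int, forall ns,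
  exists P : res (sum_of_shifts G ns), approx T P k l.
Proof.
have [b Gb] := bc_above G; have [a Ga] := bc_below G.
exists (Num.min k (a - b + k) - 2); elim=> [|n ns [P [Y [TY Yl] [t tk]]]].
  exists (@Res R zeroc (cxb zeroc) (idm _) (conj (ex_intro _ 0 (fun i _ x => thinmx0 x))
    (fun i => @projective_rV R 0)) (bij_qis (f := idm _) (fun i x h => h)
    (fun i y => ex_intro _ y erefl))).
  exists zeroc; first by split; [exact: tri_zero triT | move=> i _ x; exact: thinmx0].
  by exists (idm _) => i _; split=> [x //|y]; exists y.
have Gnb : above (b - n) (shift n G) by move=> i ib x; apply: Gb; lia.
have Gna : below (a - n) (shift n G) by move=> i ib x; apply: Ga; lia.
have [Q [Qb Qfg]] := res_bounded Gnb.
have [w [p [qp w0]]] := dsum_resolution (@rqis _ _ Q) (@rqis _ _ P).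
exists (Res (projc_ext w (rproj Q) (rproj P)) qp).
case: (leP (b - n) k) => nk.
  exists Y => //.
  have tl i : linear (fun x : extx w i => t i x.2) by move=> s u v; rewrite linearP.
  have td i (x : extx w i) : mkLin (@tl _) (cd _ x) = cd Y (mkLin (@tl _) x).
    by rewrite /= cfd.
  exists (@Cm R (extx w) Y _ td) => i ik; have [ti ts] := tk i ik; split.
    move=> [u v] /= /ti ->; rewrite (Qb i _ u) //; lia.
  by move=> y; have [x ->] := ts y; exists (0, x).
have inQ : inT T Q.
  split=> //; [exact: rproj | exists (shift n G); first exact: (tri_shift triT)].
  by exists (rp Q); apply: rqis.
have exQ i : i < Num.min k (a - b + k) - 2 -> exact_at Q i.
  by move=> il; apply: (exact_qis (@rqis _ _ Q) Gna); lia.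
have [Z [z [qz Zl zs zi]]] := truncation (proj1 (rproj Q)) Qfg exQ.
have TZ : T Z by apply: (inT_qis triT inQ qz).
exists (dsum Z Y).
  split; first exact: T_dsum.
  by move=> i il [u v]; rewrite (Zl i il u) (Yl i il v).
have tl i : linear (fun x : extx w i => (z i x.1, t i x.2) : dsum Z Y i).
  by move=> s u v; apply: (congr2 pair); rewrite linearP.
have td i (x : extx w i) : mkLin (@tl _) (cd _ x) = cd (dsum Z Y) (mkLin (@tl _) x).
  by apply: (congr2 pair); rewrite /= ?w0 ?addr0 cfd.
exists (@Cm R (extx w) (dsum Z Y) _ td) => i ik; have [ti ts] := tk i ik; split.
  have il : Num.min k (a - b + k) - 2 < i by lia.
  by move=> [u v] [/(zi i il) -> /ti ->].
move=> [u v]; have [x ->] := zs i u; have [y ->] := ts v.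
by exists (x, y).
Qed.

(** In a distinguished triangle with third term a sum of shifts of [G], the
    middle term is an extension to which the step above applies; the bound for
    the first term determines how much of the sum has to be kept. *)
Lemma factors_gen_ext (k : nat) (a : int) : exists c : int, forall X,
  gen_ext T G k X -> forall P : res X, factors T P a c.
Proof.
elim: k a => [|n IHn] a.
  have [l lP] := approx_sum (a - 1); exists l => X [_ [ns Xns]] P.
  have [Q Qa] := lP ns; apply: (factors_diso noethR (diso_sym Xns) (P := Q)).
  by apply: factors_approx Qa _; lia.
have [c cP] := IHn a; pose k := Num.min (a - 1) (c - 2).
have [l lP] := approx_sum k; exists (Num.min c l) => X.
move=> [_ [E [F0 [u [v [w [EG [_ [ns F0ns]] trg]]]]]]] P.
have {trg} [X' [Y' [f [ea [eb [ec [[dea deb dec] _]]]]]]] := trg.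
have XY : diso X Y' by exists eb.
have EX : diso E X' by exists ea.
have FC : diso F0 (cone f) by exists ec.
have [PE] := res_exists E noethR; have [PX] := res_exists X' noethR.
have fPX : factors T PX a c := factors_diso noethR EX (cP E EG PE).
have [P0 P0a] := lP ns.
have [PF] := res_exists F0 noethR; have [PC] := res_exists (cone f) noethR.
have [a1 [b1 [ba1 ab1]]] := diso_res P0 PF noethR (diso_sym F0ns).
have [a2 [b2 [ba2 ab2]]] := diso_res PF PC noethR FC.
pose idc := @Cm R (cone f) (conex f) (fun i => idfun) (fun i x => erefl).
have qidc : qis idc by apply: bij_qis => i x //; exists x.
have qP0 : qis (compm idc (compm (rp PC) (compm a2 a1))).
  apply: qis_comp => //; apply: qis_comp; first exact: rqis.
  by apply: qis_comp; [apply: htpy_equiv_qis ba2 ab2 | apply: htpy_equiv_qis ba1 ab1].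
have [w' [e qe]] := ext_resolution (@rqis _ _ PX) qP0 (rproj P0).
pose Q : res Y' := Res (projc_ext w' (rproj PX) (rproj P0)) qe.
apply: (factors_diso noethR (diso_sym XY) (P := Q)).
by apply: (factors_ext triT fPX P0a); rewrite /k; lia.
Qed.

Lemma factors_gen_add (k : nat) (a : int) : exists c : int, forall X,
  gen_add T G k X -> forall P : cx R, projc P -> forall p : cm P X, qis p ->
  factors T P a c.
Proof.
have [c cP] := factors_gen_ext k a; exists c => X [E EG [TX [F TF EXF]]] P pP p qp.
have [PE] := res_exists E noethR; have [PF] := res_exists F noethR.
have [w [q [qq w0]]] := dsum_resolution qp (@rqis _ _ PF).
pose Q : res (dsum X F) := Res (projc_ext w pP (rproj PF)) qq.
have fQ : factors T Q a c := factors_diso noethR EXF (cP E EG PE).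
have il i : linear (fun x : P i => (x, 0) : extx w i).
  by move=> s u v; apply: (congr2 pair); rewrite //= scaler0 addr0.
have pl i : linear (fun x : extx w i => x.1) by [].
have id_ i (x : P i) : mkLin (@il _) (cd P x) = cd (extx w) (mkLin (@il _) x).
  by apply: (congr2 pair); rewrite /= linear0 ?addr0.
have pd i (x : extx w i) : mkLin (@pl _) (cd _ x) = cd P (mkLin (@pl _) x).
  by rewrite /= w0 addr0.
apply: (factors_retract (i := @Cm R P (extx w) _ id_) (r := @Cm R (extx w) P _ pd) _ fQ).
exact: htpy_ext.
Qed.

(** * Annihilators of cohomology *)

Definition kills (r : R) (X : cx R) : Prop :=
  forall i (x : X (i + 1)), cd X x = 0 -> exists y, r *: x = cd X y.

Lemma kills_qis (X Y : cx R) (f : cm X Y) r : qis f -> kills r X <-> kills r Y.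
Proof.
move=> qf; split=> [kX i y dy|kY i x dx].
  have [x dx [y' yE]] := (qf i).2 y dy; have [x' xE] := kX i x dx.
  exists (r *: y' + f _ x'); rewrite linearD linearZ /= -yE -(cfd f) -xE linearZ /=.
  by rewrite scalerBr subrK.
apply: (qf i).1; first by rewrite linearZ /= dx scaler0.
have [|y yE] := kY i (f _ x); first by rewrite -cfd dx linear0.
by exists y; rewrite linearZ.
Qed.

Lemma kills_diso X Y r : diso X Y -> kills r X -> kills r Y.
Proof.
move=> XY kX; have [P] := res_exists X noethR; have [Q] := res_exists Y noethR.
have [u [v [vu uv]]] := diso_res P Q noethR XY.
apply/(kills_qis _ (@rqis _ _ Q)).1/(kills_qis _ (htpy_equiv_qis vu uv)).1.
exact/(kills_qis _ (@rqis _ _ P)).2.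
Qed.

Lemma kills_shift (X : bcomplex R) n r : kills r X -> kills r (shift n X).
Proof.
move=> kX i x dx; pose e : i + n + 1 = i + 1 + n := addrAC i n 1.
pose x' : X (i + n + 1) := @cast R X _ _ (esym e) x.
have xE : x = cast e x' by rewrite /x' cast_comp cast_id.
have dx' : diff X x' = 0.
  have := congr1 (fun z => (-1) ^+ absz n *: z) dx.
  rewrite -[cd _ x]/(diff (shift n X) x) shift_diffE signZK scaler0 xE.
  rewrite (cast_diff _ (congr1 (+%R^~ 1) e)) cast_comp; set e1 := etrans _ _.
  move/(congr1 (@cast R X _ _ (esym e1))).
  by rewrite cast_comp cast_id linear0.
have [y yE] := kX _ x' dx'; exists ((-1) ^+ absz n *: y).
have /= yE' : r *: x' = diff X y := yE.
have -> : cd (shift n X) ((-1) ^+ absz n *: y) = cast e (diff X y).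
  rewrite linearZ /= -[shift_diff_fun _]/(diff (shift n X) y) shift_diffE.
  exact: signZK.
have castZ (z : X (i + n + 1)) : cast e (r *: z) = r *: cast e z by rewrite linearZ.
by rewrite -yE' castZ xE.
Qed.

Lemma kills_sum (r : R) ns : kills r G -> kills r (sum_of_shifts G ns).
Proof.
move=> kG; elim: ns => [|n ns IH] i.
  by move=> x _; exists 0; rewrite linear0; apply: thinmx0.
move=> [x y] [dx dy]; have [y' yE] := IH i y dy.
have [x' xE] := kills_shift kG dx.
by exists (x', y'); apply: (congr2 pair).
Qed.

Lemma kills_cone (X Y : bcomplex R) (f : chain_map X Y) r s :
  kills r X -> kills s (cone f) -> kills (r * s) Y.
Proof.
move=> kX kC i y dy.
have [|[a b] [E1 E2]] := kC i (0, y).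
  by apply: (congr2 pair); rewrite /= linear0 ?oppr0 // add0r.
have da : diff X a = 0 by apply: oppr_inj; rewrite oppr0 -[LHS]E1 /= scaler0.
have [c cE] := kX _ a da.
have /= {}E2 : s *: y = f _ a + diff Y b := E2.
exists (f _ c + r *: b).
rewrite -scalerA E2 scalerDr linearD (linearZZ (cd Y)) /=; congr (_ + _).
by rewrite -(linearZZ (f _)) [r *: a]cE (cmap_diff f).
Qed.

Lemma kills_gen_ext (I : set R) (k : nat) X : (forall r, I r -> kills r G) ->
  gen_ext T G k X -> forall rs : seq R, size rs = k.+1 ->
  (forall r, r \in rs -> I r) -> kills (\prod_(r <- rs) r) X.
Proof.
move=> IG; elim: k X => [|k IHk] X.
  move=> [_ [ns Xns]] [|r [|//]] // _ rI; rewrite big_seq1.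
  apply: (kills_diso (diso_sym Xns)); apply/kills_sum/IG/rI.
  by rewrite mem_head.
move=> [_ [E [F0 [u [v [w [EG [_ [ns F0ns]] trg]]]]]]] [//|r rs] [szrs] rI.
have {trg} [X' [Y' [f [ea [eb [ec [[dea deb dec] _]]]]]]] := trg.
rewrite big_cons mulrC; apply: (kills_diso (diso_sym (ex_intro _ eb deb))).
apply: kills_cone.
  apply: (kills_diso (ex_intro _ ea dea)); apply: IHk => // s srs.
  by apply: rI; rewrite in_cons srs orbT.
apply: (kills_diso (ex_intro _ ec dec)); apply: (kills_diso (diso_sym F0ns)).
by apply/kills_sum/IG/rI; rewrite mem_head.
Qed.

Lemma kills_gen_add (I : set R) (k : nat) X : (forall r, I r -> kills r G) ->
  gen_add T G k X -> forall rs : seq R, size rs = k.+1 ->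
  (forall r, r \in rs -> I r) -> kills (\prod_(r <- rs) r) X.
Proof.
move=> IG [E EG [TX [F TF EXF]]] rs srs rI i x dx.
have [|[y z] [yE _]] := kills_diso EXF (kills_gen_ext IG EG srs rI) (x := (x, 0)) (i := i).
  by apply: (congr2 pair); rewrite //= linear0.
by exists y.
Qed.

End Generator.

Section Tensor.
Variable R : comPzRingType.
Variable F : fcx R.
Implicit Types A B : lmodType R.

(** * Tensoring a free complex with a module *)

Definition coef i (k : 'I_(rk F i)) (l : 'I_(rk F (i + 1))) : R :=
  fd F i (delta_mx 0 k) 0 l.

Lemma fdE i (x : F i) l : fd F i x 0 l = \sum_k x 0 k * coef k l.
Proof.
rewrite [x in LHS]row_sum_delta linear_sum summxE; apply: eq_bigr => k _.
by rewrite linearZ mxE.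
Qed.

Lemma coef_coef i (k : 'I_(rk F i)) l : \sum_m coef k m * @coef (i + 1) m l = 0.
Proof.
have /rowP/(_ l) := @fdd _ F i (delta_mx 0 k).
by rewrite fdE mxE => E; rewrite -[RHS]E.
Qed.

Section TensorModule.
Variable B : lmodType R.

Definition tens_fun i (x : {ffun 'I_(rk F i) -> B}) : {ffun 'I_(rk F (i + 1)) -> B} :=
  [ffun l => \sum_k coef k l *: x k].

Lemma tens_linear i : linear (@tens_fun i).
Proof.
move=> a x y; apply/ffunP => l; rewrite !ffunE scaler_sumr -big_split.
apply: eq_bigr => k _ /=; rewrite !ffunE scalerDr !scalerA.
by rewrite [a * _]mulrC.
Qed.

Lemma tens_dd i (x : {ffun 'I_(rk F i) -> B}) :
  mkLin (@tens_linear (i + 1)) (mkLin (@tens_linear i) x) = 0.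
Proof.
apply/ffunP => l; rewrite !ffunE.
rewrite (eq_bigr (fun m => \sum_k (coef k m * coef m l) *: x k)); last first.
  move=> m _; rewrite ffunE scaler_sumr; apply: eq_bigr => k _.
  by rewrite scalerA mulrC.
rewrite exchange_big big1 // => k _ /=.
by rewrite -scaler_suml coef_coef scale0r.
Qed.

Definition tens : cx R := @Cx R (fun i => {ffun 'I_(rk F i) -> B}) _ tens_dd.

Lemma tensE i (x : tens i) l : cd tens x l = \sum_k coef k l *: x k.
Proof. by rewrite /= ffunE. Qed.
End TensorModule.

Section TensorMap.
Variables (A B : lmodType R) (f : {linear A -> B}).

Definition tensm_fun i (x : tens A i) : tens B i := [ffun k => f (x k)].

Lemma tensm_linear i : linear (@tensm_fun i).
Proof. by move=> a x y; apply/ffunP => k; rewrite !ffunE linearP. Qed.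

Lemma tensm_d i (x : tens A i) :
  mkLin (@tensm_linear _) (cd _ x) = cd _ (mkLin (@tensm_linear _) x).
Proof.
apply/ffunP => l; rewrite !ffunE linear_sum; apply: eq_bigr => k _.
by rewrite linearZ ffunE.
Qed.

Definition tensm : cm (tens A) (tens B) := Cm tensm_d.

Lemma tensmE i (x : tens A i) k : tensm i x k = f (x k).
Proof. by rewrite /= ffunE. Qed.
End TensorMap.

(** ** Powers of a complex *)

Definition powx_fun r (X : cx R) i (x : {ffun 'I_r -> X i}) : {ffun 'I_r -> X (i + 1)} :=
  [ffun j => cd X (x j)].

Lemma powx_linear r (X : cx R) i : linear (@powx_fun r X i).
Proof. by move=> a x y; apply/ffunP => j; rewrite !ffunE linearP. Qed.

Lemma powx_dd r (X : cx R) i (x : {ffun 'I_r -> X i}) :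
  mkLin (@powx_linear r X (i + 1)) (mkLin (@powx_linear r X i) x) = 0.
Proof. by apply/ffunP => j; rewrite !ffunE cdd. Qed.

Definition powx r (X : cx R) : cx R := @Cx R (fun i => {ffun 'I_r -> X i}) _ (@powx_dd r X).

Variable T : subcat R.
Hypothesis noethR : noetherian_ring R.
Hypothesis triT : triangulated_subcat T.
Hypothesis thickT : thick T.

Lemma powx_T r (P : cx R) (X : bcomplex R) (p : cm P X) : T X -> qis p ->
  exists2 Y : bcomplex R, T Y & exists q : cm (powx r P) Y, qis q.
Proof.
move=> TX qp; elim: r => [|r [Y TY [q qq]]].
  exists zeroc; first exact: tri_zero triT.
  have z0 i (x : powx 0 P i) : (\0 : {linear powx 0 P (i + 1) -> zeroc (i + 1)})
     (cd _ x) = diff zeroc ((\0 : {linear powx 0 P i -> zeroc i}) x) by [].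
  exists (@Cm R (powx 0 P) zeroc _ z0); apply: bij_qis => i x.
    by move=> _; apply/ffunP => -[].
  by exists 0; apply: thinmx0.
have [w [e [qe w0]]] := dsum_resolution qp qq.
exists (dsum X Y); first exact: T_dsum.
have sl i : linear (fun x : {ffun 'I_r.+1 -> P i} =>
    (x ord0, [ffun j => x (lift ord0 j)]) : extx w i).
  move=> a x y; apply: (congr2 pair); first by rewrite !ffunE.
  by apply/ffunP => j; rewrite !ffunE.
have sd i (x : powx r.+1 P i) : mkLin (@sl _) (cd _ x) = cd (extx w) (mkLin (@sl _) x).
  apply: (congr2 pair); first by rewrite /= w0 addr0 ffunE.
  by apply/ffunP => j; rewrite !ffunE.
pose s := @Cm R (powx r.+1 P) (extx w) _ sd.
exists (compm e s); apply: qis_comp => //; apply: bij_qis.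
  move=> i x [x0 /ffunP xj]; apply/ffunP => j; rewrite ffunE.
  by case: (unliftP ord0 j) => [k ->|-> //]; have := xj k; rewrite !ffunE.
move=> i [u v]; exists [ffun j => if unlift ord0 j is Some k then v k else u].
apply: (congr2 pair); first by rewrite ffunE unlift_none.
by apply/ffunP => j; rewrite !ffunE liftK.
Qed.

Variables (b : int) (G : bcomplex R) (p : cm F G).
Hypotheses (F0 : forall i : int, b <= i -> rk F i = 0%N) (TG : T G) (qp : qis p).

Lemma tens_above B : above b (tens B).
Proof.
by move=> i bi x; apply/ffunP => -[m mi]; exfalso; move: mi; rewrite F0.
Qed.

Lemma tens_free_inT r : inT T (tens 'rV[R]_r).
Proof.
split.
- split; first by exists b; apply: tens_above.
  by move=> i; apply/projective_ffun/projective_rV.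
- by move=> i; apply/fin_gen_ffun/fin_gen_rV.
have [Y TY [q qq]] := powx_T r TG qp; exists Y => //.
have tl i : linear (fun x : {ffun 'I_(rk F i) -> 'rV[R]_r} =>
    [ffun j : 'I_r => \row_k x k 0 j] : {ffun 'I_r -> 'rV[R]_(rk F i)}).
  by move=> a x y; apply/ffunP => j; apply/rowP => k; rewrite !(ffunE, mxE).
have td i (x : tens 'rV[R]_r i) : mkLin (@tl _) (cd _ x) = cd (powx r F) (mkLin (@tl _) x).
  apply/ffunP => j; rewrite !ffunE; apply/rowP => k; rewrite mxE [RHS]fdE tensE summxE.
  by apply: eq_bigr => m _; rewrite !mxE mulrC.
pose tm := @Cm R (tens 'rV[R]_r) (powx r F) _ td.
exists (compm q tm); apply: qis_comp => //; apply: bij_qis.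
  move=> i x /ffunP x0; apply/ffunP => k; apply/rowP => j.
  by have /rowP/(_ k) := x0 j; rewrite !(ffunE, mxE).
move=> i y; exists [ffun k => \row_j y j 0 k].
by apply/ffunP => j; rewrite !ffunE; apply/rowP => k; rewrite !(ffunE, mxE).
Qed.

(** If [0 -> B' -> R^r -> B -> 0] is exact, then [tens B] is quasi-isomorphic to
    the cone of [tens B' -> F^r], and an approximation of [tens B'] gives one
    of [tens B] that is one degree deeper.  Above degree [b] the zero complex
    is an approximation. *)
Lemma tens_approx_aux (n : nat) B : fin_gen B -> exists2 Q, inT T Q &
  exists q : cm Q (tens B), forall i, b - n%:Z <= i -> exact_at (conex q) i.
Proof.
elim: n B => [|n IHn] B fgB.
  exists (cxb zeroc).
    split=> [|i|]; first split.
    - by exists 0 => i _ x; apply: thinmx0.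
    - by move=> i; apply: projective_rV.
    - exact: zero_fg.
    - exists zeroc; first exact: tri_zero triT.
      by exists (idm _); apply: bij_qis => // i y; exists y.
  have zd i (x : zeroc i) : (\0 : {linear zeroc (i + 1) -> tens B (i + 1)}) (diff zeroc x)
      = cd (tens B) ((\0 : {linear zeroc i -> tens B i}) x).
    exact: esym (linear0 (@cd _ (tens B) i)).
  exists (@Cm R (cxb zeroc) (tens B) _ zd) => i bi [x y] _; exists 0.
  rewrite linear0; apply: (congr2 pair); first exact: thinmx0.
  by apply: tens_above; lia.
have [r [g gP]] := fgB.
have [rho rhoE] := rV_ext g.
have rho_surj y : exists x, y = rho x.
  have [c ->] := gP y; exists (\row_k c k).
  rewrite [X in rho X]row_sum_delta linear_sum; apply: eq_bigr => k _.
  by rewrite linearZ rhoE mxE.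
have kerS : submod ((fun x => rho x = 0) : set 'rV[R]_r).
  split=> [|x y x0 y0|a x x0]; first exact: linear0.
    by rewrite linearD x0 y0 addr0.
  by rewrite linearZ /= x0 scaler0.
have [m [h [hS hP]]] := noetherian_submod noethR (fin_gen_rV R r) kerS.
have [sigma sigmaE] := rV_ext h.
have kerT : submod ((fun x => sigma x = 0) : set 'rV[R]_m).
  split=> [|x y x0 y0|a x x0]; first exact: linear0.
    by rewrite linearD x0 y0 addr0.
  by rewrite linearZ /= x0 scaler0.
pose B' := quo kerT.
have [iota iotaE] : exists iota : {linear B' -> 'rV[R]_r},
    forall x, iota (proj_quo kerT x) = sigma x.
  apply: factor_surj => [v|x /(proj_quo0 kerT) //]; exact: proj_quo_surj.
have iota_inj x : iota x = 0 -> x = 0.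
  have [u ->] := proj_quo_surj x; rewrite iotaE => su.
  by apply/(proj_quo0 kerT).
have rho_iota x : rho (iota x) = 0.
  have [u ->] := proj_quo_surj x; rewrite iotaE (row_sum_delta u) !linear_sum big1 // => k _.
  by rewrite !linearZ /= sigmaE hS scaler0.
have iota_ex x : rho x = 0 -> exists t, x = iota t.
  move=> /hP[c ->]; exists (proj_quo kerT (\row_k c k)); rewrite iotaE.
  rewrite [X in sigma X]row_sum_delta linear_sum; apply: eq_bigr => k _.
  by rewrite linearZ /= sigmaE mxE.
have [Q' TQ' [q' q'ex]] := IHn B' (fin_gen_quo kerT (fin_gen_rV R m)).
pose j := compm (tensm iota) q'.
exists (conex j); first by apply: inT_cone => //; apply: tens_free_inT.
have ql i : linear (fun x : conex j i => tensm rho i x.2).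
  by move=> a x y; apply: (linearP (tensm rho i)).
have qd i (x : conex j i) : mkLin (@ql _) (cd _ x) = cd (tens B) (mkLin (@ql _) x).
  rewrite -[LHS]/(tensm rho _ (j _ x.1 + cd _ x.2)) (linearD (tensm rho _)) (cfd (tensm rho)).
  have -> : tensm rho _ (j _ x.1) = 0.
    by apply/ffunP => k; rewrite tensmE tensmE rho_iota ffunE.
  by rewrite add0r.
have lift_z i (v : tens B i) : exists z, v = tensm rho i z.
  have /choice[z zE] : forall k, exists z, v k = rho z by move=> k; apply: rho_surj.
  by exists (finfun z); apply/ffunP => k; rewrite tensmE ffunE.
have lift_t i (x : tens 'rV[R]_r i) : tensm rho i x = 0 -> exists t, x = tensm iota i t.
  move=> /ffunP x0.
  have /choice[t tE] : forall k, exists t, x k = iota t.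
    by move=> k; apply: iota_ex; have := x0 k; rewrite tensmE ffunE.
  by exists (finfun t); apply/ffunP => k; rewrite tensmE ffunE.
have inj_t i (t : tens B' i) : tensm iota i t = 0 -> t = 0.
  move=> /ffunP t0; apply/ffunP => k; rewrite ffunE; apply: iota_inj.
  by have := t0 k; rewrite tensmE ffunE.
have rho_iota0 i (t : tens B' i) : tensm rho i (tensm iota i t) = 0.
  by apply/ffunP => k; rewrite !tensmE rho_iota ffunE.
exists (Cm qd) => i bi [[a y] v] [E1 E2 E3].
have da : cd Q' a = 0 by rewrite -[LHS]opprK; exact: E1.
have jay : j _ a + cd (tens 'rV[R]_r) y = 0 by apply: oppr_inj; rewrite oppr0; exact: E2.
have {}E3 : tensm rho _ y + cd (tens B) v = 0 := E3.
have [z vz] := lift_z _ v.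
have [t tE] : exists t, y + cd (tens 'rV[R]_r) z = tensm iota _ t.
  by apply: lift_t; rewrite linearD (cfd (tensm rho)) -vz.
have bi1 : b - n%:Z <= i + 1 by lia.
have [|[a' t'] [aE tE']] := q'ex (i + 1) bi1 (a, t).
  apply: (congr2 pair); first by rewrite /= da oppr0.
  apply: inj_t; rewrite linearD (cfd (tensm iota)) -tE linearD cdd addr0.
  exact: jay.
have {}aE : a = - cd Q' a' := aE.
have {}tE' : t = q' _ a' + cd (tens B') t' := tE'.
exists ((- a', z - tensm iota _ t'), 0).
have yE : y = - (j _ (- a') + cd (tens 'rV[R]_r) (z - tensm iota _ t')).
  have -> : y = tensm iota _ (q' _ a') + tensm iota _ (cd (tens B') t')
      - cd (tens 'rV[R]_r) z by rewrite -linearD -tE' -tE addrK.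
  rewrite (linearN (j _)) (linearB (cd (tens 'rV[R]_r))) -(cfd (tensm iota)).
  have -> : j _ a' = tensm iota _ (q' _ a') by [].
  by abel.
have aE' : a = - - cd Q' (- a') by rewrite (linearN (cd Q')) opprK.
have vE : v = tensm rho _ (z - tensm iota _ t') + cd (tens B) 0.
  by rewrite linearB rho_iota0 subr0 linear0 addr0.
apply: (congr2 pair); last exact: vE.
by apply: (congr2 pair); [exact: aE' | exact: yE].
Qed.

Lemma tens_approx (N : int) B : fin_gen B -> exists2 Q, inT T Q &
  exists q : cm Q (tens B), forall i, N <= i -> exact_at (conex q) i.
Proof.
move=> /(tens_approx_aux `|b - N|%N)[Q TQ [q qex]]; exists Q => //; exists q => i Ni.
by apply: qex; lia.
Qed.

End Tensor.

Section Commutative.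
Variable R : comPzRingType.

(** * Commutative algebra *)

(** Nakayama's lemma modulo [B], for the multiplicative set [S], by elimination
    of one generator at a time.  It is used with [S] the complement of a prime
    ideal and with [S = 1 + I]. *)
Lemma nakayama (S I : set R) (V : lmodType R) (B : set V) n
    (g : 'I_n -> V) (f : 'I_n -> R) (a : 'I_n -> 'I_n -> R) :
  S 1 -> (forall x y, S x -> S y -> S (x * y)) ->
  (forall x y, S x -> I y -> S (x - y)) -> is_ideal I -> submod B ->
  (forall k, S (f k)) -> (forall k l, I (a k l)) ->
  (forall k, B (f k *: g k - \sum_l a k l *: g l)) ->
  exists2 s, S s & forall k, B (s *: g k).
Proof.
move=> S1 SM SB iI hB; elim: n g f a => [|n IHn] g f a Sf Ia Bfa.
  by exists 1 => // -[].
pose f0 := f ord0 - a ord0 ord0.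
have Sf0 : S f0 by apply: SB.
have B0 : B (f0 *: g ord0 - \sum_(l < n) a ord0 (lift ord0 l) *: g (lift ord0 l)).
  have := Bfa ord0; rewrite big_ord_recl /f0 scalerBl.
  by congr B; abel.
have [|k l|k|s Ss sB] := IHn (g \o lift ord0) (fun k => f0 * f (lift ord0 k))
  (fun k l => f0 * a (lift ord0 k) (lift ord0 l) +
              a (lift ord0 k) ord0 * a ord0 (lift ord0 l)).
- by move=> k; apply: SM.
- by apply: (idealD iI); apply: (idealM iI).
- have := subD hB (subZ hB f0 (Bfa (lift ord0 k))) (subZ hB (a (lift ord0 k) ord0) B0).
  congr B; rewrite big_ord_recl /= !scalerBr scalerDr !scalerA.
  rewrite [a (lift ord0 k) ord0 * f0]mulrC !scaler_sumr.
  under [X in _ = _ - X]eq_bigr do rewrite scalerDl -!scalerA.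
  rewrite big_split /=; under eq_bigr do rewrite scalerA.
  by abel.
exists (s * f0) => [|k]; first exact: SM.
case: (unliftP ord0 k) => [j ->|->]; first by rewrite mulrC -scalerA; apply: (subZ hB); apply: sB.
have -> : (s * f0) *: g ord0 = s *: (f0 *: g ord0 -
    \sum_(l < n) a ord0 (lift ord0 l) *: g (lift ord0 l)) +
    \sum_(l < n) a ord0 (lift ord0 l) *: (s *: g (lift ord0 l)).
  rewrite scalerBr scalerA scaler_sumr -addrA [X in - X + _](eq_bigr
    (fun l => a ord0 (lift ord0 l) *: (s *: g (lift ord0 l)))) ?addNr ?addr0 //.
  by move=> l _; rewrite !scalerA [s * _]mulrC.
apply: (subD hB); first exact: (subZ hB).
by apply: (sub_sum _ hB) => l _; apply: (subZ hB); apply: sB.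
Qed.

Definition dot r (v x : 'rV[R]_r) : R := \sum_k v 0 k * x 0 k.

Lemma dotDr r (v x y : 'rV[R]_r) : dot v (x + y) = dot v x + dot v y.
Proof. by rewrite /dot -big_split; apply: eq_bigr => k _; rewrite mxE mulrDr. Qed.

Lemma dotZr r (v x : 'rV[R]_r) a : dot v (a *: x) = a * dot v x.
Proof. by rewrite /dot mulr_sumr; apply: eq_bigr => k _; rewrite mxE mulrCA. Qed.

Lemma dotDl r (v w x : 'rV[R]_r) : dot (v + w) x = dot v x + dot w x.
Proof. by rewrite /dot -big_split; apply: eq_bigr => k _; rewrite mxE mulrDl. Qed.

Lemma dotZl r (v x : 'rV[R]_r) a : dot (a *: v) x = a * dot v x.
Proof. by rewrite /dot mulr_sumr; apply: eq_bigr => k _; rewrite mxE mulrA. Qed.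

Section Prime.
Variable p : Spec R.
Local Notation pr := (spec_set p).
Let pI := spec_ideal p.

Lemma spec_sum (J : finType) (F : J -> R) : (forall k, pr (F k)) -> pr (\sum_k F k).
Proof. by move=> pF; apply: big_ind => //; [exact: ideal0 pI | exact: idealD pI]. Qed.

Lemma nspecM x y : ~ pr x -> ~ pr y -> ~ pr (x * y).
Proof. by move=> nx ny /spec_prime[]. Qed.

Lemma nspecB x y : ~ pr x -> pr y -> ~ pr (x - y).
Proof. by move=> nx py pxy; apply: nx; rewrite -[x](subrK y); apply: (idealD pI). Qed.

(** Over the fraction field of [R / p], a vector outside a subspace is detected
    by a linear form vanishing on the subspace. *)
Lemma linear_alternative r m (D : 'I_m -> 'rV[R]_r) (u : 'rV[R]_r) :
  (exists2 f, ~ pr f & exists c : 'I_m -> R,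
     forall k, pr ((f *: u - \sum_i c i *: D i) 0 k)) \/
  (exists2 v, forall i, pr (dot v (D i)) & ~ pr (dot v u)).
Proof.
elim: m D u => [|m IHm] D u.
  case: (pselect (forall k, pr (u 0 k))) => [pu|/existsNP[k nu]].
    left; exists 1; first exact: spec_proper.
    by exists (fun=> 0) => k; rewrite big_ord0 scale1r subr0.
  right; exists (delta_mx 0 k) => [[]//|]; rewrite /dot (bigD1 k) //= big1.
    by rewrite mxE !eqxx mul1r addr0.
  by move=> j jk; rewrite mxE (negPf jk) andbF mul0r.
pose D' i := D (lift ord0 i).
have [[f nf [c cE]]|[v vD vu]] := IHm D' u.
  left; exists f => //; exists (fun i => if unlift ord0 i is Some j then c j else 0) => k.
  rewrite big_ord_recl unlift_none scale0r add0r.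
  by under eq_bigr do rewrite liftK.
have [[f nf [c cE]]|[v' v'D v'r]] := IHm D' (D ord0).
  right; exists v => // i; case: (unliftP ord0 i) => [j ->|->]; first exact: vD.
  have : pr (f * dot v (D ord0)).
    pose e := f *: D ord0 - \sum_i c i *: D' i.
    have -> : f * dot v (D ord0) = dot v e + \sum_i c i * dot v (D' i).
      rewrite -dotZr -[f *: D ord0](subrK (\sum_i c i *: D' i)) dotDr; congr (_ + _).
      rewrite /dot; under [RHS]eq_bigr do rewrite mulr_sumr.
      rewrite exchange_big; apply: eq_bigr => k _ /=; rewrite summxE mulr_sumr.
      by apply: eq_bigr => j _; rewrite mxE mulrCA.
    apply: (idealD pI); apply: spec_sum => k; apply: (idealM pI); first exact: cE.
    exact: vD.
  by move=> /spec_prime[].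
pose al := dot v' (D ord0); pose u' := al *: u - dot v' u *: D ord0.
have [[f nf [c cE]]|[w wD wu]] := IHm D' u'.
  left; exists (f * al); first exact: nspecM.
  exists (fun i => if unlift ord0 i is Some j then c j else f * dot v' u) => k.
  rewrite big_ord_recl unlift_none; under eq_bigr do rewrite liftK.
  have := cE k; congr (pr _); congr (fun_of_matrix _ 0 k).
  by rewrite /u' scalerBr !scalerA; abel.
right; exists (al *: w - dot w (D ord0) *: v').
  move=> i; rewrite -scaleNr dotDl !dotZl; case: (unliftP ord0 i) => [j ->|->].
    by apply: (idealD pI); apply: (idealM pI); [exact: wD | exact: v'D].
  rewrite -/al; have -> : al * dot w (D ord0) + - dot w (D ord0) * al = 0 by ring.
  exact: ideal0 pI.
rewrite -scaleNr dotDl !dotZl => h; apply: wu.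
rewrite /u' -scaleNr dotDr !dotZr; move: h; congr (pr _).
by ring.
Qed.
End Prime.

(** * Nonvanishing of the derived fibre at a prime of the support *)

Section Splitting.
Variables (F : fcx R) (b l : int) (p : Spec R).
Local Notation pr := (spec_set p).
Hypotheses (F0 : forall i : int, b <= i -> rk F i = 0%N).
Hypothesis Fex : forall i : int, i < l -> exact_at F i.
Let pI := spec_ideal p.

Definition splits (i : int) (u v : 'rV[R]_(rk F (i + 1))) : Prop :=
  [/\ forall k, pr (fd F _ u 0 k), forall x : F i, pr (dot v (fd F _ x)) & ~ pr (dot v u)].

(** If [F] is exact at [p], then multiplication by some [f] outside [p] is
    homotopic to zero in degrees above [s]; by descending induction on [s]. *)
Lemma fibre_contraction : (forall i u v, ~ @splits i u v) -> forall n : nat,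
  exists2 f, ~ pr f & exists h : forall i, {linear F (i + 1) -> F i},
    forall i, b - n%:Z <= i -> forall x : F (i + 1),
      f *: x = cd F (h i x) + h (i + 1) (cd F x).
Proof.
move=> nosplit; elim=> [|n [f nf [h hE]]].
  exists 1; first exact: spec_proper.
  exists (fun i => \0) => i bi x; rewrite scale1r /= linear0 addr0.
  by apply: (above_fcx F0); lia.
pose s := b - n.+1%:Z.
pose e_fun (x : F (s + 1)) : F (s + 1) := f *: x - h (s + 1) (cd F x).
have el : linear e_fun.
  move=> a x y; rewrite /e_fun (linearP (cd F)) (linearP (h _)) scalerDr scalerBr.
  by rewrite !scalerA [f * a]mulrC; abel.
pose e := mkLin el.
have de x : cd F (e x) = 0.
  have bs : b - n%:Z <= s + 1 by rewrite /s; lia.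
  have := hE _ bs (cd F x); rewrite cdd linear0 addr0 => E.
  by rewrite /= /e_fun linearB linearZ /= [f *: _]E subrr.
have ee x : cd F x = 0 -> e x = f *: x.
  by move=> dx; rewrite /= /e_fun dx linear0 subr0.
have alt k : exists2 g, ~ pr g & exists y : F s, exists2 q : F (s + 1),
    g *: e (delta_mx 0 k) = cd F y + q & forall m, pr (q 0 m).
  have [[g ng [c cE]]|[v vD vu]] := linear_alternative p
    (fun j : 'I_(rk F s) => cd F (delta_mx 0 j : F s)) (e (delta_mx 0 k)).
    exists g => //; exists (\row_j c j).
    exists (g *: e (delta_mx 0 k) - cd F (\row_j c j : F s)); first by abel.
    move=> m; have := cE m; congr (pr _); congr (fun_of_matrix (_ - _) 0 m).
    rewrite [X in cd F X]row_sum_delta linear_sum; apply: eq_bigr => j _.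
    by rewrite linearZ mxE.
  case: (nosplit s (e (delta_mx 0 k)) v); split=> //.
    by move=> m; rewrite -[fd F _ _]/(cd F (e (delta_mx 0 k))) de mxE; apply: ideal0 pI.
  move=> x; rewrite [x]row_sum_delta linear_sum /dot.
  under eq_bigr do rewrite summxE mulr_sumr.
  rewrite exchange_big; apply: spec_sum => j /=.
  have := idealM pI (x 0 j) (vD j); congr (pr _); rewrite /dot mulr_sumr.
  by apply: eq_bigr => m _; rewrite linearZ /= mxE mulrCA.
have /choice[g gP] : forall k, exists g, ~ pr g /\ exists y : F s, exists2 q : F (s + 1),
    g *: e (delta_mx 0 k) = cd F y + q & forall m, pr (q 0 m).
  by move=> k; have [g ng gE] := alt k; exists g.
have /choice[y yP] : forall k, exists y : F s, exists2 q : F (s + 1),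
    g k *: e (delta_mx 0 k) = cd F y + q & forall m, pr (q 0 m).
  by move=> k; case: (gP k).
have /choice[q qP] : forall k, exists q : F (s + 1),
    g k *: e (delta_mx 0 k) = cd F (y k) + q /\ forall m, pr (q 0 m).
  by move=> k; case: (yP k) => q qE qp; exists q.
pose im : set (F (s + 1)) := fun z => exists w : F s, z = cd F w.
have imS : submod im.
  split; first by exists 0; rewrite linear0.
    by move=> _ _ [v ->] [w ->]; exists (v + w); rewrite linearD.
  by move=> a _ [v ->]; exists (a *: v); rewrite linearZ.
have [|x z|x z|||k|k m|k|t nt tB] := @nakayama (fun x => ~ pr x) pr (F (s + 1)) im _
  (fun k => e (delta_mx 0 k)) (fun k => g k * f) (fun k m => q k 0 m).
- exact: spec_proper.
- exact: nspecM.
- exact: nspecB.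
- exact: pI.
- exact: imS.
- by apply: nspecM => //; case: (gP k).
- by case: (qP k).
- exists (f *: y k); have [E _] := qP k.
  have := congr1 e E; rewrite (linearZZ e) (ee _ (de _)) scalerA (linearD e) (ee _ (cdd (y k))) => ->.
  rewrite (linearZZ (cd F)) {1}[q k]row_sum_delta (linear_sum e).
  under eq_bigr do rewrite (linearZZ e).
  by rewrite addrK.
have [h' h'E] := rV_ext (fun k => projT1 (cid (tB k))).
have dh' x : cd F (h' x) = t *: e x.
  rewrite [x]row_sum_delta (linear_sum h') (linear_sum (cd F)) (linear_sum e).
  rewrite scaler_sumr; apply: eq_bigr => k _.
  rewrite (linearZZ h') (linearZZ (cd F)) (linearZZ e) h'E.
  by case: (cid (tB k)) => w /= <-; rewrite !scalerA mulrC.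
exists (t * f); first exact: nspecM.
pose h0 i : {linear F (i + 1) -> F i} := t \*: h i.
pose h1 := dfwith h0 (h' : {linear F (s + 1) -> F s}).
exists h1 => i bi x.
have h1E j : s < j -> h1 j = h0 j.
  by move=> sj; rewrite /h1 dfwith_out //; apply: contraTneq sj => ->; rewrite ltxx.
have [es|si] := eqVneq i s; last first.
  have is1 : s < i by rewrite lt_def si /=; move: bi; rewrite /s; lia.
  rewrite (h1E _ is1) (h1E (i + 1)) /=; last by lia.
  have bi' : b - n%:Z <= i by move: is1; rewrite /s; lia.
  by rewrite -scalerA (hE _ bi' x) scalerDr (linearZZ (cd F)).
move: x; rewrite es => x.
rewrite (h1E (s + 1)) /=; last by lia.
by rewrite /h1 dfwith_in dh' /= /e_fun scalerBr scalerA subrK.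
Qed.

Lemma fibre_splitting : (forall f, kills f F -> pr f) -> exists i u v, @splits i u v.
Proof.
move=> kp; apply: contrapT => nosplit.
have [i u v suv|f nf [h hE]] := @fibre_contraction _ `|b - l|%N.
  by apply: nosplit; exists i, u, v.
apply/nf/kp => i x dx; case: (ltP i l) => il.
  by have [y ->] := Fex il dx; exists (f *: y); rewrite (linearZZ (cd F)).
exists (h i x); rewrite hE; last by lia.
by rewrite dx linear0 addr0.
Qed.

End Splitting.
End Commutative.

Section ModuleComplex.
Variable R : comPzRingType.
Implicit Types (A B C V : lmodType R).

(** * Modules as complexes in one degree *)

(** The term in degree [i] depends on the test [i == s]; elements are moved in
    and out by linear maps rather than by case analysis on that test. *)
Definition mterm (t : bool) A : lmodType R := if t then A else 'rV[R]_0.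

Definition mterm_in (t : bool) A : {linear A -> mterm t A} :=
  match t return {linear A -> mterm t A} with true => idfun | false => \0 end.

Definition mterm_out (t : bool) A : {linear mterm t A -> A} :=
  match t return {linear mterm t A -> A} with true => idfun | false => \0 end.

Arguments mterm_in t A : clear implicits.
Arguments mterm_out t A : clear implicits.

Lemma mterm_inK (t : bool) A a : t -> mterm_out t A (mterm_in t A a) = a.
Proof. by case: t. Qed.

Lemma mterm_outK (t : bool) A x : mterm_in t A (mterm_out t A x) = x.
Proof. by case: t x => // x; symmetry; apply: thinmx0. Qed.

Lemma mterm0 (t : bool) A (x : mterm t A) : ~~ t -> x = 0.
Proof. by case: t x => // x _; apply: thinmx0. Qed.

Lemma modc_bounded (s : int) A : exists N : nat, forall i : int,
  (N < absz i)%N -> forall x : mterm (i == s) A, x = 0.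
Proof.
exists `|s|%N => i si x; apply: mterm0; apply/eqP => e.
by move: si; rewrite e ltnn.
Qed.

Lemma modc_fg (s : int) A : fin_gen A -> forall i : int, fin_gen (mterm (i == s) A).
Proof.
move=> fgA i; apply: (fin_gen_surj (q := mterm_in (i == s) A)) fgA => v.
by exists (mterm_out _ _ v); rewrite mterm_outK.
Qed.

Definition modc (s : int) A (fgA : fin_gen A) : bcomplex R :=
  @BComplex R (fun i => mterm (i == s) A) (fun i => \0) (fun i x => erefl)
    (@modc_bounded s A) (modc_fg s fgA).

Lemma modc0 s A (fgA : fin_gen A) (i : int) (x : modc s fgA i) : i <> s -> x = 0.
Proof. by move=> /eqP si; apply: mterm0. Qed.

Lemma modc_d s A (fgA : fin_gen A) i (x : modc s fgA i) : cd (modc s fgA) x = 0.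
Proof. by []. Qed.

Lemma to_modc s A (fgA : fin_gen A) (X : cx R) (i : int) (f : {linear X (i + 1) -> A}) :
  s = i + 1 -> (forall x : X i, f (cd X x) = 0) ->
  exists g : cm X (modc s fgA), forall x : X (i + 1), mterm_out _ _ (g _ x) = f x.
Proof.
move=> ->{s} fd0.
pose g0 j : {linear X j -> modc (i + 1) fgA j} := \0.
pose gs : {linear X (i + 1) -> modc (i + 1) fgA (i + 1)} := mterm_in _ _ \o f.
pose g := dfwith g0 gs.
have gd j (x : X j) : g _ (cd X x) = cd (modc (i + 1) fgA) (g _ x).
  rewrite modc_d; case: (eqVneq j i) => [ji|ji].
    by subst j; rewrite /g dfwith_in /= fd0 linear0.
  by apply: modc0 => /addIr /eqP; rewrite (negPf ji).
exists (@Cm R X (modc (i + 1) fgA) g gd) => x.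
by rewrite /= /g dfwith_in /= mterm_inK.
Qed.

Lemma from_modc s A (fgA : fin_gen A) (X : cx R) (f : {linear A -> X s}) :
  (forall a, cd X (f a) = 0) ->
  exists g : cm (modc s fgA) X, forall x, g s x = f (mterm_out _ _ x).
Proof.
move=> df.
pose g0 j : {linear modc s fgA j -> X j} := \0.
pose gs : {linear modc s fgA s -> X s} := f \o mterm_out _ _.
pose g := dfwith g0 gs.
have gd j (x : modc s fgA j) : g _ (cd (modc s fgA) x) = cd X (g _ x).
  rewrite modc_d linear0; case: (eqVneq j s) => [js|js].
    by subst j; rewrite /g dfwith_in /= df.
  by rewrite [x](modc0 (fgA := fgA)) ?linear0 //; apply/eqP.
by exists (@Cm R (modc s fgA) X g gd) => x; rewrite /= /g dfwith_in.
Qed.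

Definition modm s A B (fgA : fin_gen A) (fgB : fin_gen B) (f : {linear A -> B}) :
  cm (modc s fgA) (modc s fgB) :=
  @Cm R (modc s fgA) (modc s fgB)
    (fun i => mterm_in (i == s) B \o (f \o mterm_out (i == s) A))
    (fun i x => linear0 (mterm_in (i + 1 == s) B \o (f \o mterm_out (i + 1 == s) A))).

Variable T : subcat R.
Hypothesis noethR : noetherian_ring R.
Hypothesis triT : triangulated_subcat T.
Hypothesis thickT : thick T.

Definition module_inT A : Prop := forall (fgA : fin_gen A) s, T (modc s fgA).

Lemma module_inT_shift A (fgA : fin_gen A) s : T (modc s fgA) -> module_inT A.
Proof.
move=> TA fgA' s'; have /= h := tri_shift triT (s - s') TA.
pose X := shift (s - s') (modc s fgA).
have fl i : linear (fun x : X i =>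
    mterm_in (i == s') A (mterm_out (i + (s - s') == s) A x) : modc s' fgA' i).
  by move=> a x y; rewrite !linearP.
have fd i (x : X i) : mkLin (@fl _) (cd X x) = cd (modc s' fgA') (mkLin (@fl _) x).
  by rewrite modc_d /= /shift_diff_fun /= (linear0 (cast _)) scaler0 !linear0.
have e i : (i + (s - s') == s) = (i == s') by lia.
apply/(T_qis triT (f := @Cm R X (modc s' fgA') _ fd)); last exact: h.
apply: bij_qis => i x /=.
  move: x; rewrite /X /= /shift_term /= => x.
  move=> /(congr1 (mterm_out (i == s') A)); case: (eqVneq i s') => [is'|is'].
    rewrite mterm_inK //.
    rewrite linear0.
    move=> /(congr1 (mterm_in (i + (s - s') == s) A)).
    by rewrite mterm_outK linear0.
  by move=> _; apply: mterm0; rewrite e.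
exists (mterm_in _ _ (mterm_out _ _ x)).
have [is'|is'] := pselect (i = s').
  by rewrite mterm_inK ?mterm_outK // e is'.
by rewrite [LHS](modc0 x is') [RHS](modc0 _ is').
Qed.

Section ModSes.
Variables (A B C : lmodType R) (f : {linear A -> B}) (g : {linear B -> C}).
Hypotheses (fi : forall a, f a = 0 -> a = 0) (gs : forall c, exists b, c = g b).
Hypotheses (gf : forall a, g (f a) = 0) (ex : forall b, g b = 0 -> exists a, b = f a).
Variables (fgA : fin_gen A) (fgB : fin_gen B) (fgC : fin_gen C) (s : int).

Let F := modm s fgA fgB f.
Let H := modm s fgB fgC g.

Let Ft (t : bool) (x : mterm t A) : mterm t B := mterm_in t B (f (mterm_out t A x)).
Let Ht (t : bool) (x : mterm t B) : mterm t C := mterm_in t C (g (mterm_out t B x)).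

Let Fi i x : F i x = 0 -> x = 0.
Proof.
have Fti t (y : mterm t A) : Ft y = 0 -> y = 0.
  by case: t y => y; [exact: fi | move=> _; apply: thinmx0].
exact: Fti.
Qed.

Let Hs i z : exists y, z = H i y.
Proof.
have Hts t (y : mterm t C) : exists x, y = Ht x.
  by case: t y => y; [exact: gs | exists 0; apply: thinmx0].
exact: Hts.
Qed.

Let HF i x : H i (F i x) = 0.
Proof.
have HFt t (y : mterm t A) : Ht (Ft y) = 0.
  by case: t y => // y; apply: gf.
exact: HFt.
Qed.

Let FH i y : H i y = 0 -> exists x, y = F i x.
Proof.
have FHt t (x : mterm t B) : Ht x = 0 -> exists y, x = Ft y.
  by case: t x => x; [exact: ex | move=> _; exists 0; apply: thinmx0].
exact: FHt.
Qed.

Lemma modc_ses_middle : T (modc s fgA) -> T (modc s fgC) -> T (modc s fgB).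
Proof. exact: (T_ses_middle triT Fi Hs HF FH). Qed.

Lemma modc_ses_cone : T (cone (bcm F)) <-> T (modc s fgC).
Proof. exact: (T_ses_cone triT Fi Hs HF FH). Qed.
End ModSes.

End ModuleComplex.

Section PrimeStep.
Variable R : comPzRingType.
Variable T : subcat R.
Hypothesis noethR : noetherian_ring R.
Hypothesis triT : triangulated_subcat T.
Hypothesis thickT : thick T.
Implicit Types (A B C V : lmodType R).

(** * Cyclic modules *)

Definition cyclic_module V (g : V) (J : set R) : Prop :=
  (forall v, exists r, v = r *: g) /\ forall r, r *: g = 0 <-> J r.

Definition cyclic_inT (J : set R) : Prop :=
  forall V (g : V), cyclic_module g J -> module_inT T V.

Lemma cyclic_fin_gen V (g : V) J : cyclic_module g J -> fin_gen V.
Proof.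
move=> [gV _]; exists 1%N, (fun=> g) => v; have [r ->] := gV v.
by exists (fun=> r); rewrite big_ord1.
Qed.

Lemma scaler_is_linear V (r : R) : linear (fun v : V => r *: v).
Proof. by move=> a u v; rewrite scalerDr !scalerA mulrC. Qed.

Definition scalem V r : {linear V -> V} := mkLin (@scaler_is_linear V r).

Definition scale_cm r (X : cx R) : cm X X :=
  @Cm R X X (fun i => scalem (X i) r)
    (fun i x => esym (linearZZ (@cd R X i) r x)).

(** The bound [c] below which [Y] vanishes is fixed before the approximation [Q]
    of [tens F A] is chosen.  With [Q] deep enough, a resolution of [A[-s]]
    lifts along [Q -> tens F A] in the degrees where [Y] and [A[-s]] live, and
    the lift composed with [Q -> Y] is a chain map because [Y] is zero
    elsewhere.  Truncating the resolution yields the bounded complex [W]. *)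
Lemma factor_through_T (G : bcomplex R) (n : nat) (F : fcx R) (b : int) (p : cm F G)
    A (fgA : fin_gen A) (s : int) (f : R)
    (al : cm (modc s fgA) (tens F A)) (be : cm (tens F A) (modc s fgA)) :
  (forall X, T X -> gen_add T G n X) -> T G ->
  (forall i : int, b <= i -> rk F i = 0%N) -> qis p ->
  (forall i x, be i (al i x) = f *: x) ->
  exists (W Y : bcomplex R) (e : cm W (modc s fgA)) (u : cm W Y)
         (v : cm Y (modc s fgA)) (k : forall i, {linear W (i + 1) -> modc s fgA i}),
    [/\ qis e, T Y & forall i (x : W (i + 1)), v _ (u _ x) - f *: e _ x = k (i + 1) (cd W x)].
Proof.
move=> Tgen TG F0 qp beal.
have modl : below s (modc s fgA) by move=> i si x; apply: modc0; lia.
have moda : above (s + 1) (modc s fgA) by move=> i si x; apply: modc0; lia.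
have [c cP] := factors_gen_add noethR triT TG n s.
pose N := Num.min c s - 3.
have [Q TQ [q qN]] := tens_approx noethR triT F0 TG qp N fgA.
have [pQ _ [X TX [r qr]]] := TQ.
have [Y [TY Yc] [y [v [k kE]]]] := cP X (Tgen X TX) Q pQ r qr _ modl (compm be q).
have [P [Pb Pfg]] := res_bounded noethR moda.
have [|la [h lah]] := lift_range (compm al (rp P)) _ (rproj P) qN; first by move=> i; lia.
have mud : forall i (x : P i), y _ (la _ (cd P x)) = cd Y (y _ (la _ x)).
  apply: int_succ_ind => i x; case: (ltP (i + 1 + 1) c) => ic.
    by rewrite [LHS](Yc _ ic) [RHS](Yc _ ic).
  have Ni : N <= i by rewrite /N; lia.
  by have [-> _] := lah i Ni x; rewrite (cfd y).
pose mu := @Cm R P Y (fun i => y i \o la i) mud.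
pose ka i : {linear P (i + 1) -> modc s fgA i} := \- ((k i \o la (i + 1)) \+ (be i \o h i)).
have kaE i (x : P (i + 1)) : v _ (mu _ x) - f *: rp P _ x = ka (i + 1) (cd P x).
  have [is_|is_] := pselect (i + 1 = s); last by rewrite [LHS](modc0 _ is_) [RHS](modc0 _ is_).
  have Ni : N <= i by rewrite /N; lia.
  have [E1 E2] := lah i Ni x.
  have := kE i (la _ x); rewrite modc_d add0r /= -E1 => E3.
  have E4 := congr1 (be (i + 1)) E2; rewrite /= beal (linearD (be _)) (linearD (be _)) in E4.
  rewrite (cfd be) modc_d add0r in E4.
  by rewrite E4 /= -E3; abel.
pose l := Num.min c s - 2.
have exP i : i < l -> exact_at P i.
  by move=> il; apply: (exact_qis (rqis P) modl); move: il; rewrite /l; lia.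
have [W [t [qt Wl ts ti]]] := truncation (rproj P).1 Pfg exP.
have modl' : below (l + 1) (modc s fgA).
  by move=> i il; apply: modl; move: il; rewrite /l; lia.
have Yl : below (l + 1) Y.
  by move=> i il; apply: Yc; move: il; rewrite /l; lia.
have [e eE] := factor_cm (rp P) ts ti modl'.
have [u uE] := factor_cm mu ts ti Yl.
have gex i : exists g : {linear W (i + 1) -> modc s fgA i}, forall x, g (t _ x) = ka i x.
  apply: factor_surj => [w|x tx]; first exact: ts.
  case: (ltP i s) => is_; first exact: modl.
  by rewrite (ti (i + 1) _ x tx) ?linear0 // /l; lia.
exists W, Y, e, u, v, (fun i => projT1 (cid (gex i))); split=> //.
  apply: (qis_cancel_r (f := t)) => //; apply: qis_htpy (rqis P).
  by apply: htpy_ext => i x /=; rewrite eE.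
move=> i w; have [x ->] := ts _ w.
rewrite uE eE -(cfd t); case: (cid (gex (i + 1))) => g gE /=.
by rewrite gE; apply: kaE.
Qed.

Lemma T_cone_map (X Y X' Y' : bcomplex R) (f : cm X Y) (f' : cm X' Y')
    (a : cm X X') (b : cm Y Y') : (forall i x, b i (f i x) = f' i (a i x)) ->
  qis a -> qis b -> T (cone (bcm f)) <-> T (cone (bcm f')).
Proof.
move=> ab qa qb.
pose i1 := @Cm R (cone (bcm f)) (conex f) (fun i => idfun) (fun i x => erefl).
pose i2 := @Cm R (conex f') (cone (bcm f')) (fun i => idfun) (fun i x => erefl).
apply: (T_qis triT (f := compm i2 (compm (cone_map ab) i1))).
apply: qis_comp; first by apply: bij_qis => i x //; exists x.
apply: qis_comp; first exact: qis_cone_map.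
by apply: bij_qis => i x //; exists x.
Qed.

(** Projecting the cone of [f] on [W] to [W[1]] and applying [u] gives the class of
    an extension of that cone by [Y].  The map [W -> cone f] lifts to the extension
    because its composite with the projection is zero; the homotopy [k] between
    [v u] and [f e] makes the retraction of the extension to [A[-s]] a chain map. *)
Lemma factor_and_cone A (fgA : fin_gen A) (s : int) (f : R) (W Y : bcomplex R)
    (e : cm W (modc s fgA)) (u : cm W Y) (v : cm Y (modc s fgA))
    (k : forall i, {linear W (i + 1) -> modc s fgA i}) :
  qis e -> T Y -> T (cone (bcm (scale_cm f (modc s fgA)))) ->
  (forall i (x : W (i + 1)), v _ (u _ x) - f *: e _ x = k (i + 1) (cd W x)) ->
  T (modc s fgA).
Proof.
move=> qe TY Tf kE.
pose fW := scale_cm f W.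
have TfW : T (cone (bcm fW)).
  have ec i x : e i (fW i x) = scale_cm f (modc s fgA) i (e i x) by rewrite /= linearZ.
  exact/(T_cone_map ec qe qe).
pose i1 := @Cm R (cone (bcm fW)) (conex fW) (fun i => idfun) (fun i x => erefl).
pose w : cm (cone (bcm fW)) (shx Y) := compm (compm (shxm u) (conex_out fW)) i1.
have [S SE TS] := T_ext triT w TY TfW.
have il i : linear (fun b : W i => (0, (0, b)) : extx w i).
  by move=> a x z; apply: (congr2 pair); last apply: (congr2 pair);
     rewrite //= scaler0 addr0.
have id_ i (b : W i) : mkLin (@il _) (cd W b) = cd (extx w) (mkLin (@il _) b).
  apply: (congr2 pair) => /=; last apply: (congr2 pair) => /=.
  - by rewrite !linear0 addr0.
  - by rewrite linear0 oppr0.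
  - by rewrite scaler0 add0r.
have rl i : linear (fun x : extx w i => e i x.2.2 - v i x.1 - k i x.2.1).
  move=> a x z; rewrite /= (linearP (e i)) (linearP (v i)) (linearP (k i)).
  by rewrite !scalerBr; abel.
have rd i (x : extx w i) : mkLin (@rl _) (cd _ x) = cd (modc s fgA) (mkLin (@rl _) x).
  case: x => z [a b]; rewrite modc_d /=.
  have /= kE' := kE i a.
  rewrite (linearD (e _)) (linearZZ (e _)) (cfd e) modc_d addr0.
  rewrite (linearD (v _)) (cfd v) modc_d add0r (linearN (k _)) -kE'.
  by abel.
pose im := @Cm R W (extx w) _ id_; pose rm := @Cm R (extx w) (modc s fgA) _ rd.
have qrm : qis (compm rm im).
  apply: qis_htpy qe; apply: htpy_ext => i x /=.
  by rewrite !linear0 !addr0.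
move: im rm qrm; rewrite -SE => im rm qrm.
exact: (T_retract thickT qrm TS).
Qed.

(** ** Prime ideals of the support *)

Lemma prime_step (G : bcomplex R) (n : nat) (p : Spec R) :
  (forall X, T X -> gen_add T G n X) -> T G ->
  (forall r, kills r G -> spec_set p r) ->
  (forall J, is_ideal J -> (forall x, spec_set p x -> J x) ->
     (exists2 x, J x & ~ spec_set p x) -> cyclic_inT J) ->
  cyclic_inT (spec_set p).
Proof.
move=> Tgen TG Gp IH A g Ag; have [gA annA] := Ag.
have fgA := cyclic_fin_gen Ag.
have pA r a : spec_set p r -> r *: a = 0 :> A.
  have [c ->] := gA a => pr; rewrite scalerA mulrC -scalerA.
  by rewrite ((annA r).2 pr) scaler0.
have [b Gb] := bc_above G; have [a Ga] := bc_below G.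
have [F [F0 [pi qpi]]] := resolution noethR Gb (@cterm_fg _ G).
have Fex i : i < a - 1 -> exact_at F i by move=> ia; apply: (exact_qis qpi Ga); lia.
have [i [u [v [du vd vu]]]] : exists i u v, @splits R F p i u v.
  apply: (fibre_splitting F0 Fex) => f kf; apply: Gp.
  exact: (kills_qis f qpi).1.
pose f := dot v u; pose s : int := i + 1.
(* [u] and [v] are chain maps [A[-s] -> F (x) A -> A[-s]] with composite [f] *)
have ul : linear (fun x : A => [ffun k => u 0 k *: x] : tens F A s).
  move=> c x y; apply/ffunP => k; rewrite !ffunE scalerDr !scalerA.
  by rewrite [c * _]mulrC.
have dul a0 : cd (tens F A) (mkLin ul a0) = 0.
  apply/ffunP => l; rewrite tensE ffunE.
  under eq_bigr do rewrite ffunE scalerA mulrC.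
  by rewrite -scaler_suml -fdE; apply: pA.
have [al alE] := from_modc fgA dul.
have vl : linear (fun x : tens F A s => \sum_k v 0 k *: x k).
  move=> c x y; rewrite scaler_sumr -big_split; apply: eq_bigr => k _ /=.
  by rewrite !ffunE scalerDr !scalerA [c * _]mulrC.
have vld (x : tens F A i) : mkLin vl (cd _ x) = 0.
  rewrite /=; under eq_bigr do rewrite ffunE scaler_sumr.
  rewrite exchange_big big1 // => k _ /=.
  under eq_bigr do rewrite scalerA.
  by rewrite -scaler_suml; apply/pA/(vd (delta_mx 0 k)).
have [be beE] := @to_modc R s A fgA (tens F A) i (mkLin vl) erefl vld.
have beal j (x : modc s fgA j) : be j (al j x) = f *: x.
  have [js|js] := pselect (j = s); last by rewrite [LHS](modc0 _ js) [RHS](modc0 _ js).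
  move: x; rewrite js => x.
  rewrite -[LHS]mterm_outK -[RHS]mterm_outK; congr (mterm_in _ _ _).
  rewrite [LHS]beE alE /= linearZ /= scaler_suml; apply: eq_bigr => k _.
  by rewrite ffunE scalerA.
have [W [Y [e [U [V' [k [qe TY kE]]]]]]] :=
  factor_through_T Tgen TG F0 qpi beal.
apply: (@module_inT_shift R T triT A fgA s).
apply: (factor_and_cone qe TY _ kE).
(* the cone of [f] on [A] is the cyclic module [A / f A] *)
have imS : submod ((fun x => exists y, x = f *: y) : set A).
  split; first by exists 0; rewrite scaler0.
    by move=> _ _ [x ->] [y ->]; exists (x + y); rewrite scalerDr.
  by move=> c _ [x ->]; exists (c *: x); rewrite !scalerA mulrC.
pose C := quo imS; pose J : set R := fun r => exists y, r *: g = f *: y.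
have Cg : cyclic_module (proj_quo imS g) J.
  split=> [c|r]; last by rewrite -linearZ; apply: proj_quo0.
  have [x ->] := proj_quo_surj c; have [r ->] := gA x.
  by exists r; rewrite linearZ.
have fgC := cyclic_fin_gen Cg.
have fi (x : A) : scalem A f x = 0 -> x = 0.
  have [r ->] := gA x; rewrite /= scalerA => /annA /spec_prime[|pr]; first by [].
  by apply/annA.
have gs c : exists x, c = proj_quo imS x := proj_quo_surj c.
have gf x : proj_quo imS (scalem A f x) = 0 by apply/proj_quo0; exists x.
have ex x : proj_quo imS x = 0 -> exists y, x = scalem A f y by move=> /proj_quo0.
have TC : T (modc s fgC).
  apply: (IH J _ _ _ C _ Cg).
  - split=> [|x y [x' xE] [y' yE]|c x [x' xE]].
    + by exists 0; rewrite scale0r scaler0.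
    + by exists (x' + y'); rewrite scalerDl xE yE scalerDr.
    + by exists (c *: x'); rewrite -scalerA xE !scalerA mulrC.
  - by move=> x px; exists 0; rewrite scaler0; apply/annA.
  - by exists f => //; exists g.
have := (modc_ses_cone triT fi gs gf ex fgA fgA fgC s).2 TC.
have sf j (x : modc s fgA j) : 
    idm (modc s fgA) j (modm s fgA fgA (scalem A f) j x) =
    scale_cm f (modc s fgA) j (idm (modc s fgA) j x).
  by rewrite /= linearZ /= mterm_outK.
have qid : qis (idm (modc s fgA)) by apply: bij_qis => // j y; exists y.
exact: (T_cone_map sf qid qid).1.
Qed.

End PrimeStep.

Section Ideals.
Variable R : comPzRingType.
Hypothesis noethR : noetherian_ring R.
Implicit Types I J K : set R.

(** * Ideals of noetherian rings *)

(** A strictly increasing sequence of counterexamples would have a finitely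
    generated union. *)
Lemma noetherian_induction (P : set R -> Prop) :
  (forall J, is_ideal J ->
     (forall J', is_ideal J' -> (forall x, J x -> J' x) ->
        (exists2 x, J' x & ~ J x) -> P J') -> P J) ->
  forall J, is_ideal J -> P J.
Proof.
move=> IH J0 iJ0; apply: contrapT => nP0.
pose bad := {J : set R | is_ideal J /\ ~ P J}.
have nextP (J : bad) : exists J' : bad,
    (forall x, sval J x -> sval J' x) /\ exists2 x, sval J' x & ~ sval J x.
  case: J => J [iJ nPJ] /=; apply: contrapT => nJ'; apply: nPJ; apply: IH => // J' iJ' JJ' xJ'.
  by apply: contrapT => nPJ'; apply: nJ'; exists (exist _ J' (conj iJ' nPJ')).
have [nxt nxtP] := choice nextP.
pose c (n : nat) : bad := iter n nxt (exist _ J0 (conj iJ0 nP0)).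
have cS m n x : sval (c m) x -> sval (c (m + n)%N) x.
  elim: n => [|n IHn] cx; first by rewrite addn0.
  by rewrite addnS; apply: (nxtP (c (m + n)%N)).1; apply: IHn.
have ic n : is_ideal (sval (c n)) := (svalP (c n)).1.
pose U : set R := fun x => exists n, sval (c n) x.
have iU : is_ideal U.
  split=> [|x y [m cx] [n cy]|a x [n cx]].
  - by exists 0%N; apply: ideal0 (ic _).
  - exists (m + n)%N; apply: (idealD (ic _)); first exact: cS.
    by rewrite addnC; apply: cS.
  - by exists n; apply: idealM (ic _) _ _ cx.
have [k [g [gU gP]]] := noethR iU.
have [N NP] : exists N, forall j, sval (c N) (g j).
  have [d dP] := choice gU; exists (\sum_j d j)%N => j.
  by rewrite (bigD1 j) //=; apply: cS.
have [x cx ncx] := (nxtP (c N)).2; apply: ncx.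
have [|e ->] := gP x; first by exists N.+1.
apply: big_ind => [||j _]; [exact: ideal0 (ic _) | exact: idealD (ic _) |].
by apply: (idealM (ic _)).
Qed.

Definition ideal_add J a : set R := fun x => exists y r, J y /\ x = y + r * a.

Lemma ideal_add_ideal J a : is_ideal J -> is_ideal (ideal_add J a).
Proof.
move=> iJ; split=> [|x y [x' [r [Jx ->]]] [y' [s [Jy ->]]]|c x [x' [r [Jx ->]]]].
- by exists 0, 0; split; [exact: ideal0 iJ | rewrite mul0r addr0].
- exists (x' + y'), (r + s); split; first exact: (idealD iJ).
  by rewrite mulrDl addrACA.
- exists (c * x'), (c * r); split; first exact: (idealM iJ).
  by rewrite mulrDr mulrA.
Qed.

Lemma ideal_addl J a x : J x -> ideal_add J a x.
Proof. by move=> Jx; exists x, 0; rewrite mul0r addr0. Qed.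

Lemma ideal_addr J a : is_ideal J -> ideal_add J a a.
Proof. by move=> iJ; exists 0, 1; rewrite mul1r add0r; split=> //; apply: ideal0 iJ. Qed.

Lemma prime_or_split J : is_ideal J -> ~ J 1 ->
  (exists p : Spec R, spec_set p = J) \/
  exists a b, [/\ J (a * b), ~ J a & ~ J b].
Proof.
move=> iJ J1; case: (pselect (exists a b, [/\ J (a * b), ~ J a & ~ J b])); first by right.
move=> np; left.
have Jp x y : J (x * y) -> J x \/ J y.
  move=> Jxy; apply: contrapT => /not_orP[nx ny]; apply: np.
  by exists x, y.
by exists (MkSpec iJ J1 Jp).
Qed.

Lemma prime_above J : is_ideal J -> ~ J 1 -> exists p : Spec R, forall x, J x -> spec_set p x.
Proof.
move: J; apply: noetherian_induction => J iJ IH J1.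
have [[p pJ]|[a [b [Jab na nb]]]] := prime_or_split iJ J1.
  by exists p; rewrite pJ.
have add1 c : ~ J c -> ~ ideal_add J c 1 -> exists p : Spec R, forall x, J x -> spec_set p x.
  move=> nc c1; have [||p pP] := IH _ (ideal_add_ideal c iJ) _ _ c1.
  - by move=> x; apply: ideal_addl.
  - by exists c => //; apply: ideal_addr.
  - by exists p => x Jx; apply/pP/ideal_addl.
have [[x [r [Jx xE]]]|a1] := pselect (ideal_add J a 1); last exact: add1 a1.
have [[y [s [Jy yE]]]|b1] := pselect (ideal_add J b 1); last exact: add1 b1.
case: J1; have -> : 1 = (y + s * b) * x + ((r * a) * y + (r * s) * (a * b)).
  rewrite -yE mul1r [r * s * _](_ : _ = (r * a) * (s * b)); last by ring.
  by rewrite -mulrDr -yE mulr1.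
apply: (idealD iJ); first exact: (idealM iJ).
by apply: (idealD iJ); apply: (idealM iJ).
Qed.

(** ** Powers of an ideal *)

(** The product [I^m], as the least ideal that contains the products. *)
Fixpoint ideal_pow I (m : nat) : set R :=
  if m is m'.+1 then fun x => forall J, is_ideal J ->
    (forall a b, I a -> ideal_pow I m' b -> J (a * b)) -> J x
  else setT.

Lemma ideal_pow_ideal I m : is_ideal (ideal_pow I m).
Proof.
case: m => [|m]; first by split.
split=> [J iJ _|x y Ix Iy J iJ h|a x Ix J iJ h].
- exact: ideal0 iJ.
- by apply: (idealD iJ); [apply: Ix | apply: Iy].
- by apply: (idealM iJ); apply: Ix.
Qed.

Lemma ideal_pow_prod I (rs : seq R) : (forall r, r \in rs -> I r) ->
  ideal_pow I (size rs) (\prod_(r <- rs) r).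
Proof.
elim: rs => [//|r rs IH] rsI J iJ h; rewrite big_cons; apply: h.
  by apply: rsI; rewrite mem_head.
by apply: IH => s srs; apply: rsI; rewrite in_cons srs orbT.
Qed.

Lemma ideal_pow_sub I m J : is_ideal J ->
  (forall rs, size rs = m -> (forall r, r \in rs -> I r) -> J (\prod_(r <- rs) r)) ->
  forall x, ideal_pow I m x -> J x.
Proof.
elim: m J => [|m IHm] J iJ h x /=.
  move=> _; have := h [::] erefl; rewrite big_nil => J1.
  by rewrite -[x]mulr1; apply: (idealM iJ); apply: J1.
apply=> // a b Ia; apply: (IHm (fun y => J (a * y))).
  split=> [|y z Jy Jz|c y Jy]; first by rewrite mulr0; apply: ideal0 iJ.
    by rewrite mulrDr; apply: (idealD iJ).
  by rewrite mulrCA; apply: (idealM iJ).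
move=> rs srs rsI; have := h (a :: rs); rewrite big_cons /= srs; apply=> // r.
by rewrite in_cons => /orP[/eqP ->|/rsI].
Qed.

Lemma ideal_pow_spec I m (p : Spec R) :
  (forall x, ideal_pow I m x -> spec_set p x) -> forall x, I x -> spec_set p x.
Proof.
move=> h x Ix; have : spec_set p (\prod_(r <- nseq m x) r).
  apply: h; rewrite -[m in ideal_pow _ m](size_nseq m x); apply: ideal_pow_prod.
  by move=> r /nseqP[->].
elim: m {h} => [|m IHm]; first by rewrite big_nil => /spec_proper.
by rewrite /= big_cons => /spec_prime[].
Qed.

(** If the powers of [I] become stationary, the stable one is generated by an
    idempotent, by Nakayama's lemma. *)
Lemma stable_power_idempotent I N : is_ideal I ->
  (forall x, ideal_pow I N x -> ideal_pow I (N + N) x) ->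
  exists e, [/\ ideal_pow I N e, (1 - e) * e = 0 &
                forall x, ideal_pow I N x -> x = e * x].
Proof.
move=> iI stab; set K := ideal_pow I N in stab *.
have iK : is_ideal K := ideal_pow_ideal I N.
have [n [g [gK gP]]] := noethR iK.
pose J : set R := fun x => exists a : 'I_n -> R, (forall l, K (a l)) /\ x = \sum_l a l * g l.
have iJ : is_ideal J.
  split=> [|x y [a [aK ->]] [b [bK ->]]|c x [a [aK ->]]].
  - exists (fun=> 0); split; first by move=> l; apply: ideal0 iK.
    by rewrite big1 // => l _; rewrite mul0r.
  - exists (fun l => a l + b l); split; first by move=> l; apply: (idealD iK).
    by rewrite -big_split; apply: eq_bigr => l _; rewrite mulrDl.
  - exists (fun l => c * a l); split; first by move=> l; apply: (idealM iK).
    by rewrite mulr_sumr; apply: eq_bigr => l _; rewrite mulrA.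
have KJ x : K x -> J x.
  move=> /stab; apply: ideal_pow_sub => // rs srs rsI.
  have Kt : K (\prod_(r <- take N rs) r).
    have st : size (take N rs) = N by rewrite size_takel // srs leq_addr.
    rewrite /K -{1}st; apply: ideal_pow_prod => r /mem_take; exact: rsI.
  have Kd : K (\prod_(r <- drop N rs) r).
    have sd : size (drop N rs) = N by rewrite size_drop srs addnK.
    rewrite /K -{1}sd; apply: ideal_pow_prod => r /mem_drop; exact: rsI.
  have [c cE] := gP _ Kd.
  exists (fun l => (\prod_(r <- take N rs) r) * c l); split.
    by move=> l; rewrite mulrC; apply: (idealM iK).
  rewrite -{1}(cat_take_drop N rs) big_cat /= cE mulr_sumr.
  by apply: eq_bigr => l _; rewrite mulrA.
have /choice[a aP] : forall k, exists a : 'I_n -> R,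
    (forall l, K (a l)) /\ g k = \sum_l a l * g l by move=> k; apply: KJ.
have B0 : submod ((fun x => x = 0) : set R^o).
  split=> [//|x y -> ->|c x ->]; [exact: addr0 | exact: scaler0].
pose S : set R := fun s => exists2 e, K e & s = 1 - e.
have S1 : S 1 by exists 0; [exact: ideal0 iK | rewrite subr0].
have SM x y : S x -> S y -> S (x * y).
  move=> [e Ke ->] [f Kf ->]; exists (e + f - e * f); last by ring.
  apply: (idealD iK); first exact: (idealD iK).
  by rewrite -mulNr; apply: (idealM iK).
have SB x y : S x -> K y -> S (x - y).
  move=> [e Ke ->] Ky; exists (e + y); first exact: (idealD iK).
  by ring.
have [k l|k|s [e Ke ->] sg] := @nakayama R S K R^o _ n (g : 'I_n -> R^o) (fun=> 1) a
  S1 SM SB iK B0 (fun=> S1).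
- by case: (aP k).
- by rewrite scale1r; have [_ {1}->] := aP k; rewrite subrr.
have eK x : K x -> (1 - e) * x = 0.
  move=> /gP[c ->]; rewrite mulr_sumr big1 // => l _.
  by rewrite mulrCA [(1 - e) * _](sg l) mulr0.
exists e; split=> //; first exact: eK.
by move=> x /eK; rewrite mulrBl mul1r => /subr0_eq.
Qed.

(** ** Connectedness *)

Lemma unit_of_spec x : (forall p : Spec R, ~ spec_set p x) -> exists y, y * x = 1.
Proof.
move=> xp; apply: contrapT => nx.
have iJ : is_ideal ((fun z => exists y, z = y * x) : set R).
  split=> [|z w [y ->] [v ->]|c z [y ->]].
  - by exists 0; rewrite mul0r.
  - by exists (y + v); rewrite mulrDl.
  - by exists (c * y); rewrite mulrA.
have [|p pP] := prime_above iJ; first by move=> [y yE]; apply: nx; exists y.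
by apply: (xp p); apply: pP; exists 1; rewrite mul1r.
Qed.

Lemma connected_idempotent (e : R) : connected [set: Spec R]%classic ->
  (1 - e) * e = 0 -> e = 1 \/ e = 0.
Proof.
move=> conn ee.
pose B : set (Spec R) := fun p => ~ spec_set p e.
have pe (p : Spec R) : spec_set p e \/ spec_set p (1 - e).
  have : spec_set p ((1 - e) * e) by rewrite ee; apply: ideal0 (spec_ideal p).
  by move=> /spec_prime[]; [right | left].
have npe (p : Spec R) : spec_set p e -> spec_set p (1 - e) -> False.
  move=> p1 p2; apply: (@spec_proper _ p); rewrite -[1](subrK e).
  exact: idealD (spec_ideal p) _ _ p2 p1.
have openV x : open ((fun p => ~ spec_set p x) : set (Spec R)).
  exists (fun y => y = x); apply/seteqP; split=> p /=.
    by move=> npx h; apply: npx; apply: h.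
  by move=> h px; apply: h => y ->.
have [[p0 Bp0]|nB] := pselect (exists p, B p).
  left; have BT : B = setT.
    apply: conn; first by exists p0.
      by exists B; [exact: openV | rewrite setTI].
    exists B; last by rewrite setTI.
    rewrite -[B]setCK; apply: open_closedC.
    rewrite (_ : ~` B = (fun p => ~ spec_set p (1 - e)))%classic; first exact: openV.
    apply/seteqP; split=> p /=; first by move=> /contrapT h1 h2; apply: npe h1 h2.
    by move=> h1 h2; case: (pe p).
  have [|y yE] := @unit_of_spec e.
    by move=> p; have : B p by rewrite BT.
  have : y * ((1 - e) * e) = 0 by rewrite ee mulr0.
  by rewrite mulrCA yE mulr1 => /subr0_eq.
right; have [|y yE] := @unit_of_spec (1 - e).
  move=> p h; apply: nB; exists p => pe1; exact: npe pe1 h.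
have : y * ((1 - e) * e) = 0 by rewrite ee mulr0.
by rewrite mulrA yE mul1r.
Qed.

End Ideals.

Section Devissage.
Variable R : comPzRingType.
Variable T : subcat R.
Hypothesis noethR : noetherian_ring R.
Hypothesis triT : triangulated_subcat T.
Hypothesis thickT : thick T.
Implicit Types (V : lmodType R) (I J : set R).

(** * Devissage *)

Lemma T_zero (X : bcomplex R) : (forall i (x : X i), x = 0) -> T X.
Proof.
move=> X0.
have fd i (x : zeroc i) : (\0 : {linear zeroc (i + 1) -> X (i + 1)}) (diff zeroc x) =
  diff X ((\0 : {linear zeroc i -> X i}) x) by rewrite [LHS]X0 [RHS]X0.
apply/(T_qis triT (f := @Cm R zeroc X _ fd)); last exact: tri_zero triT.
by apply: bij_qis => i x; [move=> _; apply: thinmx0 | exists 0; rewrite [LHS]X0 [RHS]X0].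
Qed.

Lemma module_inT_zero V : (forall v : V, v = 0) -> module_inT T V.
Proof.
move=> V0 fgV s; apply: T_zero => i x.
by rewrite -[x]mterm_outK [mterm_out _ _ _]V0 linear0.
Qed.

Lemma line_submod V (h : V) : submod ((fun v => exists r, v = r *: h) : set V).
Proof.
split=> [|_ _ [r ->] [s ->]|a _ [r ->]].
- by exists 0; rewrite scale0r.
- by exists (r + s); rewrite scalerDl.
- by exists (a * r); rewrite scalerA.
Qed.

Lemma ann_ideal V (h : V) : is_ideal ((fun r => r *: h = 0) : set R).
Proof.
split=> [|r s r0 s0|a r r0]; first exact: scale0r.
  by rewrite scalerDl r0 s0 addr0.
by rewrite -scalerA r0 scaler0.
Qed.

Lemma ideal_submod J : is_ideal J -> submod (J : set R^o).
Proof. by case. Qed.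

Lemma cyclic_quo J (iJ : is_ideal J) :
  cyclic_module (proj_quo (ideal_submod iJ) (1 : R^o)) J.
Proof.
split=> [v|r].
  have [r ->] := proj_quo_surj v; exists r.
  by rewrite -linearZZ; congr (proj_quo _ _); rewrite -[RHS]/(r * 1) mulr1.
rewrite -linearZZ -{2}[r]mulr1; exact: proj_quo0.
Qed.

(** The submodule generated by [h] is [R] modulo the annihilator of [h]. *)
Lemma module_inT_line V (h : V) :
  cyclic_inT T (fun r => r *: h = 0) -> module_inT T (quo (line_submod h)) -> module_inT T V.
Proof.
move=> TJ TQ fgV s; have iJ := ann_ideal h.
have Cg := cyclic_quo iJ; have fgC := cyclic_fin_gen Cg.
have hl : linear (fun r : R^o => r *: h).
  by move=> a x y; rewrite scalerDl -scalerA.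
have [f fE] : exists f : {linear quo (ideal_submod iJ) -> V},
    forall r, f (proj_quo _ r) = mkLin hl r.
  apply: factor_surj => [v|r]; first exact: proj_quo_surj.
  by move=> /(proj_quo0 (ideal_submod iJ)).
have fi v : f v = 0 -> v = 0.
  have [r ->] := proj_quo_surj v; rewrite fE => rh.
  exact/(proj_quo0 (ideal_submod iJ)).
have ex v : proj_quo (line_submod h) v = 0 -> exists r, v = f r.
  move=> /(proj_quo0 (line_submod h))[r ->]; exists (proj_quo _ (r : R^o)).
  by rewrite fE.
have gf x : proj_quo (line_submod h) (f x) = 0.
  have [r ->] := proj_quo_surj x; rewrite fE.
  by apply/(proj_quo0 (line_submod h)); exists r.
have fgQ := fin_gen_quo (line_submod h) fgV.
have Qs := @proj_quo_surj _ _ _ (line_submod h).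
have TC : T (modc s fgC) by apply: TJ Cg _ _.
exact: (modc_ses_middle triT fi Qs gf ex _ TC (TQ fgQ s)).
Qed.

(** Noetherian induction on [J]: when [a b] is in [J], the module [R / J] is an
    extension of two cyclic modules with larger annihilators, and a prime that
    contains a power of the annihilator of [G] contains that annihilator. *)
Lemma cyclic_power (G : bcomplex R) (n m : nat) :
  (forall X, T X -> gen_add T G n X) -> T G -> forall J, is_ideal J ->
  (forall x, ideal_pow (fun r => kills r G) m x -> J x) -> cyclic_inT T J.
Proof.
move=> Tgen TG.
apply: (noetherian_induction noethR) => J iJ IH mJ.
have [J1|J1] := pselect (J 1).
  move=> V g [gV annV]; apply: module_inT_zero => v.
  have [r ->] := gV v; apply/annV; rewrite -[r]mulr1; exact: (idealM iJ).
have {}IH J' : is_ideal J' -> (forall x, J x -> J' x) -> (exists2 x, J' x & ~ J x) ->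
    cyclic_inT T J'.
  by move=> iJ' JJ' xJ'; apply: IH => // x /mJ/JJ'.
have [[p pJ]|[a [b [Jab na nb]]]] := prime_or_split iJ J1.
  rewrite -pJ; apply: (prime_step noethR triT thickT Tgen TG) => [r kr|J' iJ' pJ' xJ'].
    by apply: (@ideal_pow_spec _ (fun r => kills r G) m) => // x /mJ; rewrite pJ.
  by apply: IH => //; rewrite -pJ.
move=> V g [gV annV]; apply: (@module_inT_line V (a *: g)).
  apply: IH; first exact: ann_ideal.
    by move=> x Jx; apply/eqP; rewrite scalerA; apply/eqP/annV; rewrite mulrC; apply: (idealM iJ).
  by exists b => //; rewrite scalerA; apply/annV; rewrite mulrC.
pose J' : set R := fun r => exists c, r *: g = c *: (a *: g).
apply: (IH J' _ _ _ _ (proj_quo (line_submod (a *: g)) g)).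
- split=> [|x y [c xE] [d yE]|c x [d xE]].
  + by exists 0; rewrite !scale0r.
  + by exists (c + d); rewrite !scalerDl xE yE.
  + by exists (c * d); rewrite -!scalerA xE scalerA.
- by move=> x Jx; exists 0; rewrite scale0r; apply/annV.
- by exists a => //; exists 1; rewrite scale1r.
split=> [v|r]; last by rewrite -linearZZ; apply: proj_quo0.
have [w ->] := proj_quo_surj v; have [r ->] := gV w.
by exists r; rewrite linearZZ.
Qed.

Lemma module_inT_fin_gen V : (forall J, is_ideal J -> cyclic_inT T J) -> fin_gen V -> module_inT T V.
Proof.
move=> Tcyc [n [g gV]]; elim: n V g gV => [|n IHn] V g gV.
  by apply: module_inT_zero => v; have [c ->] := gV v; rewrite big_ord0.
apply: (@module_inT_line V (g ord0)); first exact/Tcyc/ann_ideal.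
apply: (IHn _ (fun k => proj_quo (line_submod (g ord0)) (g (lift ord0 k)))) => v.
have [w ->] := proj_quo_surj v; have [c ->] := gV w; exists (fun k => c (lift ord0 k)).
rewrite big_ord_recl linearD (proj_quo0 (line_submod _) _).2; last by exists (c ord0).
by rewrite add0r linear_sum; apply: eq_bigr => k _; rewrite linearZZ.
Qed.

(** Brutal truncation: the top term is a subcomplex, and the quotient is
    shorter. *)
Lemma T_of_terms (X : bcomplex R) : (forall V, fin_gen V -> module_inT T V) -> T X.
Proof.
move=> TV; have [a Xa] := bc_below X; have [b Xb] := bc_above X.
have : above (a + `|b - a|%N%:Z) X by move=> i ib x; apply: Xb; lia.
move: (`|b - a|%N) => n {b Xb}.
elim: n X Xa => [|n IHn] X Xa Xb.
  by apply: T_zero => i x; case: (ltP i a) => ia; [apply: Xa | apply: Xb; lia].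
pose m : int := a + n%:Z.
have dm (x : X m) : cd X x = 0 by apply: Xb; rewrite /m; lia.
have [f fE] := @from_modc R m (X m) (@cterm_fg R X m) X idfun dm.
pose N i : set (X i) := fun x => i <> m -> x = 0.
have hN i : submod (@N i).
  split=> // [x y x0 y0|c x x0] im; first by rewrite x0 // y0 // addr0.
  by rewrite x0 // scaler0.
have dN i x : @N i x -> @N (i + 1) (cd X x).
  move=> Nx _; have [im|im] := pselect (i = m); first by move: x {Nx}; rewrite im.
  by rewrite Nx // linear0.
have [Q [q [_ [qs q0]]]] := @quot_cx R X N hN dN.
have Qa : below a Q by move=> i ia y; have [x ->] := qs i y; rewrite (Xa i ia x) linear0.
have Qb : above m Q.
  move=> i im y; have [x ->] := qs i y; apply/q0 => nim.
  by apply: Xb; move: im nim; rewrite /m; lia.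
have [Q' QE] := bcomplexP Qb Qa (fun i => fin_gen_surj (qs i) (@cterm_fg R X i)).
have TQ : T Q' by apply: IHn; rewrite QE.
have fi i x : f i x = 0 -> x = 0.
  have [im|im] := pselect (i = m); last by rewrite (modc0 x im).
  move: x; rewrite im => x; rewrite fE => /= x0.
  by rewrite -[x]mterm_outK x0 linear0.
have gf i x : q i (f i x) = 0.
  by apply/q0 => im; rewrite (modc0 x im) linear0.
have ex i y : q i y = 0 -> exists x, y = f i x.
  move=> /q0 Ny; have [im|im] := pselect (i = m).
    move: y {Ny}; rewrite im => y; exists (mterm_in (m == m) (X m) y).
    by rewrite fE mterm_inK.
  by exists 0; rewrite linear0 Ny.
move: q {q0} qs gf ex; rewrite -QE => q qs gf ex.
apply: (T_ses_middle triT fi qs gf ex) => //.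
exact: TV (@cterm_fg R X m) _ _.
Qed.

End Devissage.

Section Annihilator.
Variable R : comPzRingType.

Lemma kills_ideal (X : bcomplex R) : is_ideal ((fun r => kills r X) : set R).
Proof.
split=> [i x dx|r s kr ks i x dx|a r kr i x dx].
- by exists 0; rewrite scale0r linear0.
- have [y yE] := kr i x dx; have [z zE] := ks i x dx.
  by exists (y + z); rewrite scalerDl yE zE linearD.
- by have [y yE] := kr i x dx; exists (a *: y); rewrite -scalerA yE linearZZ.
Qed.

Lemma kills_modc (s : int) (V : lmodType R) (fgV : fin_gen V) r :
  kills r (modc s fgV) -> forall v : V, r *: v = 0.
Proof.
have -> : s = s - 1 + 1 by rewrite subrK.
move: (s - 1) => {}s kr v; have [//|y] := kr s (mterm_in _ V v).
rewrite -linearZZ [RHS]modc_d => /(congr1 (mterm_out _ V)).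
by rewrite mterm_inK // linear0.
Qed.

Lemma acyclic_diso0 (X : bcomplex R) : kills 1 X -> diso X zeroc.
Proof.
move=> k1.
have fd i (x : zeroc i) : (\0 : {linear zeroc (i + 1) -> X (i + 1)}) (diff zeroc x) =
    diff X ((\0 : {linear zeroc i -> X i}) x).
  by rewrite [RHS](linear0 (@diff R X i)).
apply: (@qis_diso _ zeroc X (@Cm R zeroc X _ fd) _).2 => i.
split=> [x _ _|y dy]; first by exists 0; apply: thinmx0.
exists 0; first by apply: thinmx0.
by have [z zE] := k1 i y dy; exists z; rewrite /= subr0 -zE scale1r.
Qed.

End Annihilator.

Theorem theorem1p1 (R : comPzRingType)
    (noethR : noetherian_ring R)
    (connR : connected [set: Spec R]%classic)
    (T : subcat R)
    (triT : triangulated_subcat T)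
    (thickT : thick T)
    (regT : regular T) :
  (forall F : bcomplex R, T F <-> diso F zeroc) \/
  (forall F : bcomplex R, T F <-> full_Db F).
Proof.
have [G [TG [n TE]]] := regT.
pose I : set R := fun r => kills r G.
have iI : is_ideal I := kills_ideal G.
have Tgen X : T X -> gen_add T G n X by move=> /TE.
have Tcyc m J : is_ideal J -> (forall x, ideal_pow I m x -> J x) -> cyclic_inT T J.
  exact: (cyclic_power noethR triT thickT Tgen TG).
have stable m x : ideal_pow I n.+1 x -> ideal_pow I m x.
  have iJ := ideal_pow_ideal I m.
  apply: ideal_pow_sub => // rs srs rsI.
  have Cg := cyclic_quo iJ.
  have TC := Tcyc m _ iJ (fun x h => h) _ _ Cg (cyclic_fin_gen Cg) 0.
  have kC := kills_gen_add noethR (I := I) (fun r h => h) (Tgen _ TC) srs rsI.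
  by apply/(Cg.2 _).1; apply: kills_modc kC _.
have [e [Ie ee eE]] := stable_power_idempotent noethR iI (stable (n.+1 + n.+1)%N).
have [e1|e0] := connected_idempotent noethR connR ee.
  left=> F; split=> [/Tgen TF|F0]; last first.
    by apply: (tri_iso triT) (tri_zero triT); apply: diso_sym.
  have I1 : I 1.
    rewrite -e1; apply: (ideal_pow_sub iI _ Ie) => -[//|r rs] _ rI.
    by rewrite big_cons mulrC; apply: (idealM iI); apply: rI; rewrite mem_head.
  have := kills_gen_add noethR (I := I) (fun r h => h) TF (size_nseq n.+1 1).
  rewrite big_nseq iter_mulr_1 expr1n => k1; apply: acyclic_diso0; apply: k1.
  by move=> r /nseqP[->].
right=> F; split=> // _; apply: (T_of_terms triT) => V; apply: module_inT_fin_gen => // J iJ.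
apply: (Tcyc n.+1) => // x /eE; rewrite e0 mul0r => ->.
exact: ideal0 iJ.
Qed.
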